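(* Assume the Strong Exponential Time Hypothesis (SETH). Then for every $\delta > 0$ and every $\gamma < 3$ there exists a constant $c > 0$ such that there is no algorithm solving $\gamma$-approximate Bichromatic Closest Pair under the $\ell_\infty$ norm in time $N^{2-\delta}$ on instances of dimension $d = c \log N$, where $N$ is the size of each of the two input sets.
   Context: SETH: for every $\varepsilon > 0$ there exists $k = k(\varepsilon)$ such that $k$-SAT on $n$ variables cannot be solved in time $2^{(1-\varepsilon)n}$. The $\gamma$-approximate Bichromatic Closest Pair problem under the $\ell_p$ norm is the promise problem: given sets $A, B \subset \mathbb{R}^d$, each of size $N$, and numbers $\gamma > 1$, $r > 0$, distinguish between (YES) there exist $a \in A$, $b \in B$ with $\|a-b\|_p \le r$, and (NO) for all $a \in A$, $b \in B$, $\|a-b\|_p \ge \gamma r$. *)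

(* Defs.v *)
From HB Require Import structures.
From mathcomp Require Import all_boot all_order all_algebra.
From mathcomp Require Import all_classical all_reals all_analysis.

Set Implicit Arguments.
Unset Strict Implicit.
Unset Printing Implicit Defensive.

Import Order.TTheory GRing.Theory Num.Theory.
Import numFieldNormedType.Exports.

Local Open Scope ring_scope.

(* Algorithms are deterministic random access programs over unbounded integers
   under the logarithmic cost criterion (every integer that is read, written,
   used as an address or as an operand is charged its bit length).  Up to
   polylogarithmic factors this is the word RAM.  A program uses finitely many
   arrays, named by naturals and indexed by integers; scalar variables are
   arrays used at a fixed index. *)

Inductive binop := OpAdd | OpSub | OpMul | OpDiv.

Inductive expr :=
  | ECst of int
  | EGet of nat & expr          (* EGet a e is a[e] *)
  | EBin of binop & expr & expr.

Inductive prog :=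
  | PSkip
  | PSet of nat & expr & expr   (* PSet a i e is a[i] := e *)
  | PSeq of prog & prog
  | PIf of expr & prog & prog   (* the test e succeeds when 0 < e *)
  | PWhile of expr & prog.

Definition state := nat -> int -> int.

Definition update (s : state) (a : nat) (i v : int) : state :=
  fun a' i' => if (a' == a) && (i' == i) then v else s a' i'.

(* Bit length; 0 counts for one bit, so that every step has a positive cost. *)
Definition bitlen (z : int) : nat := (trunc_log 2 `|z|%N).+1.

Definition binop_val (o : binop) (x y : int) : int :=
  match o with
  | OpAdd => x + y
  | OpSub => x - y
  | OpMul => x * y
  | OpDiv => (x %/ y)%Z
  end.

Fixpoint eval (s : state) (e : expr) : int :=
  match e with
  | ECst z => z
  | EGet a i => s a (eval s i)
  | EBin o e1 e2 => binop_val o (eval s e1) (eval s e2)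
  end.

Fixpoint ecost (s : state) (e : expr) : nat :=
  match e with
  | ECst z => bitlen z
  | EGet a i => (ecost s i + bitlen (eval s i) + bitlen (s a (eval s i)))%N
  | EBin _ e1 e2 =>
      (ecost s e1 + ecost s e2 + bitlen (eval s e1) + bitlen (eval s e2))%N
  end.

(* exec p s t s' : started in s, the program p halts in s' after time t. *)
Inductive exec : prog -> state -> nat -> state -> Prop :=
  | ExecSkip s : exec PSkip s 1 s
  | ExecSet s a i e :
      exec (PSet a i e) s
        (ecost s i + ecost s e + bitlen (eval s i) + bitlen (eval s e))%N
        (update s a (eval s i) (eval s e))
  | ExecSeq p q s t s' t' s'' :
      exec p s t s' -> exec q s' t' s'' -> exec (PSeq p q) s (t + t')%N s''
  | ExecIfTrue e p q s t s' :
      0 < eval s e -> exec p s t s' -> exec (PIf e p q) s (ecost s e + t)%N s'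
  | ExecIfFalse e p q s t s' :
      eval s e <= 0 -> exec q s t s' -> exec (PIf e p q) s (ecost s e + t)%N s'
  | ExecWhileTrue e p s t s' t' s'' :
      0 < eval s e -> exec p s t s' -> exec (PWhile e p) s' t' s'' ->
      exec (PWhile e p) s (ecost s e + t + t')%N s''
  | ExecWhileFalse e p s :
      eval s e <= 0 -> exec (PWhile e p) s (ecost s e) s.

(* The input occupies cells 0, 1, 2, ... of array 0; all other cells are 0. *)
Definition init (x : seq int) : state :=
  fun a i => if a == 0%N then (if i is Posz j then nth 0 x j else 0) else 0.

(* On input x, p halts after t steps with answer b (1 or 0) in cell 0 of
   array 1. *)
Definition answers (p : prog) (x : seq int) (b : bool) (t : nat) : Prop :=
  exists s, exec p (init x) t s /\ s 1%N 0 = b%:Z.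

(* A literal (i, b) is the i-th variable if b, and its negation otherwise. *)
Definition literal (n : nat) := ('I_n * bool)%type.
Definition clause (n : nat) := seq (literal n).
Definition cnf (n : nat) := seq (clause n).

(* A formula is a set of clauses and a clause a set of at most k literals.
   Ruling out repetitions keeps the size of a k-CNF polynomial in n, without
   which no time bound depending on n alone would be meaningful. *)
Definition is_kcnf (k n : nat) (phi : cnf n) : bool :=
  uniq phi && all (fun c : clause n => uniq c && (size c <= k)%N) phi.

Definition satisfiable (n : nat) (phi : cnf n) : bool :=
  [exists v : {ffun 'I_n -> bool},
     all (fun c : clause n => has (fun l : literal n => v l.1 == l.2) c) phi].

Definition encode_literal (n : nat) (l : literal n) : int :=
  if l.2 then l.1.+1%:Z else - l.1.+1%:Z.

Definition encode_clause (n : nat) (c : clause n) : seq int :=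
  (size c)%:Z :: [seq encode_literal l | l <- c].

Definition encode_cnf (n : nat) (phi : cnf n) : seq int :=
  [:: n%:Z, (size phi)%:Z & flatten [seq encode_clause c | c <- phi]].

(* p solves k-SAT in time O(2^((1 - eps) n)). *)
Definition solves_kSAT (R : realType) (k : nat) (eps : R) (p : prog) : Prop :=
  exists C : R, forall (n : nat) (phi : cnf n), is_kcnf k phi ->
    exists t : nat, answers p (encode_cnf phi) (satisfiable phi) t /\
      t%:R <= C * 2 `^ ((1 - eps) * n%:R).

Definition SETH (R : realType) : Prop :=
  forall eps : R, 0 < eps ->
    exists k : nat, ~ exists p : prog, solves_kSAT k eps p.

(* Input points have rational coordinates, so that they can be written down;
   they are regarded as points of R^d, where the norm `|_| on row vectors is
   the sup norm. *)
Definition real_point (R : realType) (d : nat) (a : 'rV[rat]_d) : 'rV[R]_d :=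
  map_mx ratr a.

Definition dist_infty (R : realType) (d : nat) (a b : 'rV[rat]_d) : R :=
  `|real_point R a - real_point R b|.

Definition bcp_instance (N d : nat) (A B : seq 'rV[rat]_d) (r : rat) : bool :=
  [&& uniq A, size A == N, uniq B, size B == N & 0 < r].

Definition bcp_yes (R : realType) (d : nat)
    (A B : seq 'rV[rat]_d) (r : rat) : Prop :=
  exists a b, [/\ a \in A, b \in B & dist_infty R a b <= ratr r].

Definition bcp_no (R : realType) (gamma : R) (d : nat)
    (A B : seq 'rV[rat]_d) (r : rat) : Prop :=
  forall a b, a \in A -> b \in B -> gamma * ratr r <= dist_infty R a b.

Definition encode_rat (x : rat) : seq int := [:: numq x; denq x].

Definition encode_point (d : nat) (a : 'rV[rat]_d) : seq int :=
  flatten [seq encode_rat (a 0 i) | i <- enum 'I_d].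

Definition encode_bcp (N d : nat) (A B : seq 'rV[rat]_d) (r : rat) : seq int :=
  [:: N%:Z, d%:Z & encode_rat r] ++ flatten [seq encode_point a | a <- A]
    ++ flatten [seq encode_point b | b <- B].

(* Numerator and denominator have O(kappa log N) bits. *)
Definition short_rat (kappa N : nat) (x : rat) : bool :=
  (`|numq x| <= N.+1 ^ kappa)%N && (`|denq x| <= N.+1 ^ kappa)%N.

Definition short_instance (kappa N d : nat)
    (A B : seq 'rV[rat]_d) (r : rat) : bool :=
  short_rat kappa N r &&
  all (fun a : 'rV[rat]_d => [forall i, short_rat kappa N (a 0 i)]) (A ++ B).

(* p solves gamma-approximate bichromatic closest pair under the sup norm, on
   instances of dimension floor (c ln N), in time O(N^(2 - delta)).  As usual
   numbers are assumed to have O(log N) bits, as otherwise the input could not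
   even be read within a bound depending on N alone.  This is the role of
   kappa: every instance is short for some kappa (so p must be correct on all
   of them), and the constant in the time bound may depend on kappa. *)
Definition solves_bcp (R : realType) (gamma delta c : R) (p : prog) : Prop :=
  forall kappa : nat, exists C : R,
  forall (N d : nat) (A B : seq 'rV[rat]_d) (r : rat),
    (0 < N)%N -> d = Num.truncn (c * ln (N%:R : R)) ->
    bcp_instance N A B r -> short_instance kappa N A B r ->
    let answers_in_time (b : bool) :=
      exists t : nat, answers p (encode_bcp N A B r) b t /\
        t%:R <= C * N%:R `^ (2 - delta) in
    (bcp_yes R A B r -> answers_in_time true) /\
    (bcp_no gamma A B r -> answers_in_time false).

(* Main.v *)
(* A k-CNF formula on n variables is turned into a single closest pair instance
   with N about 2^(n/2) points per side.

   Gap 3.  For bits a and b, map a = 1, 0 to 0, 2N and b = 0, 1 to N, 3N.  The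
   distance is N unless a = b = 1, when it is 3N.  If coordinate j says on side A
   (resp. B) whether the j-th clause is falsified by the first (resp. second)
   half of an assignment, then a pair of points is at sup distance N when the
   combined assignment is satisfying, and 3N otherwise.

   Dimension O(log N).  The clauses are first made few by the sparsification
   lemma of Impagliazzo, Paturi and Zane: as long as many clauses of one size
   share a common part H (a flower), branch on adding H or all the remainders
   C \ H.  A potential shows that remainder branches are so rare that a path to a
   leaf is described by eta n bits.  These bits s are made part of the points,
   x = (s, half assignment), and one more coordinate, 4Ns + x, keeps points with
   different s at distance at least 3N.  An arbitrary s is harmless: if it does
   not lead to a leaf, then its points on side A are moved away from side B.

   The reduction is written in a small language of expressions with bounded sums
   and of counted loops, compiled to the random access machine together with a
   cost bound; the closest pair program is then run on arrays with shifted
   names. *)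

(* The dimension is prescribed by [N] as [c ln N], linear in n, while a k-CNF may have about n^k
   clauses; hence the need for sparsification. Solving one closest pair instance per leaf would run
   the given program many times, on a memory that it may leave in any state. So all leaves share one
   instance and the program runs once; the price is that a path must be named by few bits. A path is
   cut into tokens. A token is the number of hearts taken before the petals, at most W =
   alpha^(2k-1). A heart raises the potential by at least 1 and petals by at least W, so a token
   reaches a leaf or raises the potential by W. The potential never exceeds 3kM alpha^(2k-2) with M
   = 2n+1, so about 3kM/alpha tokens of w = O(k log alpha) bits suffice, and eta = 6kw/alpha tends
   to 0 as alpha grows. Thus N = 2^((1/2+eta)n + O(1)). Writing the instance takes N poly(n) steps,
   and the closest pair program O(N^(2-delta)), which is O(2^((1-delta/4)n)) as soon as eta <=
   delta/8. *)
Require Import Defs.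
From mathcomp Require Import all_boot zify.

Set Implicit Arguments.
Unset Strict Implicit.
Unset Printing Implicit Defensive.

(** * Sparsification *)

Section Sparsify.
Variables (E : finType) (k alpha : nat).
Hypotheses (k_gt0 : 0 < k) (alpha_ge : 4 * k <= alpha).
Implicit Types (F G N : {set {set E}}) (C D H : {set E}).

(* [theta i] clauses with a common part make a flower when [i] is the size of
   their remainders; the weights balance theta, [theta i * (weight i / 2)] being
   [alpha ^ (2 * k - 1)] for every [i]. *)
Definition theta i := alpha ^ i.*2.-1.
Definition weight i := 2 * alpha ^ (k - i).*2.
Definition deg F H c := #|[set C in F | (#|C| == c) && (H \subset C)]|.
Definition flower F H c :=
  [&& 0 < #|H|, #|H| < c, c <= k & theta (c - #|H|) <= deg F H c].
(** Smallest clauses first, and among them the largest heart. The first choice keeps the smaller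
    sizes free of flowers, so new clauses of size [j < c] meet degrees below [theta]. The second
    bounds the petals through a common part, which would otherwise yield a flower with a larger
    heart. *)
Definition min_flower F H c := flower F H c /\
  forall H' c', flower F H' c' -> c < c' \/ c = c' /\ #|H'| <= #|H|.
Definition petals F H c :=
  [set C :\: H | C in [set C in F | (#|C| == c) && (H \subset C)]].
Definition upd F N :=
  N :|: [set C in F | ~~ [exists D in N, D \subset C]].
Definition antichain F := forall C D, C \in F -> D \in F -> C \subset D -> C = D.
Definition potential G := \sum_(C in G) weight #|C|.
(* [G] is the set of clauses of [F] that were added by branching. *)
Definition sp_inv F G := [/\ antichain F, G \subset F,
  forall C, C \in F -> #|C| <= k,
  set0 \notin G &
  forall H i, 0 < #|H| -> #|H| < i <= k -> deg G H i <= 2 * theta (i - #|H|)].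
Definition sat (v : pred E) F := [forall C in F, [exists e in C, v e]].

Lemma alpha_gt0 : 0 < alpha. Proof. by lia. Qed.

Lemma sum_by_size (P : pred {set E}) (f : nat -> nat) :
  (forall C, P C -> #|C| <= k) ->
  \sum_(C | P C) f #|C| = \sum_(i < k.+1) #|[set C | P C & #|C| == i]| * f i.
Proof.
move=> Pk; rewrite (partition_big (fun C => inord #|C| : 'I_k.+1) predT) //=.
apply: eq_bigr => i _; rewrite -sum_nat_const.
apply: eq_big => [C|C /andP[PC /eqP <-]]; last by rewrite inordK // ltnS Pk.
rewrite inE; case PC: (P C) => //=.
by apply/eqP/eqP => [<-|ci]; [rewrite inordK // ltnS Pk | apply: val_inj; rewrite /= ci inord_val].
Qed.

Lemma deg_sub F G H c : F \subset G -> deg F H c <= deg G H c.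
Proof.
move=> FG; apply/subset_leq_card/subsetP => C; rewrite !inE => /andP[CF ->].
by rewrite (subsetP FG).
Qed.

Lemma deg_setU F G H c : deg (F :|: G) H c <= deg F H c + deg G H c.
Proof.
apply: leq_trans (leq_card_setU _ _); apply/subset_leq_card/subsetP => C.
by rewrite !inE andb_orl.
Qed.


(** Double counting of the pairs of a clause and one of its elements. *)
Lemma card_size_bound F i b : 0 < i ->
  (forall e : E, deg F [set e] i <= b) ->
  #|[set C | C \in F & #|C| == i]| <= #|E| * b.
Proof.
move=> i0 hb.
have -> : #|E| * b = \sum_(e : E) b by rewrite sum_nat_const.
apply: leq_trans (leq_sum _ (fun e _ => hb e)).
rewrite /deg; under eq_bigr => e _ do rewrite -sum1_card.
rewrite (exchange_big_dep (fun C => C \in [set C | C \in F & #|C| == i])) /=; last first.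
  by move=> e C _; rewrite !inE => /and3P[-> ->].
rewrite -sum1_card; apply: leq_sum => C; rewrite inE => /andP[CF /eqP ci].
have /card_gt0P[e eC] : 0 < #|C| by rewrite ci.
by rewrite (bigD1 e) ?leq_addr // !inE CF ci eqxx sub1set.
Qed.

(** The right side is independent of [i]: all clause sizes above [j] contribute equally in
    [potential_superset]. *)
Lemma theta_weight i j : j < i <= k ->
  2 * theta (i - j) * weight i = 4 * alpha ^ (k - j).*2.-1.
Proof.
move=> /andP[ji ik]; rewrite /theta /weight mulnACA -expnD -!muln2.
by congr (_ * _ ^ _); lia.
Qed.

(* Adding a clause [D] kills only clauses of total weight at most half of its own. *)
Lemma potential_superset F G D j : sp_inv F G -> #|D| = j -> 0 < j ->
  (forall C, C \in G -> D \subset C -> j < #|C|) ->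
  \sum_(C in G | D \subset C) weight #|C| <= alpha ^ (k - j).*2.
Proof.
move=> [_ GF Fk _ Gdeg] Dj j0 prD.
have [jk|kj] := ltnP j k; last first.
  rewrite big_pred0 // => C; apply/negP => /andP[CG DC].
  by have := prD C CG DC; have := Fk C (subsetP GF _ CG); lia.
rewrite sum_by_size; last by move=> C /andP[/(subsetP GF) /Fk].
apply: (@leq_trans (\sum_(i < k.+1) (j < i) * (4 * alpha ^ (k - j).*2.-1))).
  apply: leq_sum => i _; case: ltnP => [ji|ij].
    have ik : i <= k by rewrite -ltnS.
    rewrite mul1n -(@theta_weight i j) ?ji // leq_mul2r; apply/orP; right.
    rewrite -Dj; apply: leq_trans (Gdeg D i _ _); rewrite ?Dj ?ji //.
    by apply/subset_leq_card/subsetP => C; rewrite !inE => /andP[/andP[-> ->] ->].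
  rewrite mul0n leqn0 muln_eq0 cards_eq0; apply/orP; left; apply/eqP/setP => C.
  rewrite !inE; apply/negP => /andP[/andP[CG DC] /eqP ci].
  by have := prD C CG DC; lia.
rewrite -big_distrl /=.
have -> : \sum_(i < k.+1) (j < i : nat) = k - j.
  rewrite -[k.+1](subnKC (_ : j.+1 <= k.+1)) 1?ltnW // big_split_ord /=.
  rewrite big1 => [|i _]; last by have := ltn_ord i; lia.
  under eq_bigr => i _ do rewrite (_ : j < _ = true) ?addSn ?ltnS ?leq_addr //.
  by rewrite sum_nat_const card_ord; lia.
(* There are [k - j] sizes, and [4 * (k - j) <= alpha] absorbs their number and the factor 4 into
   one more power of [alpha]. *)
rewrite -(@prednK (k - j).*2) /= ?double_gt0 ?subn_gt0 //.
rewrite expnS mulnA leq_mul2r; apply/orP; right; lia.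
Qed.

(** Shared by both branches, [N] being the heart alone or all the petals. The weight of [N] is twice
    [#|N| * alpha ^ (k - j).*2]: one half pays for the clauses that [N] kills, by
    [potential_superset], and the other half is the gain. *)
Lemma sp_step F G N j c : sp_inv F G -> 0 < j -> j < c -> c <= k ->
  (forall D, D \in N -> #|D| = j) ->
  (forall D, D \in N -> exists2 C, C \in F & D \proper C) ->
  (forall H, 0 < #|H| -> #|H| < j -> deg F H j < theta (j - #|H|)) ->
  (forall H, 0 < #|H| -> #|H| < j -> deg N H j <= theta (j - #|H|)) ->
  sp_inv (upd F N) (upd G N) /\
  potential G + #|N| * alpha ^ (k - j).*2 <= potential (upd G N).
Proof.
move=> inv j0 jc ck Nj Npr dF dN; have [aF GF Fk G0 Gdeg] := inv.
have NF D C : D \in N -> C \in F -> D \subset C -> D \proper C.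
  move=> DN CF DC; rewrite properEneq DC andbT; apply/eqP => DC'.
  have [C' C'F] := Npr _ DN; rewrite DC' => pr.
  have := aF _ _ CF C'F (proper_sub pr) => CC'.
  by move: pr; rewrite CC' properxx.
have NF' D C : D \in N -> C \in F -> ~~ (C \subset D).
  move=> DN CF; apply/negP => CD; have [C' C'F pr] := Npr _ DN.
  have CC' := aF _ _ CF C'F (subset_trans CD (proper_sub pr)).
  by move: pr; rewrite -CC' properE CD andbF.
split.
  split.
  - move=> C D; rewrite !inE => /orP[CN|/andP[CF CN]] /orP[DN|/andP[DF DN]] CD.
    + by apply/eqP; rewrite eqEcard CD (Nj _ CN) (Nj _ DN) leqnn.
    + by case/negP: DN; apply/existsP; exists C; rewrite CN.
    + by case/negP: (NF' _ _ DN CF).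
    + exact: aF.
  - apply/setUS/subsetP => C; rewrite !inE => /andP[CG ->].
    by rewrite (subsetP GF).
  - move=> C; rewrite !inE => /orP[/Nj ->|/andP[/Fk //]]; lia.
  - rewrite !inE negb_or negb_and G0 orTb andbT.
    by apply/negP => /Nj; rewrite cards0; lia.
  - move=> H i H0 Hi.
    have kG : [set C in G | ~~ [exists D in N, D \subset C]] \subset G.
      by apply/subsetP => C; rewrite inE => /andP[].
    apply: leq_trans (deg_setU _ _ _ _) _.
    have [eij|nij] := eqVneq i j; last first.
      rewrite (_ : deg N H i = 0) ?add0n.
        exact: leq_trans (deg_sub _ _ kG) (Gdeg _ _ H0 Hi).
      apply/eqP; rewrite cards_eq0; apply/eqP/setP => C; rewrite !inE.
      by apply/negP => /and3P[/Nj -> /eqP e _]; rewrite e eqxx in nij.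
    (* This is the origin of the factor 2 in [sp_inv]: one [theta] for the members of [N], one for
       the old clauses, which form no flower of size [j]. *)
    rewrite eij mul2n -addnn in Hi *; case/andP: Hi => Hj _; apply: leq_add; first exact: dN.
    apply: leq_trans (deg_sub _ _ kG) _; apply: leq_trans (deg_sub _ _ GF) _.
    exact/ltnW/dF.
have NG : [disjoint N & G].
  apply/pred0P => D /=; apply/negP => /andP[DN /(subsetP GF) DF].
  by case/negP: (NF' _ _ DN DF).
pose killed := [set C in G | [exists D in N, D \subset C]].
pose kept := [set C in G | ~~ [exists D in N, D \subset C]].
have eG : potential G = potential killed + potential kept.
  rewrite /potential (bigID (fun C => [exists D in N, D \subset C])) /=.
  by congr (_ + _); apply: eq_bigl => C; rewrite !inE.
have eU : potential (upd G N) = #|N| * weight j + potential kept.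
  have dis : [disjoint N & kept].
    by apply: disjointWr NG; apply/subsetP => C; rewrite inE => /andP[].
  rewrite /potential /upd -/kept (eq_bigl (fun C => C \in [predU N & kept])).
    rewrite bigU //=.
    by congr (_ + _); rewrite -sum_nat_const; apply: eq_bigr => C /Nj ->.
  by move=> C; rewrite !inE.
rewrite eG eU -addnA [_ kept + _]addnC addnA leq_add2r.
have -> : #|N| * weight j = #|N| * alpha ^ (k - j).*2 + #|N| * alpha ^ (k - j).*2.
  by rewrite /weight; lia.
rewrite leq_add2r.
(* Every killed clause contains some member of [N], so it is counted at least once in this double
   sum. *)
apply: (@leq_trans (\sum_(D in N) \sum_(C in G | D \subset C) weight #|C|)); last first.
  rewrite -sum_nat_const; apply: leq_sum => D DN.
  apply: (potential_superset inv (Nj _ DN) j0) => C CG DC.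
  by rewrite -(Nj _ DN); apply/proper_card/NF => //; exact: (subsetP GF).
rewrite (exchange_big_dep (fun C => C \in G)) /=; last by move=> D C _ /andP[].
rewrite /potential [X in X <= _](_ : _ = \sum_(C in G | [exists D in N, D \subset C]) weight #|C|); last first.
  by apply: eq_bigl => C; rewrite inE.
rewrite big_mkcondr /=; apply: leq_sum => C CG.
case: ifP => // /existsP[D /andP[DN DC]].
by rewrite (bigD1 D) /= ?leq_addr // DN CG.
Qed.

Lemma min_flower_small F H c H' c' : min_flower F H c ->
  0 < #|H'| -> #|H'| < c' -> c' <= k -> c' < c \/ c' = c /\ #|H| < #|H'| ->
  deg F H' c' < theta (c' - #|H'|).
Proof.
move=> [_ mn] h0 h1 h2 h3; rewrite ltnNge; apply/negP => h4.
have /mn : flower F H' c' by apply/and4P.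
by lia.
Qed.

Lemma sp_heart F G H c : sp_inv F G -> min_flower F H c ->
  sp_inv (upd F [set H]) (upd G [set H]) /\
  potential G + 1 <= potential (upd G [set H]).
Proof.
move=> inv fl; have [/and4P[H0 Hc ck hdeg] mn] := fl.
have [D|D|H' h0 h1|H' h0 h1|I P] := sp_step (N := [set H]) inv H0 Hc ck.
- by rewrite inE => /eqP ->.
- rewrite inE => /eqP ->.
  have /card_gt0P[C] : 0 < deg F H c.
    by apply: leq_trans hdeg; rewrite expn_gt0 alpha_gt0.
  rewrite inE => /and3P[CF /eqP Cc HC]; exists C => //.
  by rewrite properEcard HC Cc.
- by apply: (min_flower_small fl) => //; lia.
- apply: (@leq_trans 1); last by rewrite expn_gt0 alpha_gt0.
  rewrite -(cards1 H); apply/subset_leq_card/subsetP => C.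
  by rewrite inE => /andP[].
split=> //; apply: leq_trans P.
by rewrite leq_add2l cards1 mul1n expn_gt0 alpha_gt0.
Qed.

Lemma card_petals F H c : #|petals F H c| = deg F H c.
Proof.
rewrite card_in_imset // => C D; rewrite !inE => /and3P[_ _ HC] /and3P[_ _ HD] e.
by rewrite -(setID C H) -(setID D H) e (setIidPr HC) (setIidPr HD).
Qed.

(** At least [theta i] petals of size [i], with a gain of [alpha ^ (k - i).*2] each, give
    [alpha ^ k.*2.-1] whatever [i] is. *)
Lemma sp_petals F G H c : sp_inv F G -> min_flower F H c ->
  sp_inv (upd F (petals F H c)) (upd G (petals F H c)) /\
  potential G + alpha ^ k.*2.-1 <= potential (upd G (petals F H c)).
Proof.
move=> inv fl; have [/and4P[H0 Hc ck hdeg] mn] := fl.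
have szP C : #|C| = c -> H \subset C -> #|C :\: H| = c - #|H|.
  by move=> <- HC; rewrite cardsD (setIidPr HC).
have j0 : 0 < c - #|H| by lia.
have jc : c - #|H| < c by lia.
have [D|D|H' h0 h1|H' h0 h1|I P] := sp_step (N := petals F H c) inv j0 jc ck.
- by move=> /imsetP[C]; rewrite inE => /and3P[CF /eqP Cc HC] ->; exact: szP.
- move=> /imsetP[C]; rewrite inE => /and3P[CF /eqP Cc HC] ->; exists C => //.
  by rewrite properEcard subsetDl szP // Cc.
- by apply: (min_flower_small fl) => //; lia.
(* Petals avoid [H], so only an [H'] disjoint from [H] lies in any. Petals through it come from
   clauses through [H :|: H'], and a heart larger than [H] has small degree by the choice of [H]. *)
- have [/eqP dHH|nd] := boolP (H' :&: H == set0); last first.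
    rewrite (_ : deg _ _ _ = 0) //; apply/eqP; rewrite cards_eq0; apply/eqP/setP => D.
    rewrite !inE; apply/negP => /and3P[/imsetP[C _ ->] _].
    rewrite subsetD => /andP[_]; by rewrite -setI_eq0 (negPf nd).
  have cHH : #|H :|: H'| = #|H| + #|H'| by rewrite cardsU setIC dHH cards0 subn0.
  apply: (@leq_trans (deg F (H :|: H') c)); last first.
    have -> : c - #|H| - #|H'| = c - #|H :|: H'| by lia.
    by apply/ltnW/(min_flower_small fl) => //; lia.
  apply: leq_trans (leq_imset_card (fun C => C :\: H) _).
  apply/subset_leq_card/subsetP => D; rewrite inE.
  move=> /and3P[/imsetP[C]]; rewrite inE => /and3P[CF Cc HC] -> _ HD.
  apply/imsetP; exists C => //; rewrite inE CF Cc subUset HC /=.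
  exact: subset_trans HD (subsetDl _ _).
split=> //; apply: leq_trans P; rewrite leq_add2l card_petals.
apply: (@leq_trans (theta (c - #|H|) * alpha ^ (k - (c - #|H|)).*2)).
  by rewrite /theta -expnD leq_pexp2l ?alpha_gt0 // -!muln2; lia.
by rewrite leq_mul2r hdeg orbT.
Qed.

(** Singletons give at most [#|E|] times [2 * alpha ^ (k.-1).*2]. By the degree bound at single
    elements, each larger size gives at most [4 * #|E| * alpha ^ (k.-1).*2.-1], and all of them
    together one more [#|E| * alpha ^ (k.-1).*2], as [4 * k <= alpha]. *)
Lemma potential_bound F G : sp_inv F G ->
  potential G <= 3 * #|E| * alpha ^ (k.-1).*2.
Proof.
move=> [_ GF Fk G0 Gdeg].
rewrite /potential sum_by_size; last by move=> C /(subsetP GF) /Fk.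
rewrite big_ord_recl /= -[X in X * _](_ : 0 = _) ?mul0n ?add0n; last first.
  apply/esym/eqP; rewrite cards_eq0; apply/eqP/setP => C; rewrite !inE cards_eq0.
  by apply/negP => /andP[CG /eqP e]; rewrite -e CG in G0.
have [k' ek] : exists k', k = k'.+1 by exists k.-1; lia.
have a0 := alpha_gt0.
pose f i := #|[set C | C \in G & #|C| == i]| * weight i.
rewrite (_ : \sum_(i < k) _ = \sum_(i < k'.+1) f i.+1); last by rewrite -ek.
rewrite {}/f [in k.-1]ek big_ord_recl /=.
have -> : 3 * #|E| * alpha ^ k'.*2 = #|E| * (2 * alpha ^ k'.*2) + #|E| * alpha ^ k'.*2 by lia.
apply: leq_add.
  rewrite /weight ek subSS subn0 leq_mul2r; apply/orP; right.
  have := @card_size_bound G 1 1 isT; rewrite muln1; apply => e.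
  rewrite -[leqRHS](cards1 [set e]); apply/subset_leq_card/subsetP => C.
  rewrite inE => /and3P[_ C1 eC]; have [x Cx] := cards1P C1.
  by move: eC; rewrite Cx sub1set !inE => /eqP ->.
apply: (@leq_trans (\sum_(i < k') #|E| * (4 * alpha ^ k'.*2.-1))).
  apply: leq_sum => i _; 
  have i1 : 0 < i.+2 by [].
  apply: leq_trans (leq_mul (@card_size_bound G _ (2 * theta i.+1) i1 _) (leqnn _)) _.
    move=> e; have := Gdeg [set e] i.+2; rewrite cards1 subSS subn0; apply => //.
    by have := ltn_ord i; lia.
  rewrite -mulnA leq_mul2l; apply/orP; right.
  rewrite /theta /weight mulnACA -expnD.
  have -> // : i.+1.*2.-1 + (k - i.+2).*2 = k'.*2.-1.
  by have := ltn_ord i; rewrite -!muln2; lia.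
rewrite sum_nat_const card_ord; case: k' ek => [|k'] ek; first by rewrite mul0n.
rewrite mulnCA leq_mul2l; apply/orP; right.
rewrite mulnA doubleS /= [in X in _ <= X]expnS leq_mul2r; apply/orP; right; lia.
Qed.

(** The terms 1 and [#|E|] stand for the empty clause and the singletons. Larger sizes are
    controlled by the degrees of single elements, because no [[set e]] is the heart of a flower. *)
Lemma leaf_bound F : (forall C, C \in F -> #|C| <= k) ->
  (forall H c, ~~ flower F H c) -> #|F| <= 1 + #|E| * (1 + k * theta k).
Proof.
move=> Fk nofl.
have -> : #|F| = \sum_(C in F) 1 by rewrite sum1_card.
rewrite (@sum_by_size (mem F) (fun=> 1) Fk) big_ord_recl /=.
apply: leq_add.
  rewrite muln1 -(cards1 (set0 : {set E})); apply/subset_leq_card/subsetP => C.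
  by rewrite !inE cards_eq0 => /andP[].
have [k' ek] : exists k', k = k'.+1 by exists k.-1; lia.
have a0 := alpha_gt0.
pose f i := #|[set C | C \in F & #|C| == i]| * 1.
rewrite (_ : \sum_(i < k) _ = \sum_(i < k'.+1) f i.+1); last by rewrite -ek.
rewrite {}/f [in X in _ <= X]ek big_ord_recl /=.
rewrite mulnDr; apply: leq_add.
  rewrite muln1.
  apply: card_size_bound => // e; rewrite -[leqRHS](cards1 [set e]); apply/subset_leq_card/subsetP => C.
  rewrite inE => /and3P[_ C1 eC]; have [x Cx] := cards1P C1.
  by move: eC; rewrite Cx sub1set !inE => /eqP ->.
apply: (@leq_trans (\sum_(i < k') #|E| * theta k'.+1)); last first.
  by rewrite sum_nat_const card_ord mulnCA leq_mul2l mulSn leq_addl orbT.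
apply: leq_sum => i _; rewrite muln1; apply: card_size_bound => // e.
have := nofl [set e] i.+2; rewrite /flower cards1 [in _ <= k]ek /= !ltnS ltn_ord /= -ltnNge subSS subn0.
move=> h; apply: ltnW (leq_trans h _).
rewrite /theta leq_pexp2l // -!muln2; have := ltn_ord i; lia.
Qed.

(** An update only strengthens the formula, since a dropped clause contains an added one. Hence
    every path is sound, and only completeness depends on the choice of branches. *)
Lemma sat_upd v F N : (forall D, D \in N -> exists2 C, C \in F & D \proper C) ->
  sat v (upd F N) -> sat v F.
Proof.
move=> Npr /forallP sU; apply/forallP => C; apply/implyP => CF.
have [/existsP[D /andP[DN DC]]|nk] := boolP [exists D in N, D \subset C].
  have := sU D; rewrite !inE DN /= => /existsP[e /andP[eD ve]].
  by apply/existsP; exists e; rewrite (subsetP DC).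
by have := sU C; rewrite !inE CF nk orbT.
Qed.

Lemma sat_updW v F N : sat v F -> sat v N -> sat v (upd F N).
Proof.
move=> /forallP sF /forallP sN; apply/forallP => C; apply/implyP.
by rewrite !inE => /orP[CN|/andP[CF _]]; [have := sN C; rewrite CN | have := sF C; rewrite CF].
Qed.

(** When the heart is falsified, the true literal of each clause through it lies in the
    remainder. *)
Lemma sat_branch v F H c : sat v F -> ~~ sat v [set H] -> sat v (petals F H c).
Proof.
move=> /forallP sF nH; apply/forallP => D; apply/implyP => /imsetP[C].
rewrite inE => /and3P[CF _ HC] ->.
have := sF C; rewrite CF /= => /existsP[e /andP[eC ve]].
apply/existsP; exists e; rewrite inE eC ve !andbT; apply: contra nH => eH.
apply/forallP => H'; apply/implyP; rewrite inE => /eqP ->.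
by apply/existsP; exists e; rewrite eH.
Qed.

End Sparsify.

(** * Clauses coded as numbers *)

Definition dig (M c i : nat) := c %/ M ^ i %% M.
Definition code_of (M k : nat) (f : nat -> nat) := \sum_(i < k) f i * M ^ i.

Lemma code_of_bound M k f : 0 < M -> (forall i, i < k -> f i < M) ->
  code_of M k f < M ^ k.
Proof.
move=> M0; elim: k => [|k IH] hf; first by rewrite /code_of big_ord0.
rewrite /code_of big_ord_recr /= -/(code_of M k f) expnS.
have h1 := IH (fun i ik => hf i (ltnW ik)); have h2 := hf k (leqnn _).
apply: leq_trans (_ : (f k).+1 * M ^ k <= _); first by rewrite mulSn -addSn leq_add2r.
by rewrite leq_mul2r h2 orbT.
Qed.

Lemma dig_code_of M k f i : 0 < M -> (forall i, i < k -> f i < M) -> i < k ->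
  dig M (code_of M k f) i = f i.
Proof.
move=> M0 hf; elim: k hf => // k IH hf; rewrite ltnS leq_eqVlt => /orP[/eqP ->|ik].
  rewrite /dig /code_of big_ord_recr /= -/(code_of M k f) addnC divnMDl ?expn_gt0 ?M0 //.
  rewrite divn_small ?addn0 ?modn_small ?hf //.
  by apply: code_of_bound => // j jk; apply: hf; apply: ltnW.
have hf' j : j < k -> f j < M by move=> jk; apply: hf; apply: ltnW.
rewrite -[RHS](IH hf' ik) /dig /code_of big_ord_recr /= -/(code_of M k f).
have -> : f k * M ^ k = f k * M ^ (k - i).-1 * M * M ^ i.
  by rewrite -!mulnA -expnS -expnD; congr (_ * _ ^ _); lia.
by rewrite addnC divnMDl ?expn_gt0 ?M0 // modnMDl.
Qed.

Lemma dig_ltn M c i : 0 < M -> dig M c i < M.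
Proof. exact: ltn_pmod. Qed.

Lemma code_of_dig M k c : 0 < M -> c < M ^ k -> code_of M k (dig M c) = c.
Proof.
move=> M0; elim: k c => [|k IH] c hc; first by rewrite /code_of big_ord0; lia.
rewrite /code_of big_ord_recr /= -/(code_of M k _).
have e : code_of M k (dig M c) = code_of M k (dig M (c %% M ^ k)).
  apply: eq_bigr => i _; congr (_ * _); rewrite /dig.
  rewrite {1}(divn_eq c (M ^ k)).
  have -> : c %/ M ^ k * M ^ k = c %/ M ^ k * M ^ (k - i).-1 * M * M ^ i.
    rewrite -!mulnA -expnS -expnD; congr (_ * _ ^ _); have := ltn_ord i; lia.
  by rewrite divnMDl ?expn_gt0 ?M0 // modnMDl.
rewrite e IH ?ltn_pmod ?expn_gt0 ?M0 // [RHS](divn_eq c (M ^ k)) addnC; congr (_ * _ + _).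
by rewrite /dig modn_small // ltn_divLR ?expn_gt0 ?M0 // -expnS.
Qed.

Lemma code_of_ext M k f g : (forall i, i < k -> f i = g i) -> code_of M k f = code_of M k g.
Proof. by move=> h; apply: eq_bigr => i _; rewrite h. Qed.

(** Bounded quantifiers are written as sums, the only iteration available in the expressions of the
    program. *)
Lemma exists_sum n (b : pred nat) : (0 < \sum_(i < n) b i) = [exists i : 'I_n, b i].
Proof.
rewrite lt0n sum_nat_eq0 negb_forall; apply: eq_existsb => i /=.
by rewrite eqb0 negbK.
Qed.

Section Codes.
Variables (M k alpha : nat).
Hypotheses (M_gt0 : 0 < M) (k_gt0 : 0 < k) (alpha_ge : 4 * k <= alpha).
Notation E := ('I_k * 'I_M)%type.
Notation U := (M ^ k).
Notation dig := (dig M).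
Notation theta := (theta alpha).
Implicit Types (f : nat -> bool).

(* The code [c] stands for the clause with the literal [dig c i] at position [i],
   the digit 0 marking an absent literal. *)
Definition cset (c : nat) : {set E} := [set e : E | (0 < e.2) && (dig c e.1 == e.2)].
Definition csize (c : nat) := \sum_(i < k) (0 < dig c i).
Definition csub (h c : nat) := \sum_(i < k) ((dig h i == 0) || (dig h i == dig c i)) == k.
Definition cdiff (c h : nat) := \sum_(i < k) (dig h i == 0) * dig c i * M ^ i.

Lemma csubP h c : reflect (forall i : 'I_k, 0 < dig h i -> dig h i = dig c i) (csub h c).
Proof.
pose b (i : 'I_k) := (dig h i == 0) || (dig h i == dig c i).
have e : \sum_(i < k) b i + \sum_(i < k) ~~ b i = k.
  rewrite -big_split /= (eq_bigr (fun=> 1)); first by rewrite sum_nat_const card_ord muln1.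
  by move=> i _; case: (b i).
apply: (iffP idP) => [/eqP h1 i d0|h1]; rewrite /csub -/b in h1 *.
  have /eqP : \sum_(i < k) ~~ b i = 0 by rewrite /b in e h1 *; lia.
  rewrite sum_nat_eq0 => /forallP/(_ i); rewrite eqb0 negbK /b.
  by case/orP=> /eqP // e0; rewrite e0 in d0.
rewrite -[X in _ == X]e -[X in X == _]addn0 eqn_add2l eq_sym sum_nat_eq0.
apply/forallP => i; rewrite eqb0 negbK /b /=.
by have [//|d0] := posnP (dig h i); rewrite h1 // eqxx orbT.
Qed.

Lemma card_cset c : #|cset c| = csize c.
Proof.
rewrite /csize -sum1_card (eq_bigl (fun e : E => (0 < e.2) && (dig c e.1 == e.2))); last first.
  by move=> e; rewrite inE.
rewrite -(pair_big_dep predT (fun (i : 'I_k) (j : 'I_M) => (0 < j) && (dig c i == j)) (fun _ _ => 1)) /=.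
apply: eq_bigr => i _; have [d0|d0] := posnP (dig c i).
  by rewrite big_pred0 // => j; rewrite d0; apply/negP => /andP[j0 /eqP e]; rewrite -e in j0.
rewrite (big_pred1 (Ordinal (dig_ltn c i M_gt0))) // => j /=.
by rewrite -val_eqE /= eq_sym; case: eqP => [->|]; rewrite ?d0 ?andbF.
Qed.

(** Elements of a clause are literals tagged with their position, so inclusion becomes a digitwise
    test. The tag costs only a factor [k] in the size of the ground set [E]. *)
Lemma csub_cset h c : csub h c = (cset h \subset cset c).
Proof.
apply/csubP/subsetP => [hc [i j]|hc i d0].
  rewrite !inE /= => /andP[j0 /eqP e]; rewrite j0 /= -e eq_sym; apply/eqP/hc; lia.
have := hc (i, Ordinal (dig_ltn h i M_gt0)); rewrite !inE /= d0 eqxx => /(_ isT)/eqP.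
by [].
Qed.

Lemma csize_leq c : csize c <= k.
Proof.
rewrite /csize -[X in _ <= X]card_ord -sum1_card; apply: leq_sum => i _; exact: leq_b1.
Qed.

Lemma cset_inj c c' : c < U -> c' < U -> cset c = cset c' -> c = c'.
Proof.
move=> cU cU' e; rewrite -(code_of_dig M_gt0 cU) -(code_of_dig M_gt0 cU').
apply: code_of_ext => i ik.
have s1 : csub c c' by rewrite csub_cset e.
have s2 : csub c' c by rewrite csub_cset e.
have := csubP _ _ s1 (Ordinal ik); have := csubP _ _ s2 (Ordinal ik); rewrite /=; lia.
Qed.

Lemma cdiffE c h : cdiff c h = code_of M k (fun i => (dig h i == 0) * dig c i).
Proof. by []. Qed.

Lemma mask_ltn (b : bool) c i : b * dig c i < M.
Proof. by case: b; rewrite ?mul1n ?mul0n // dig_ltn. Qed.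

Lemma cdiff_bound c h : cdiff c h < U.
Proof. by rewrite cdiffE; apply: code_of_bound => // i _; apply: mask_ltn. Qed.

Lemma cset_cdiff c h : csub h c -> cset (cdiff c h) = cset c :\: cset h.
Proof.
move=> /csubP hc; apply/setP => -[i j]; rewrite !inE /= cdiffE dig_code_of //; last first.
  by move=> i' _; apply: mask_ltn.
have [d0|d0] := posnP (dig h i); first by rewrite mul1n; lia.
rewrite mul0n -(hc i d0); lia.
Qed.

(** All digits outside the positions of [H] are erased. So every heart has a code, and a search over
    codes misses no flower. *)
Lemma cset_restr c (H : {set E}) : H \subset cset c -> exists2 h, h < U & cset h = H.
Proof.
move=> Hc; pose b (i : nat) := [exists e : E, (e \in H) && (e.1 == i :> nat)].
exists (code_of M k (fun i => b i * dig c i)).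
  by apply: code_of_bound => // i _; apply: mask_ltn.
apply/setP => -[i j]; rewrite inE /= dig_code_of //; last by move=> i' _; apply: mask_ltn.
apply/andP/idP => [[j0 /eqP e]|ijH].
  have /existsP[[i' j'] /andP[eH /eqP /= ei]] : b i by case: (b i) e j0 => //; rewrite mul0n; lia.
  have := subsetP Hc _ eH; rewrite inE /= => /andP[_ /eqP e'].
  have bi : b i by case: (b i) e j0 => //; rewrite mul0n; lia.
  suff <- : (i', j') = (i, j) by [].
  congr pair; first exact: val_inj.
  by apply: val_inj; rewrite /= -e -e' ei bi mul1n.
have := subsetP Hc _ ijH; rewrite inE /= => /andP[j0 /eqP e]; split=> //.
suff -> : b i by rewrite mul1n e.
by apply/existsP; exists (i, j); rewrite ijH /=.
Qed.

Definition fam f : {set {set E}} := [set cset c | c : 'I_U & f c].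

Lemma famP f C : reflect (exists c, [/\ c < U, f c & C = cset c]) (C \in fam f).
Proof.
apply: (iffP imsetP) => [[c fc ->]|[c [cU fc ->]]].
  by exists c; split=> //; move: fc; rewrite inE.
by exists (Ordinal cU) => //; rewrite inE.
Qed.

Lemma mem_fam f c : c < U -> (cset c \in fam f) = f c.
Proof.
move=> cU; apply/famP/idP => [[c' [cU' fc e]]|fc]; last by exists c.
by rewrite (cset_inj cU cU' e).
Qed.

Lemma eq_fam f g : (forall c, c < U -> f c = g c) -> fam f = fam g.
Proof.
move=> fg; apply/setP => C; apply/famP/famP => -[c [cU fc ->]]; exists c; split=> //.
  by rewrite -fg.
by rewrite fg.
Qed.

Lemma card_fam f : #|fam f| = \sum_(c < U) f c.
Proof.
rewrite card_in_imset; last by move=> c c' _ _ /cset_inj e; apply: val_inj; apply: e.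
by rewrite -sum1_card big_mkcond /=; apply: eq_bigr => c _; rewrite inE; case: (f c).
Qed.

Definition cdeg f h c := \sum_(C < U) [&& f C, csize C == c & csub h C].

Lemma cdegE f h c : cdeg f h c = deg (fam f) (cset h) c.
Proof.
rewrite /deg; pose g C := [&& f C, csize C == c & csub h C].
rewrite -[LHS](card_fam g); congr #|pred_of_set _|; apply/setP => C.
rewrite inE; apply/famP/andP => [[c' [cU /and3P[fc sz sb] ->]]|[/famP[c' [cU fc ->]] /andP[sz sb]]].
  by rewrite mem_fam // fc card_cset sz -csub_cset sb.
by exists c'; split=> //; rewrite /g fc -card_cset sz csub_cset sb.
Qed.

(** A search index packs a clause size [xc], a petal size [xi] and a heart code [xh], most
    significant first. The least index of a flower then has the smallest clauses and, among those,
    the smallest petals and so the largest heart: it is a [min_flower]. *)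
Definition search_bound := k.+1 * k.+1 * U.
Local Notation Q := search_bound.
Definition xc x := x %/ U %/ k.+1.
Definition xi x := x %/ U %% k.+1.
Definition xh x := x %% U.
Definition isflower f x := [&& 0 < xi x, xi x < xc x, csize (xh x) + xi x == xc x &
  theta (xi x) <= cdeg f (xh x) (xc x)].
(* The least index of a flower, or [Q] when there is none. *)
Definition sel f := \sum_(x < Q) (\sum_(y < Q) ((y <= x) && isflower f y) == 0).

(** An [x] contributes 1 exactly when no [y <= x] satisfies [p], so the sum counts the indices
    before the first hit. This turns a search into bounded sums. *)
Lemma first_index n (p : pred nat) :
  \sum_(x < n) (\sum_(y < n) ((y <= x) && p y) == 0) = find p (iota 0 n).
Proof.
have e x : x < n -> (\sum_(y < n) ((y <= x) && p y) == 0) = (x < find p (iota 0 n)).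
  move=> xn; rewrite sum_nat_eq0; apply/forallP/idP => [h|h y].
    rewrite ltnNge; apply/negP => fx.
    have hp : has p (iota 0 n) by rewrite has_find size_iota (leq_ltn_trans fx).
    have fn := leq_ltn_trans fx xn.
    have := h (Ordinal fn); rewrite /= fx eqb0.
    by have := nth_find 0 hp; rewrite nth_iota // add0n => ->.
  rewrite eqb0; apply/negP => /andP[yx py].
  have := before_find 0 (leq_ltn_trans yx h); rewrite nth_iota ?add0n ?py //.
rewrite (eq_bigr (fun x : 'I_n => (x < find p (iota 0 n)) : nat)); last by move=> x _; rewrite e.
have fn : find p (iota 0 n) <= n by rewrite -[X in _ <= X](size_iota 0 n) find_size.
move: (find _ _) fn => m mn {e}.
rewrite -(subnKC mn) big_split_ord /= -[RHS]addn0; congr (_ + _).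
  by rewrite (eq_bigr (fun=> 1)) ?sum_nat_const ?card_ord ?muln1 // => i _; rewrite ltn_ord.
by rewrite big1 // => i _; have := ltn_ord i; lia.
Qed.

Lemma selE f : sel f = find (isflower f) (iota 0 Q).
Proof. exact: first_index. Qed.

Lemma U_gt0 : 0 < U. Proof. by rewrite expn_gt0 M_gt0. Qed.

Lemma isflowerP f x : x < Q -> isflower f x -> flower k alpha (fam f) (cset (xh x)) (xc x).
Proof.
move=> xQ /and4P[i0 ic /eqP sz dg]; apply/and4P; rewrite card_cset.
split; [lia|lia| |].
  by rewrite /xc -ltnS !ltn_divLR // U_gt0.
by rewrite -cdegE (_ : xc x - csize (xh x) = xi x) //; lia.
Qed.

Lemma flower_index f (H : {set E}) c : flower k alpha (fam f) H c ->
  exists x, [/\ x < Q, isflower f x, xc x = c & xi x = c - #|H|].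
Proof.
move=> /and4P[H0 Hc ck dg].
have /card_gt0P[C] : 0 < deg (fam f) H c.
  by apply: leq_trans dg; rewrite expn_gt0; lia.
rewrite inE => /and3P[/famP[cc [_ _ ->]] _ /cset_restr[h hU eH]].
pose x := (c * k.+1 + (c - #|H|)) * U + h.
have ex : x %/ U = c * k.+1 + (c - #|H|) by rewrite /x divnMDl ?U_gt0 // divn_small // addn0.
have exc : xc x = c by rewrite /xc ex divnMDl // divn_small ?addn0 //; lia.
have exi : xi x = c - #|H| by rewrite /xi ex modnMDl modn_small //; lia.
have exh : xh x = h by rewrite /xh /x modnMDl modn_small.
exists x; split=> //.
  by rewrite /Q -ltn_divLR ?U_gt0 // -ltn_divLR // -/(xc x) exc ltnS.
apply/and4P; rewrite exc exi exh; split; [lia|lia| |].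
  by rewrite -card_cset eH; lia.
by rewrite cdegE eH.
Qed.

Lemma sel_leq f : sel f <= Q.
Proof. by rewrite selE -[X in _ <= X](size_iota 0 Q) find_size. Qed.

Lemma sel_leaf f : sel f = Q -> forall H c, ~~ flower k alpha (fam f) H c.
Proof.
rewrite selE => e H c; apply/negP => /flower_index[x [xQ fx _ _]].
have : has (isflower f) (iota 0 Q) by apply/hasP; exists x; rewrite ?mem_iota.
by rewrite has_find e size_iota ltnn.
Qed.

Lemma sel_min f : sel f < Q -> min_flower k alpha (fam f) (cset (xh (sel f))) (xc (sel f)).
Proof.
move=> sQ; have hp : has (isflower f) (iota 0 Q) by rewrite has_find size_iota -selE.
have fs : isflower f (sel f).
  by have := nth_find 0 hp; rewrite -selE nth_iota.
split; first exact: isflowerP.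
move=> H' c' /flower_index[x [xQ fx <- exi]].
have sx : sel f <= x.
  rewrite leqNgt; apply/negP => xs; have := @before_find _ 0 (isflower f) (iota 0 Q) x.
  by rewrite -selE nth_iota // add0n fx => /(_ xs).
have h1 : sel f %/ U <= x %/ U by apply: leq_div2r.
have e1 := divn_eq (sel f %/ U) k.+1; have e2 := divn_eq (x %/ U) k.+1.
rewrite -/(xc (sel f)) -/(xi (sel f)) in e1; rewrite -/(xc x) -/(xi x) in e2.
case/and4P: fs; rewrite card_cset => i0 ic /eqP sz _.
case/and4P: fx => j0 jc _ _.
have h3 : xi x < k.+1 by apply: ltn_pmod.
have h4 : xi (sel f) < k.+1 by apply: ltn_pmod.
have [lt|gt|eq] := ltngtP (xc (sel f)) (xc x); [by left| |].
  have : xc x * k.+1 + k.+1 <= xc (sel f) * k.+1 by rewrite -mulSnr leq_mul2r gt orbT.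
  lia.
by right; split=> //; rewrite eq in e1; lia.
Qed.

(* Action 1 branches on the heart, action 2 on the petals. *)
Definition newcl f q act D :=
  if act == 1 then D == xh q
  else if act == 2 then
    0 < \sum_(C < U) [&& f C, csize C == xc q, csub (xh q) C & cdiff C (xh q) == D]
  else false.
Definition cupd f (nn : nat -> bool) D :=
  nn D || f D && (\sum_(D' < U) (nn D' && csub D' D) == 0).

Lemma fam_cupd f nn : fam (cupd f nn) = upd (fam f) (fam nn).
Proof.
apply/setP => C; rewrite !inE; apply/famP/idP => [[c [cU + ->]]|].
  rewrite /cupd mem_fam // mem_fam // => /orP[-> //|/andP[-> h]]; rewrite orbC /=.
  apply/orP; left; apply: contraTN h => /existsP[D /andP[/famP[d [dU nd ->]] dc]].
  rewrite -lt0n (exists_sum U (fun D' => nn D' && csub D' c)).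
  by apply/existsP; exists (Ordinal dU); rewrite /= nd csub_cset.
move=> /orP[/famP[c [cU nc ->]]|/andP[/famP[c [cU fc ->]] h]]; exists c; split=> //.
  by rewrite /cupd nc.
rewrite /cupd fc /= orbC -leqn0 leqNgt (exists_sum U (fun D' => nn D' && csub D' c)).
apply/orP; left; apply: contra h => /existsP[d /andP[nd dc]].
by apply/existsP; exists (cset d); rewrite mem_fam // nd -csub_cset.
Qed.

Lemma fam_heart f q : fam (newcl f q 1) = [set cset (xh q)].
Proof.
have hU : xh q < U by rewrite ltn_pmod // U_gt0.
apply/setP => C; rewrite inE; apply/famP/eqP => [[c [cU /eqP -> ->]] //|->].
by exists (xh q); rewrite /newcl /= eqxx.
Qed.

Lemma fam_petals f q : fam (newcl f q 2) = petals (fam f) (cset (xh q)) (xc q).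
Proof.
apply/setP => D; apply/famP/imsetP => [[d [dU + ->]]|[C]].
  rewrite /newcl /= (exists_sum U (fun C => [&& f C, csize C == xc q, csub (xh q) C & cdiff C (xh q) == d])).
  move=> /existsP[C /and4P[fC sz sb /eqP <-]]; exists (cset C); last exact: cset_cdiff.
  by rewrite inE mem_fam // fC card_cset sz -csub_cset sb.
rewrite inE => /and3P[/famP[c [cU fc ->]] sz sb] ->; rewrite -csub_cset in sb.
exists (cdiff c (xh q)); rewrite cdiff_bound cset_cdiff //; split=> //.
rewrite /newcl /= (exists_sum U (fun C => [&& f C, csize C == xc q, csub (xh q) C & cdiff C (xh q) == _])).
by apply/existsP; exists (Ordinal cU); rewrite /= fc -card_cset sz sb eqxx.
Qed.

(** * Runs of the branching process, driven by tokens *)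

Definition action v j := if j < v then 1 else if j == v then 2 else 0.
Definition cnew f v j D := if sel f < Q then newcl f (sel f) (action v j) D else false.
Definition cstep f v j D := cupd f (cnew f v j) D.
(** A token always takes the same number of steps, idling after the petals or at a leaf, so that
    counted loops can execute it. The token [v = n] stands for hearts only. *)
Definition ctok f v n := iteri n (fun j g => cstep g v j) f.
Definition crun f (tok : nat -> nat) W n := iteri n (fun t g => ctok g (tok t) W) f.

Lemma ctokS f v n : ctok f v n.+1 = cstep (ctok f v n) v n. Proof. by []. Qed.

Lemma crunS f tok W n : crun f tok W n.+1 = ctok (crun f tok W n) (tok n) W.
Proof. by []. Qed.

Notation inv := (sp_inv k alpha).
Notation pot := (potential k alpha).

Lemma cstep_none f v j : (sel f < Q) = false \/ action v j = 0 -> fam (cstep f v j) = fam f.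
Proof.
move=> h; apply: eq_fam => c cU; rewrite /cstep /cupd.
have e D : cnew f v j D = false.
  by rewrite /cnew; case: h => [->//|->]; case: ifP.
by rewrite e /= big1 ?andbT // => D _; rewrite e.
Qed.

Lemma cstep_heart f v j : sel f < Q -> action v j = 1 ->
  fam (cstep f v j) = upd (fam f) [set cset (xh (sel f))].
Proof.
move=> sQ av; rewrite fam_cupd; congr upd; rewrite -(fam_heart f).
by apply: eq_fam => c _; rewrite /cnew sQ av.
Qed.

Lemma cstep_petals f v j : sel f < Q -> action v j = 2 ->
  fam (cstep f v j) = upd (fam f) (petals (fam f) (cset (xh (sel f))) (xc (sel f))).
Proof.
move=> sQ av; rewrite fam_cupd; congr upd; rewrite -(fam_petals f).
by apply: eq_fam => c _; rewrite /cnew sQ av.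
Qed.

Lemma action_cases v j : [\/ action v j = 0, action v j = 1 | action v j = 2].
Proof. by rewrite /action; case: ifP => _; [|case: ifP => _]; [apply: Or32|apply: Or33|apply: Or31]. Qed.

Lemma heart_proper F (H : {set E}) c : flower k alpha F H c ->
  forall D, D \in [set H] -> exists2 C, C \in F & D \proper C.
Proof.
move=> /and4P[H0 Hc ck hdeg] D; rewrite inE => /eqP ->.
have /card_gt0P[C] : 0 < deg F H c.
  by apply: leq_trans hdeg; rewrite expn_gt0; lia.
rewrite inE => /and3P[CF /eqP Cc HC]; exists C => //.
by rewrite properEcard HC Cc.
Qed.

Lemma petals_proper F (H : {set E}) c : flower k alpha F H c ->
  forall D, D \in petals F H c -> exists2 C, C \in F & D \proper C.
Proof.
move=> /and4P[H0 Hc ck hdeg] D /imsetP[C]; rewrite inE => /and3P[CF /eqP Cc HC] ->.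
exists C => //; rewrite properEcard subsetDl cardsD (setIidPr HC); lia.
Qed.

Lemma cstep_sat vv f v j : sat vv (fam (cstep f v j)) -> sat vv (fam f).
Proof.
have [sQ|nQ] := boolP (sel f < Q); last by rewrite cstep_none //; left; apply: negbTE.
have [fl _] := sel_min sQ.
have [a|a|a] := action_cases v j.
- by rewrite cstep_none //; right.
- by rewrite cstep_heart //; apply: sat_upd; apply: heart_proper fl.
- by rewrite cstep_petals //; apply: sat_upd; apply: petals_proper fl.
Qed.

Lemma cstep_inv f G v j : inv (fam f) G ->
  exists2 G', inv (fam (cstep f v j)) G' & pot G <= pot G'.
Proof.
move=> I; have [sQ|nQ] := boolP (sel f < Q); last first.
  by exists G => //; rewrite cstep_none //; left; apply: negbTE.
have mf := sel_min sQ.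
have [a|a|a] := action_cases v j.
- by exists G => //; rewrite cstep_none //; right.
- have [I' P'] := sp_heart k_gt0 alpha_ge I mf.
  by rewrite cstep_heart //; eexists; [exact: I'|lia].
- have [I' P'] := sp_petals k_gt0 alpha_ge I mf.
  by rewrite cstep_petals //; eexists; [exact: I'|lia].
Qed.

Lemma cstep_leaf f v j : sel f = Q -> fam (cstep f v j) = fam f.
Proof. by move=> e; apply: cstep_none; left; rewrite e ltnn. Qed.

Lemma sel_fam f g : fam f = fam g -> sel f = sel g.
Proof.
move=> e; rewrite !selE; apply: eq_find => x; rewrite /isflower.
by rewrite !cdegE e.
Qed.

Lemma crun_sat vv f tok W n : sat vv (fam (crun f tok W n)) -> sat vv (fam f).
Proof.
elim: n => [//|n IH]; rewrite crunS => h; apply: IH; move: h.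
move: (crun f tok W n) (tok n) => g v.
by elim: W => [//|W IH]; rewrite ctokS => /cstep_sat /IH.
Qed.

Lemma ctok_inv f G v W : inv (fam f) G ->
  exists2 G', inv (fam (ctok f v W)) G' & pot G <= pot G'.
Proof.
move=> I; elim: W => [|W [G' I' P']]; first by exists G.
by have [G'' I'' P''] := cstep_inv v W I'; exists G'' => //; lia.
Qed.

Lemma crun_inv f G tok W n : inv (fam f) G ->
  exists2 G', inv (fam (crun f tok W n)) G' & pot G <= pot G'.
Proof.
move=> I; elim: n => [|n [G' I' P']]; first by exists G.
by have [G'' I'' P''] := ctok_inv (tok n) W I'; exists G'' => //; lia.
Qed.

Lemma ctok_eq f v v' r : (forall j, j < r -> action v j = action v' j) ->
  ctok f v r = ctok f v' r.
Proof.
elim: r => [//|r IH] h; rewrite !ctokS IH; last first.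
  by move=> j jr; apply: h; apply: ltnW.
by rewrite /cstep /cnew h.
Qed.

(* The token [v] for an assignment [vv] counts the hearts that [vv] satisfies
   before the first one that it falsifies, where it must take the petals. *)
Lemma ctok_progress vv f G r : inv (fam f) G -> sat vv (fam f) -> sel f < Q ->
  r <= alpha ^ k.*2.-1 ->
  exists v, [/\ v <= r, sat vv (fam (ctok f v r)) &
    sel (ctok f v r) = Q \/
    exists2 G', inv (fam (ctok f v r)) G' &
      (v = r -> pot G + r <= pot G') /\ (v < r -> pot G + alpha ^ k.*2.-1 <= pot G')].
Proof.
move=> I S sQ; elim: r => [|r IH] rW.
  by exists 0; split=> //; right; exists G => //; split=> //; rewrite addn0.
have [v [vr Sv h]] := IH (ltnW rW).
(* As long as all steps so far took the heart ([v = r]), the token can still be raised without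
   changing them. *)
have e v' : v' <= r.+1 -> (v = r -> r <= v') -> (v < r -> v' = v) -> ctok f v' r = ctok f v r.
  move=> v1 v2 v3; apply: ctok_eq => j jr; rewrite /action.
  have [vr'|vr'] := ltnP v r; first by rewrite v3.
  have [j1 j2] : j < v' /\ j < v by lia.
  by rewrite j1 j2.
have leafcase : sel (ctok f v r) = Q -> exists v', [/\ v' <= r.+1, sat vv (fam (ctok f v' r.+1)) &
    sel (ctok f v' r.+1) = Q].
  move=> lf; exists v; rewrite ctokS cstep_leaf // (sel_fam (cstep_leaf _ _ lf)).
  by split=> //; lia.
case: h => [lf|[G' I' [P1 P2]]].
  by have [v' [? ? ?]] := leafcase lf; exists v'; split=> //; left.
have [nl|lf] : sel (ctok f v r) < Q \/ sel (ctok f v r) = Q by have := sel_leq (ctok f v r); lia.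
  have mf := sel_min nl; set g := ctok f v r in mf Sv nl I' *.
  have [lt|eq] : v < r \/ v = r by lia.
    have a : action v r = 0 by rewrite /action !ifN //; lia.
    exists v; rewrite ctokS -/g cstep_none; last by right.
    split=> //; first lia.
    by right; exists G' => //; split; [lia|move=> _; apply: P2].
  (* If [vv] satisfies the heart, the token grows to [r.+1]; otherwise it stays [r], and step [r]
     takes the petals. *)
  have [SH|nSH] := boolP (sat vv [set cset (xh (sel g))]).
    have [I2 P3] := sp_heart k_gt0 alpha_ge I' mf.
    exists r.+1; rewrite ctokS e; [|lia|lia|lia].
    rewrite -/g cstep_heart // ?/action ?ltnSn //; split=> //; first exact: sat_updW.
    by right; eexists; [exact: I2|split; [have := P1 eq; lia|lia]].
  have [I2 P3] := sp_petals k_gt0 alpha_ge I' mf.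
  exists r; rewrite ctokS e; [|lia|lia|lia].
  rewrite -/g cstep_petals // ?/action ?ltnn ?eqxx //; split=> //.
    by apply: sat_updW => //; apply: sat_branch.
  right; eexists; [exact: I2|split; [lia|]] => _.
  have := P1 eq; lia.
by have [v' [? ? ?]] := leafcase lf; exists v'; split=> //; left.
Qed.

Lemma crun_eq f tok tok' W n : (forall t, t < n -> tok t = tok' t) ->
  crun f tok W n = crun f tok' W n.
Proof.
elim: n => [//|n IH] h; rewrite !crunS IH.
  by rewrite h.
by move=> t tn; apply: h; apply: ltnW.
Qed.

Lemma ctok_leaf f v W : sel f = Q -> fam (ctok f v W) = fam f.
Proof.
move=> lf; elim: W => [//|W IH].
by rewrite ctokS cstep_leaf // (sel_fam IH).
Qed.

(** Unless a leaf is reached, a token [v < W] has taken petals, which gain [W] at once, and the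
    token [W] has taken [W] hearts, which gain 1 each. Either way the potential rises by [W]. *)
Lemma crun_progress vv f G n : inv (fam f) G -> sat vv (fam f) ->
  let W := alpha ^ k.*2.-1 in
  exists tok : nat -> nat, [/\ forall t, tok t <= W, sat vv (fam (crun f tok W n)) &
    sel (crun f tok W n) = Q \/
    exists2 G', inv (fam (crun f tok W n)) G' & pot G + n * W <= pot G'].
Proof.
move=> I S W; elim: n => [|n [tok [hW Sn h]]].
  by exists (fun=> 0); split=> //; right; exists G => //; rewrite addn0.
have ext v t : t < n -> (fun t => if t == n then v else tok t) t = tok t.
  by move=> tn; rewrite /= ltn_eqF.
set g := crun f tok W n in Sn h.
have crunS' v : crun f (fun t => if t == n then v else tok t) W n.+1 = ctok g v W.
  by rewrite crunS eqxx (crun_eq f W (ext v)).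
have tokW v : v <= W -> forall t, (if t == n then v else tok t) <= W.
  by move=> vW t; case: eqP.
have leafcase : sel g = Q -> exists tok : nat -> nat, [/\ forall t, tok t <= W,
    sat vv (fam (crun f tok W n.+1)) & sel (crun f tok W n.+1) = Q].
  move=> lf; exists (fun t => if t == n then 0 else tok t); rewrite crunS' ctok_leaf //.
  by split=> //; [exact: tokW|rewrite (sel_fam (ctok_leaf 0 W lf))].
case: h => [lf|[G' I' P']].
  by have [t' [? ? ?]] := leafcase lf; exists t'; split=> //; left.
have [nl|lf] : sel g < Q \/ sel g = Q by have := sel_leq g; lia.
  have [v [vW Sv h]] := ctok_progress I' Sn nl (leqnn W).
  exists (fun t => if t == n then v else tok t); rewrite crunS'.
  split=> //; first exact: tokW.
  case: h => [|[G'' I'' [P1 P2]]]; [by left|right].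
  exists G'' => //; rewrite mulSn.
  have [lt|eq] : v < W \/ v = W by lia.
    by have := P2 lt; rewrite -/W; lia.
  by have := P1 eq; lia.
by have [t' [? ? ?]] := leafcase lf; exists t'; split=> //; left.
Qed.

(** A run without leaf would gain [n * alpha ^ k.*2.-1], more than [potential_bound] allows. *)
Lemma crun_complete vv f G n : inv (fam f) G -> sat vv (fam f) ->
  3 * (k * M) < n * alpha ->
  let W := alpha ^ k.*2.-1 in
  exists tok : nat -> nat, [/\ forall t, tok t <= W, sat vv (fam (crun f tok W n)) &
    sel (crun f tok W n) = Q].
Proof.
move=> I S hn W; have [tok [hW Sn [lf|[G' I' P']]]] := crun_progress n I S; first by exists tok.
have := potential_bound k_gt0 alpha_ge I'; rewrite card_prod !card_ord => hb.
have a0 : 0 < alpha by lia.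
have : 3 * (k * M) * alpha ^ k.-1.*2 < n * W.
  rewrite /W (_ : k.*2.-1 = k.-1.*2.+1) ?expnS ?mulnA; last by lia.
  by rewrite -(mulnA 3) ltn_mul2r expn_gt0 a0 hn.
lia.
Qed.

(** The run starts from the inclusion-minimal clauses, because [sp_inv] demands an antichain. *)
Definition cmin f c := f c && (\sum_(d < U) [&& f d, csub d c & d != c :> nat] == 0).

Lemma cmin_inv f : inv (fam (cmin f)) set0.
Proof.
have nom c d : c < U -> d < U -> cmin f c -> cmin f d -> csub d c -> d = c.
  move=> cU dU /andP[_ h] /andP[fd _] dc; apply/eqP/negPn/negP => ndc.
  move: h; rewrite -leqn0 leqNgt (exists_sum U (fun d => [&& f d, csub d c & d != c :> nat])).
  by move=> /negP; apply; apply/existsP; exists (Ordinal dU); rewrite /= fd dc.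
split.
- move=> C D /famP[c [cU fc ->]] /famP[d [dU fd ->]]; rewrite -csub_cset => cd.
  by rewrite (nom d c).
- exact: sub0set.
- by move=> C /famP[c [cU fc ->]]; rewrite card_cset csize_leq.
- by rewrite inE.
- move=> H i _ _; rewrite (_ : deg _ _ _ = 0) //; apply/eqP; rewrite cards_eq0.
  by apply/eqP/setP => C; rewrite !inE.
Qed.

Lemma cmin_sat vv f : sat vv (fam (cmin f)) = sat vv (fam f).
Proof.
apply/idP/idP => /forallP h; apply/forallP => C; apply/implyP => /famP[c [cU fc ->]].
  (* Induction on the size: every clause contains a minimal one. *)
  have [n] := ubnP (csize c); elim: n c cU fc => // n IH c cU fc szc.
  have [mc|nmc] := boolP (cmin f c).
    by have := h (cset c); rewrite mem_fam // mc.
  move: nmc; rewrite /cmin fc /= -lt0n (exists_sum U (fun d => [&& f d, csub d c & d != c :> nat])).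
  move=> /existsP[d /and3P[fd dc ndc]].
  have prc : cset d \proper cset c.
    rewrite properEneq -csub_cset dc andbT; apply: contra ndc => /eqP e.
    by apply/eqP/cset_inj.
  have hd : csize d < n by have := proper_card prc; rewrite !card_cset; lia.
  have /existsP[e /andP[ed ve]] := IH d (ltn_ord d) fd hd.
  by apply/existsP; exists e; rewrite (subsetP (proper_sub prc)).
by case/andP: fc => fc _; have := h (cset c); rewrite mem_fam // fc.
Qed.

(** The rank numbers the clauses of a leaf consecutively, so that the dimension only has to match
    the number of clauses and not the number [U] of codes. *)
Definition rank f c := \sum_(d < U) (f d && (d < c)).

Lemma crun_leaf_card f tok n W : sel (crun (cmin f) tok W n) = Q ->
  \sum_(c < U) crun (cmin f) tok W n c <= 1 + k * M * (1 + k * theta k).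
Proof.
move=> lf; rewrite -card_fam.
have [G' I' _] := crun_inv tok W n (cmin_inv f).
have := leaf_bound k_gt0 alpha_ge (F := fam (crun (cmin f) tok W n)).
rewrite card_prod !card_ord; apply; last exact: sel_leaf.
by case: I'.
Qed.

Lemma rank_ltn f c : c < U -> f c -> rank f c < \sum_(d < U) f d.
Proof.
move=> cU fc; rewrite /rank (bigD1 (Ordinal cU)) //= [X in _ < X](bigD1 (Ordinal cU)) //=.
rewrite ltnn andbF fc add0n add1n ltnS; apply: leq_sum => d _.
by case: (f d); case: (_ < _).
Qed.

Lemma rank_inj f c d : c < U -> d < U -> f c -> f d -> rank f c = rank f d -> c = d.
Proof.
have aux c' d' : c' < U -> f c' -> c' < d' -> rank f c' < rank f d'.
  move=> cU fc cd; rewrite /rank (bigD1 (Ordinal cU)) //= [X in _ < X](bigD1 (Ordinal cU)) //=.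
  rewrite ltnn andbF fc cd add0n add1n ltnS; apply: leq_sum => e _.
  by case: (f e) => //=; case: ltnP => // h; rewrite (ltn_trans h cd).
move=> cU dU fc fd e; have [lt|gt|//] := ltngtP c d.
  by have := aux c d cU fc lt; lia.
by have := aux d c dU fd gt; lia.
Qed.

End Codes.

From mathcomp Require Import all_order all_algebra boolp.

Import Order.TTheory GRing.Theory Num.Theory.
Local Open Scope ring_scope.

(** * A language with bounded sums and counted loops *)

Lemma bitlen_gt0 z : (0 < bitlen z)%N. Proof. by []. Qed.

Lemma bitlen_leq z b : (0 < b)%N -> (bitlen z <= b)%N = (`|z| < 2 ^ b)%N.
Proof.
move=> b0; rewrite /bitlen; apply/idP/idP => [h|h].
  by apply: leq_trans (trunc_log_ltn _ (isT : (1 < 2)%N)) _; rewrite leq_pexp2l.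
have [->|z0] := posnP `|z|%N; first by rewrite trunc_log0.
by rewrite -(ltn_exp2l _ _ (isT : (1 < 2)%N)) (leq_ltn_trans (trunc_logP _ z0)).
Qed.

Lemma bitlen_ltn z : (`|z| < 2 ^ bitlen z)%N.
Proof. by rewrite -bitlen_leq. Qed.

Lemma bitlen_leq_abs x y : (`|x| <= `|y|)%N -> (bitlen x <= bitlen y)%N.
Proof. by move=> h; rewrite bitlen_leq // (leq_ltn_trans h) // bitlen_ltn. Qed.

Lemma bitlen_binop o x y : (bitlen (binop_val o x y) <= bitlen x + bitlen y)%N.
Proof.
have [x0 y0] := (bitlen_ltn x, bitlen_ltn y).
have p0 : (0 < bitlen x + bitlen y)%N by rewrite addn_gt0 bitlen_gt0.
rewrite bitlen_leq // expnD; case: o => /=.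
- suff h : (2 ^ bitlen x + 2 ^ bitlen y <= 2 ^ bitlen x * 2 ^ bitlen y)%N by lia.
  have : (2 ^ 1 <= 2 ^ bitlen x)%N by rewrite leq_pexp2l.
  have : (2 ^ 1 <= 2 ^ bitlen y)%N by rewrite leq_pexp2l.
  nia.
- suff h : (2 ^ bitlen x + 2 ^ bitlen y <= 2 ^ bitlen x * 2 ^ bitlen y)%N by lia.
  have : (2 ^ 1 <= 2 ^ bitlen x)%N by rewrite leq_pexp2l.
  have : (2 ^ 1 <= 2 ^ bitlen y)%N by rewrite leq_pexp2l.
  nia.
- by rewrite abszM; apply: ltn_mul.
- apply: leq_ltn_trans (lez_div x y) _; apply: leq_trans x0 _.
  by rewrite leq_pmulr // expn_gt0.
Qed.

(* Arrays 2 and 3 hold the loop variables and the temporaries of compiled code. *)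
Definition EV := 2%N.
Definition TP := 3%N.
(** Array 4 holds the ranges of all bounded sums ([U] in cell 0, [search_bound] in cell 1), so one
    invariant on the state bounds them all. *)
Definition PA := 4%N.

Inductive xexpr :=
  | XC of int
  | XV of nat
  | XG of nat & xexpr
  | XB of binop & xexpr & xexpr
  | XIf of xexpr & xexpr & xexpr
  | XSum of nat & nat & xexpr.  (* XSum l j e is the sum of e over l < PA[j] *)

Definition upd_env (env : nat -> int) l v := fun l' => if l' == l then v else env l'.

Fixpoint xeval (s : state) (env : nat -> int) (e : xexpr) : int :=
  match e with
  | XC z => z
  | XV l => env l
  | XG a e => s a (xeval s env e)
  | XB o e1 e2 => binop_val o (xeval s env e1) (xeval s env e2)
  | XIf e e1 e2 => if 0 < xeval s env e then xeval s env e1 else xeval s env e2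
  | XSum l j e => \sum_(i < `|s PA j|%N) xeval s (upd_env env l i%:Z) e
  end.

Fixpoint xwf (e : xexpr) : bool :=
  match e with
  | XC _ | XV _ => true
  | XG a e => [&& a != EV, a != TP & xwf e]
  | XB _ e1 e2 => xwf e1 && xwf e2
  | XIf e e1 e2 => [&& xwf e, xwf e1 & xwf e2]
  | XSum _ _ e => xwf e
  end.

Definition tget (t : nat) := EGet TP (ECst t%:Z).
Definition tset (t : nat) e := PSet TP (ECst t%:Z) e.
Definition vget (l : nat) := EGet EV (ECst l%:Z).
Definition vset (l : nat) e := PSet EV (ECst l%:Z) e.

(* Leaves the value in cell [t] of [TP]; only cells [>= t] of [TP] are used. *)
Fixpoint xcomp (t : nat) (e : xexpr) : prog :=
  match e with
  | XC z => tset t (ECst z)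
  | XV l => tset t (vget l)
  | XG a e => PSeq (xcomp t e) (tset t (EGet a (tget t)))
  | XB o e1 e2 =>
      PSeq (xcomp t e1) (PSeq (xcomp t.+1 e2) (tset t (EBin o (tget t) (tget t.+1))))
  | XIf e e1 e2 => PSeq (xcomp t e) (PIf (tget t) (xcomp t e1) (xcomp t e2))
  | XSum l j e =>
      PSeq (tset t (ECst 0)) (PSeq (tset t.+1 (vget l)) (PSeq (vset l (ECst 0))
      (PSeq
        (PWhile (EBin OpSub (EGet PA (ECst j%:Z)) (vget l))
          (PSeq (xcomp t.+2 e)
          (PSeq (tset t (EBin OpAdd (tget t) (tget t.+2)))
                (vset l (EBin OpAdd (vget l) (ECst 1))))))
        (vset l (tget t.+1)))))
  end.

Definition rep (s : state) (env : nat -> int) (s1 : state) :=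
  (forall a i, a != EV -> a != TP -> s1 a i = s a i) /\
  (forall l : nat, s1 EV l = env l).

Definition tp_same (t : nat) (s s' : state) := forall i : nat, (i < t)%N -> s' TP i = s TP i.

(* [B] bounds the bit length of all values, [W] the ranges of the sums. *)
Definition bounded (B W : nat) (s : state) (env : nat -> int) :=
  [/\ (0 < B)%N, forall a i, (bitlen (s a i) <= B)%N,
      forall l, (bitlen (env l) <= B)%N & forall j : nat, 0 <= s PA j <= W%:Z].

(** Cost of an expression on numbers of [B] bits: each nested sum costs a factor of order [W]. A
    single [K] serves as coefficient and exponent, which makes costs add up as in [unitD]. *)
Definition unit (K B W : nat) := (K * (B * W.+1 ^ K))%N.

(** [K] depends on [e] and [t] but not on the state or the bounds. This uniformity makes the cost
    polynomial in n once [B] and [W] are. *)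
Definition comp_spec (K t : nat) (e : xexpr) := (bitlen t <= K)%N /\
  forall B W s env s1, bounded B W s env -> rep s env s1 ->
  (bitlen (xeval s env e) <= K * B)%N /\
  exists s1' T, [/\ exec (xcomp t e) s1 T s1', rep s env s1', tp_same t s1 s1',
    s1' TP t = xeval s env e & (T <= unit K B W)%N].

Lemma unit_mono K K' B W : (K <= K')%N -> (unit K B W <= unit K' B W)%N.
Proof. by move=> h; rewrite /unit !leq_mul // leq_pexp2l. Qed.

Lemma unitD K K' B W : (unit K B W + unit K' B W <= unit (K + K') B W)%N.
Proof.
rewrite [leqRHS]/unit mulnDl; apply: leq_add; rewrite leq_mul2l leq_mul2l leq_pexp2l ?orbT //; lia.
Qed.

Lemma leq_unit K B W : (K * B <= unit K B W)%N.
Proof. by rewrite /unit leq_mul2l leq_pmulr ?orbT // expn_gt0. Qed.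

Lemma comp_spec_mono K K' t e : (K <= K')%N -> comp_spec K t e -> comp_spec K' t e.
Proof.
move=> KK' [tK sp]; split; first exact: leq_trans KK'.
move=> B W s env s1 bd rp; have [h [s1' [T [? ? ? ? hT]]]] := sp _ _ _ _ _ bd rp.
split; first exact: leq_trans h (leq_mul KK' (leqnn B)).
by exists s1', T; split=> //; apply: leq_trans hT (unit_mono _ _ KK').
Qed.

Lemma update_ne s a i v b : b != a -> update s a i v b = s b.
Proof. by move=> ba; apply: funext => j; rewrite /update (negPf ba). Qed.

Lemma update_at s a i v : update s a i v a i = v.
Proof. by rewrite /update !eqxx. Qed.

Lemma update_same s a i v j : update s a i v a j = if j == i then v else s a j.
Proof. by rewrite /update eqxx. Qed.

Lemma rep_tset s env s1 i v : rep s env s1 -> rep s env (update s1 TP i v).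
Proof.
by move=> [h1 h2]; split=> [a j aE aT|l]; rewrite update_ne // h1.
Qed.

Lemma rep_vset s env s1 l v : rep s env s1 ->
  rep s (upd_env env l v) (update s1 EV l%:Z v).
Proof.
move=> [h1 h2]; split=> [a j aE aT|l']; first by rewrite update_ne // h1.
by rewrite update_same /upd_env h2.
Qed.

Lemma rep_env s env env' s1 : env =1 env' -> rep s env s1 -> rep s env' s1.
Proof. by move=> e [h1 h2]; split=> // l; rewrite h2 e. Qed.

Lemma tp_same_trans t t' s s' s'' : (t <= t')%N ->
  tp_same t s s' -> tp_same t' s' s'' -> tp_same t s s''.
Proof. by move=> tt h h' i it; rewrite h' ?h // (leq_trans it). Qed.

Lemma tp_same_tset t t' s v : (t <= t')%N -> tp_same t s (update s TP t'%:Z v).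
Proof. by move=> tt i it; rewrite update_same; case: eqP => // -[]; lia. Qed.

Lemma exec_tset t e s : exec (tset t e) s
  (bitlen t%:Z + ecost s e + bitlen t%:Z + bitlen (eval s e))%N
  (update s TP t%:Z (eval s e)).
Proof. exact: ExecSet. Qed.

Lemma exec_vset t e s : exec (vset t e) s
  (bitlen t%:Z + ecost s e + bitlen t%:Z + bitlen (eval s e))%N
  (update s EV t%:Z (eval s e)).
Proof. exact: ExecSet. Qed.

Lemma sum_bitlen n (f : 'I_n -> int) b : (0 < b)%N ->
  (forall i, bitlen (f i) <= b)%N -> (bitlen (\sum_(i < n) f i)%R <= bitlen n + b)%N.
Proof.
move=> b0 hf; rewrite bitlen_leq ?addn_gt0 ?b0 ?orbT // expnD.
apply: (@leq_ltn_trans (n * 2 ^ b)).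
  elim: n f hf => [|n IH] f hf; first by rewrite big_ord0.
  rewrite big_ord_recr /= mulSn addnC.
  have := IH (fun i => f (widen_ord (leqnSn n) i)) (fun i => hf _).
  have := hf ord_max; rewrite bitlen_leq //.
  move: (\sum_(i < n) _) (f ord_max) => x y; lia.
by rewrite ltn_mul2r expn_gt0 /= -[X in (X < _)%N]absz_nat bitlen_ltn.
Qed.

Lemma bounded_env B W s env l v : bounded B W s env -> (bitlen v <= B)%N ->
  bounded B W s (upd_env env l v).
Proof. by move=> [? ? h ?] hv; split=> // l'; rewrite /upd_env; case: eqP. Qed.

Lemma upd_env_id env l v : env l = v -> upd_env env l v =1 env.
Proof. by move=> h l'; rewrite /upd_env; case: eqP => // ->. Qed.

Lemma upd_env_at env l v : upd_env env l v l = v.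
Proof. by rewrite /upd_env eqxx. Qed.

Lemma upd_env2 env l v v' : upd_env (upd_env env l v) l v' =1 upd_env env l v'.
Proof. by move=> l'; rewrite /upd_env; case: eqP. Qed.

Lemma comp_XC t z : exists K, comp_spec K t (XC z).
Proof.
exists (2 * (bitlen t + bitlen z))%N; split; first lia.
move=> B W s env s1 [B0 _ _ _] rp; split; first by move: (bitlen z) => c /=; nia.
exists (update s1 TP t z), (bitlen t%:Z + bitlen z + bitlen t%:Z + bitlen z)%N; split.
- exact: (exec_tset t (ECst z)).
- exact: rep_tset.
- exact: tp_same_tset.
- exact: update_at.
- by apply: leq_trans (leq_unit _ _ _); move: (bitlen t%:Z) (bitlen z) => *; nia.
Qed.

Lemma comp_XV t l : exists K, comp_spec K t (XV l).
Proof.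
exists (2 * bitlen t + 2 * bitlen l + 2)%N; split; first lia.
move=> B W s env s1 [B0 _ be _] rp; have bel := be l; split => /=; first nia.
eexists; eexists; split.
- exact: exec_tset.
- exact: rep_tset.
- exact: tp_same_tset.
- by rewrite update_at /= rp.2.
- rewrite /= rp.2; apply: leq_trans (leq_unit _ _ _).
  by move: (bitlen t%:Z) (bitlen l%:Z) (bitlen (env l)) bel => *; nia.
Qed.

Lemma comp_XG t a e : a != EV -> a != TP ->
  (exists K, comp_spec K t e) -> exists K, comp_spec K t (XG a e).
Proof.
move=> aE aT [K1 [_ sp]]; exists (K1 + (4 * bitlen t + 2 * K1 + 2))%N; split; first lia.
move=> B W s env s1 bd rp; have [B0 bs _ _] := bd.
have [hb [s2 [T [ex rp2 tp2 v2 hT]]]] := sp _ _ _ _ _ bd rp.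
have bsv := bs a (xeval s env e).
split => /=; first by apply: leq_trans bsv _; nia.
eexists; eexists; split.
- exact: ExecSeq ex (exec_tset _ _ _).
- exact: rep_tset.
- exact: tp_same_trans (leqnn t) tp2 (tp_same_tset _ _ _).
- by rewrite update_at /= v2 rp2.1.
- rewrite /= v2 rp2.1 //; apply: leq_trans (unitD _ _ _ _); apply: leq_add hT _.
  apply: leq_trans (leq_unit _ _ _).
  by move: (bitlen t%:Z) (bitlen _) (bitlen _) hb bsv => *; nia.
Qed.

Lemma comp_XB t o e1 e2 :
  (exists K, comp_spec K t e1) -> (exists K, comp_spec K t.+1 e2) ->
  exists K, comp_spec K t (XB o e1 e2).
Proof.
move=> [K1 [_ sp1]] [K2 [_ sp2]].
exists (K1 + (K2 + (4 * bitlen t + 2 * bitlen t.+1 + 3 * K1 + 3 * K2)))%N; split; first lia.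
move=> B W s env s1 bd rp; have [B0 _ _ _] := bd.
have [hb1 [s2 [T1 [ex1 rp1 tp1 v1 hT1]]]] := sp1 _ _ _ _ _ bd rp.
have [hb2 [s3 [T2 [ex2 rp2 tp2 v2 hT2]]]] := sp2 _ _ _ _ _ bd rp1.
have hb := bitlen_binop o (xeval s env e1) (xeval s env e2).
split => /=; first by apply: leq_trans hb _; nia.
eexists; eexists; split.
- exact: ExecSeq ex1 (ExecSeq ex2 (exec_tset _ _ _)).
- exact: rep_tset.
- move=> i it; rewrite (tp_same_tset _ _ (leqnn t)) // tp2 ?tp1 // ltnS ltnW //.
- by rewrite update_at /= v2 tp2 // v1.
- rewrite /= v2 tp2 // v1; apply: leq_trans (unitD _ _ _ _); apply: leq_add hT1 _.
  apply: leq_trans (unitD _ _ _ _); apply: leq_add hT2 _.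
  apply: leq_trans (leq_unit _ _ _).
  move: (bitlen (binop_val _ _ _)) hb => b3 hb.
  by move: (bitlen t%:Z) (bitlen t.+1%:Z) (bitlen _) (bitlen _) b3 hb hb1 hb2 => *; nia.
Qed.

Lemma comp_XIf t e e1 e2 :
  (exists K, comp_spec K t e) ->
  (exists K, comp_spec K t e1) -> (exists K, comp_spec K t e2) ->
  exists K, comp_spec K t (XIf e e1 e2).
Proof.
move=> [K0 [_ sp0]] [K1 [_ sp1]] [K2 [_ sp2]].
exists (K0 + ((2 * bitlen t + K0) + (K1 + K2)))%N; split; first lia.
move=> B W s env s1 bd rp; have [B0 _ _ _] := bd.
have [hb0 [s2 [T0 [ex0 rp0 tp0 v0 hT0]]]] := sp0 _ _ _ _ _ bd rp.
have hc : (ecost s2 (tget t) <= (2 * bitlen t + K0) * B)%N.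
  by rewrite /= v0; move: (bitlen t%:Z) (bitlen _) hb0 => *; nia.
have [hb1 [s3 [T1 [ex1 rp1 tp1 v1 hT1]]]] := sp1 _ _ _ _ _ bd rp0.
have [hb2 [s4 [T2 [ex2 rp2 tp2 v2 hT2]]]] := sp2 _ _ _ _ _ bd rp0.
split => /=.
  by case: ifP => _; [apply: leq_trans hb1 _|apply: leq_trans hb2 _]; nia.
have [pos|npos] := ltP 0 (xeval s env e).
  exists s3, (T0 + (ecost s2 (tget t) + T1))%N; split => //.
  - by apply: ExecSeq ex0 (ExecIfTrue _ _ ex1); rewrite /= v0.
  - exact: tp_same_trans (leqnn t) tp0 tp1.
  - apply: leq_trans (unitD _ _ _ _); apply: leq_add hT0 _.
    apply: leq_trans (unitD _ _ _ _); apply: leq_add; first exact: leq_trans (leq_unit _ _ _).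
    exact: leq_trans hT1 (unit_mono _ _ (leq_addr _ _)).
exists s4, (T0 + (ecost s2 (tget t) + T2))%N; split => //.
- by apply: ExecSeq ex0 (ExecIfFalse _ _ ex2); rewrite /= v0.
- exact: tp_same_trans (leqnn t) tp0 tp2.
- apply: leq_trans (unitD _ _ _ _); apply: leq_add hT0 _.
  apply: leq_trans (unitD _ _ _ _); apply: leq_add; first exact: leq_trans (leq_unit _ _ _).
  exact: leq_trans hT2 (unit_mono _ _ (leq_addl _ _)).
Qed.

Lemma bitlen1 : bitlen 1 = 1%N. Proof. by []. Qed.

Lemma comp_XSum t l j e :
  (exists K, comp_spec K t.+2 e) -> exists K, comp_spec K t (XSum l j e).
Proof.
move=> [K1 [_ sp1]].
pose bt := bitlen t%:Z; pose bt1 := bitlen t.+1%:Z; pose bt2 := bitlen t.+2%:Z.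
pose bl := bitlen l%:Z; pose bj := bitlen j%:Z.
pose c := (20 * (bt + bt1 + bt2 + bl + bj + K1 + 1))%N.
(* [3 * c] pays for the initialisation and for restoring the loop variable, [K1.+1] for at most [W]
   runs of the body (one more power of [W]), and the last [c] for the overhead of the iterations. *)
exists (3 * c + (K1.+1 + c))%N; split; first by rewrite /c -/bt; lia.
move=> B W s env s1 bd rp; have [B0 bs be bp] := bd.
pose n := `|s PA j|%N.
have hx x : (x <= x * B)%N by rewrite leq_pmulr.
have cB : (c * B = 20 * (bt * B + bt1 * B + bt2 * B + bl * B + bj * B + K1 * B + B))%N.
  by rewrite /c -mulnA !mulnDl mul1n.
have nE : s PA j = n%:Z by have := bp j; rewrite /n; lia.
have nW : (n <= W)%N by have := bp j; rewrite nE; lia.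
have bn : (bitlen n%:Z <= B)%N by rewrite -nE; apply: bs.
have bi i : (i <= n)%N -> (bitlen i%:Z <= B)%N.
  by move=> ni; apply: leq_trans bn; apply: bitlen_leq_abs.
pose f i := xeval s (upd_env env l i%:Z) e.
have bf i : (i <= n)%N -> (bitlen (f i) <= K1 * B)%N.
  move=> ni; have bd' := bounded_env l bd (bi _ ni).
  by have [] := sp1 _ _ _ _ _ bd' (rep_vset l _ rp).
have bS i : (i <= n)%N -> (bitlen (\sum_(i' < i) f i')%R <= K1.+1 * B)%N.
  move=> ni; apply: leq_trans (sum_bitlen (b := K1 * B) _ _) _.
  - have := bf 0%N isT; have := bitlen_gt0 (f 0%N); lia.
  - by move=> i'; apply: bf; apply: ltnW; apply: leq_trans ni.
  - by rewrite mulSn leq_add2r; apply: bi.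
split; first by apply: leq_trans (bS _ (leqnn n)) _; rewrite /c; nia.
pose wh := PWhile (EBin OpSub (EGet PA (ECst j%:Z)) (vget l))
          (PSeq (xcomp t.+2 e)
          (PSeq (tset t (EBin OpAdd (tget t) (tget t.+2)))
                (vset l (EBin OpAdd (vget l) (ECst 1))))).
have loop r i sa : (i + r = n)%N -> rep s (upd_env env l i%:Z) sa ->
    sa TP t = \sum_(i' < i) f i' ->
  exists sb T, [/\ exec wh sa T sb, rep s (upd_env env l n%:Z) sb,
    tp_same t sa sb /\ sb TP t.+1 = sa TP t.+1, sb TP t = \sum_(i' < n) f i' &
    (T <= r * (unit K1 B W + c * B) + c * B)%N].
  elim: r i sa => [|r IH] i sa ir rpa va.
    rewrite addn0 in ir; subst i; have bnn := bi n (leqnn n).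
    exists sa; eexists; split; [apply: ExecWhileFalse| | | |] => //.
      by rewrite /= rpa.1 // rpa.2 nE upd_env_at subrr.
    rewrite /= mul0n rpa.1 // rpa.2 nE upd_env_at -/bj -/bl.
    by move: bnn; move: (bitlen n) => ?; nia.
  have i_n : (i < n)%N by lia.
  have bii := bi i (ltnW i_n); have bii1 := bi i.+1 i_n.
  have bd' := bounded_env l bd bii.
  have [hb [s2 [T1 [ex1 rp1 tp1 v1 hT1]]]] := sp1 _ _ _ _ _ bd' rpa.
  pose s3 := update s2 TP t (\sum_(i' < i.+1) f i').
  have ve3 : eval s2 (EBin OpAdd (tget t) (tget t.+2)) = \sum_(i' < i.+1) f i'.
    by rewrite /= v1 tp1 // va big_ord_recr.
  have ex3 := exec_tset t (EBin OpAdd (tget t) (tget t.+2)) s2.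
  rewrite ve3 -/s3 in ex3.
  have rp3 : rep s (upd_env env l i%:Z) s3 by apply: rep_tset.
  pose s4 := update s3 EV l i.+1%:Z.
  have ve4 : eval s3 (EBin OpAdd (vget l) (ECst 1)) = i.+1%:Z.
    by rewrite /= rp3.2 upd_env_at; lia.
  have ex4 := exec_vset l (EBin OpAdd (vget l) (ECst 1)) s3.
  rewrite ve4 -/s4 in ex4.
  have rp4 : rep s (upd_env env l i.+1%:Z) s4.
    by apply: rep_env (rep_vset l _ rp3) => l'; rewrite upd_env2.
  have v4 : s4 TP t = \sum_(i' < i.+1) f i' by rewrite /s4 update_ne // /s3 update_at.
  have [|sb [T [exb rpb [tpb tpb1] vb hT]]] := IH i.+1 s4 _ rp4 v4; first lia.
  exists sb; eexists; split.
  - apply: ExecWhileTrue exb; last exact: ExecSeq ex1 (ExecSeq ex3 ex4).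
    by rewrite /= rpa.1 // rpa.2 nE upd_env_at; lia.
  - by [].
  - split.
      move=> i' it; rewrite tpb // /s4 update_ne // /s3 update_same.
      by case: eqP => [[]|_]; [lia | rewrite tp1 //; lia].
    rewrite tpb1 /s4 update_ne // /s3 update_same.
    by case: eqP => [[]|_]; [lia | rewrite tp1].
  - by [].
  - have hbS := bS _ (ltnW i_n); have hbS1 := bS _ i_n.
    rewrite /= rpa.1 // rpa.2 nE tp1 // va v1 !rp3.2 upd_env_at bitlen1.
    rewrite -/(f i) -/bt -/bt1 -/bt2 -/bl -/bj (mulSn r).
    rewrite -/(f i) in hb.
    have := cB; move: bii bii1 hb hbS hbS1 bn hT1 hT (hx bt) (hx bt2) (hx bl) (hx bj).
    rewrite (mulSn K1) (mulnDr r); move: (bitlen (\sum_(_ < i) _)) (bitlen (\sum_(_ < i.+1) _)) (r * unit K1 B W)%N (r * (c * B))%N (unit K1 B W) (c * B)%N.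
    move: (bitlen (f i)) (bitlen n) (bitlen i) (bitlen i.+1).
    move: (bt1 * B)%N (bt * B)%N (bt2 * B)%N (bl * B)%N (bj * B)%N (K1 * B)%N (bt) (bt2) (bl) (bj).
    by clear -B0 => *; lia.
pose s2 := update s1 TP t 0.
have rp2 : rep s env s2 by apply: rep_tset.
pose s3 := update s2 TP t.+1 (env l).
have rp3 : rep s env s3 by apply: rep_tset.
pose s4 := update s3 EV l 0.
have rp4 : rep s (upd_env env l 0%:Z) s4 by apply: rep_vset.
have ex2 : exec (tset t (ECst 0)) s1 (2 * bt + 2)%N s2.
  have -> : (2 * bt + 2 = bt + 1 + bt + 1)%N by lia.
  exact: (exec_tset t (ECst 0)).
have ex3 : exec (tset t.+1 (vget l)) s2 (2 * bt1 + 2 * bl + 2 * bitlen (env l))%N s3.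
  have := exec_tset t.+1 (vget l) s2; rewrite /= rp2.2 -/bt1 -/bl.
  by congr (exec _ _ _ _); lia.
have ex4 : exec (vset l (ECst 0)) s3 (2 * bl + 2)%N s4.
  have -> : (2 * bl + 2 = bl + 1 + bl + 1)%N by lia.
  exact: (exec_vset l (ECst 0)).
have v4 : s4 TP t = \sum_(i' < 0) f i'.
  by rewrite big_ord0 /s4 update_ne // /s3 update_same; case: eqP => [[]|_]; [lia|rewrite /s2 update_at].
have v41 : s4 TP t.+1 = env l by rewrite /s4 update_ne // /s3 update_at.
have [sb [T [exb rpb [tpb tpb1] vb hT]]] := loop n 0%N s4 (add0n n) rp4 v4.
pose s5 := update sb EV l (env l).
have ex5 : exec (vset l (tget t.+1)) sb (2 * bl + 2 * bt1 + 2 * bitlen (env l))%N s5.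
  have := exec_vset l (tget t.+1) sb; rewrite /= tpb1 v41 -/bt1 -/bl.
  by congr (exec _ _ _ _); lia.
exists s5; eexists; split.
- exact: ExecSeq ex2 (ExecSeq ex3 (ExecSeq ex4 (ExecSeq exb ex5))).
- apply: rep_env (rep_vset l (env l) rpb) => l'; rewrite upd_env2.
  exact: upd_env_id.
- move=> i it; rewrite /s5 update_ne // tpb // /s4 update_ne // /s3 update_same.
  case: eqP => [[]|_]; first lia.
  by rewrite /s2 update_same; case: eqP => [[]|_ //]; lia.
- by rewrite /s5 update_ne.
- apply: leq_trans (_ : 3 * c * B + (W * (unit K1 B W + c * B)) <= _)%N.
    have := be l; move: hT (hx bt) (hx bt1) (hx bl).
    have := leq_mul nW (leqnn (unit K1 B W + c * B)%N); rewrite -mulnA cB.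
    move: (bitlen (env l)) (n * _)%N (W * _)%N => *.
    lia.
  apply: leq_trans (unitD _ _ _ _); apply: leq_add; first exact: leq_unit.
  rewrite mulnDr; apply: leq_trans (unitD _ _ _ _); apply: leq_add.
    rewrite /unit expnS (mulnCA W) leq_mul // (mulnCA W) leq_mul // leq_mul //.
have c1 : (0 < c)%N by rewrite /c; lia.
rewrite /unit (mulnCA W) leq_mul // mulnC leq_mul //.
apply: leq_trans (leqnSn W) _; rewrite -[X in (X <= _)%N]expn1.
by rewrite leq_pexp2l.
Qed.

Lemma comp_specP e t : xwf e -> exists K, comp_spec K t e.
Proof.
elim: e t => [z|l|a e IH|o e1 IH1 e2 IH2|e IH e1 IH1 e2 IH2|l j e IH] t /=.
- by move=> _; apply: comp_XC.
- by move=> _; apply: comp_XV.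
- by move=> /and3P[aE aT we]; apply: comp_XG => //; apply: IH.
- by move=> /andP[w1 w2]; apply: comp_XB; [apply: IH1 | apply: IH2].
- by move=> /and3P[w w1 w2]; apply: comp_XIf; [apply: IH|apply: IH1|apply: IH2].
- by move=> we; apply: comp_XSum; apply: IH.
Qed.

(** * Commands and their cost *)

Inductive cmd :=
  | CSet of nat & xexpr & xexpr
  | CSeq of cmd & cmd
  | CFor of nat & xexpr & cmd.  (* the bound is evaluated once *)

Fixpoint cwf (c : cmd) : bool :=
  match c with
  | CSet a e1 e2 => [&& a != EV, a != TP, xwf e1 & xwf e2]
  | CSeq c1 c2 => cwf c1 && cwf c2
  | CFor _ e c => xwf e && cwf c
  end.

Fixpoint ccomp (t : nat) (c : cmd) : prog :=
  match c with
  | CSet a e1 e2 =>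
      PSeq (xcomp t e1) (PSeq (xcomp t.+1 e2) (PSet a (tget t) (tget t.+1)))
  | CSeq c1 c2 => PSeq (ccomp t c1) (ccomp t c2)
  | CFor l e c =>
      PSeq (xcomp t e) (PSeq (tset t.+1 (vget l)) (PSeq (vset l (ECst 0))
      (PSeq
        (PWhile (EBin OpSub (tget t) (vget l))
          (PSeq (ccomp t.+2 c) (vset l (EBin OpAdd (vget l) (ECst 1)))))
        (vset l (tget t.+1)))))
  end.

(** Collects one constant [K] valid for all expressions inside [c]. No cost is stated here, as the
    number of iterations depends on the run; [wpc] counts it in units. *)
Fixpoint ccomp_spec (K t : nat) (c : cmd) : Prop :=
  match c with
  | CSet a e1 e2 => [/\ a != EV, a != TP, comp_spec K t e1 & comp_spec K t.+1 e2]
  | CSeq c1 c2 => ccomp_spec K t c1 /\ ccomp_spec K t c2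
  | CFor l e c => [/\ (0 < K)%N, (bitlen l <= K)%N, (bitlen t.+1 <= K)%N,
                    comp_spec K t e & ccomp_spec K t.+2 c]
  end.

Lemma ccomp_spec_mono K K' t c : (K <= K')%N -> ccomp_spec K t c -> ccomp_spec K' t c.
Proof.
move=> KK'; elim: c t => [a e1 e2|c1 IH1 c2 IH2|l e c IH] t /=.
- by case=> ? ? h1 h2; split=> //; apply: comp_spec_mono KK' _.
- by case=> h1 h2; split; [apply: IH1|apply: IH2].
- case=> h1 h2 h3 h4 h5; split; [lia|lia|lia| |exact: IH].
  exact: comp_spec_mono KK' h4.
Qed.

Lemma ccomp_specP c t : cwf c -> exists K, ccomp_spec K t c.
Proof.
elim: c t => [a e1 e2|c1 IH1 c2 IH2|l e c IH] t /=.
- move=> /and4P[? ? w1 w2].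
  have [K1 h1] := comp_specP t w1; have [K2 h2] := comp_specP t.+1 w2.
  exists (K1 + K2)%N; split=> //; first exact: comp_spec_mono (leq_addr _ _) h1.
  exact: comp_spec_mono (leq_addl _ _) h2.
- move=> /andP[w1 w2]; have [K1 h1] := IH1 t w1; have [K2 h2] := IH2 t w2.
  exists (K1 + K2)%N.
  split; first exact: ccomp_spec_mono (leq_addr _ _) h1.
  exact: ccomp_spec_mono (leq_addl _ _) h2.
- move=> /andP[w1 w2]; have [K1 h1] := comp_specP t w1; have [K2 h2] := IH t.+2 w2.
  exists (1 + bitlen l + bitlen t.+1 + K1 + K2)%N; split; try lia.
    by apply: comp_spec_mono h1; lia.
  by apply: ccomp_spec_mono h2; lia.
Qed.

(* Running [c] from [s] reaches a state satisfying [Q] within [m] units. *)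
Definition wpc (B W K t : nat) (c : cmd) env s (m : nat) (Q : state -> Prop) :=
  ccomp_spec K t c -> forall s1, bounded B W s env -> rep s env s1 ->
  exists s' s1' T, [/\ exec (ccomp t c) s1 T s1', rep s' env s1' /\ tp_same t s1 s1',
    bounded B W s' env, Q s' & (T <= m * unit K B W)%N].

Lemma wpc_mono B W K t c env s m m' (Q Q' : state -> Prop) :
  wpc B W K t c env s m Q -> (m <= m')%N -> (forall s', Q s' -> Q' s') ->
  wpc B W K t c env s m' Q'.
Proof.
move=> h mm QQ sp s1 bd rp; have [s' [s1' [T [? ? ? /QQ ? hT]]]] := h sp s1 bd rp.
by exists s', s1', T; split=> //; apply: leq_trans hT (leq_mul _ _).
Qed.

Lemma wpc_seq B W K t c1 c2 env s m1 m2 (Q : state -> Prop) :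
  wpc B W K t c1 env s m1 (fun s' => wpc B W K t c2 env s' m2 Q) ->
  wpc B W K t (CSeq c1 c2) env s (m1 + m2) Q.
Proof.
move=> h [sp1 sp2] s1 bd rp.
have [s' [s1' [T1 [ex1 [rp1 tp1] bd1 h2 hT1]]]] := h sp1 s1 bd rp.
have [s'' [s1'' [T2 [ex2 [rp2 tp2] bd2 q hT2]]]] := h2 sp2 s1' bd1 rp1.
exists s'', s1'', (T1 + T2)%N; split=> //; first exact: ExecSeq ex1 ex2.
  by split=> //; apply: tp_same_trans (leqnn t) tp1 tp2.
by rewrite mulnDl leq_add.
Qed.

(** The condition on [PA] preserves the bound [W] on the ranges of the sums. Two of the ten units
    pay for the two expressions, the others for the store. *)
Lemma wpc_set B W K t a e1 e2 env s (Q : state -> Prop) :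
  (bitlen (xeval s env e2) <= B)%N ->
  (a = PA -> 0 <= xeval s env e2 <= W%:Z) ->
  Q (update s a (xeval s env e1) (xeval s env e2)) ->
  wpc B W K t (CSet a e1 e2) env s 10 Q.
Proof.
move=> hv hPA q [aE aT sp1 sp2] s1 bd rp; have [B0 bs be bp] := bd.
have [tK sp1'] := sp1; have [t1K sp2'] := sp2.
have [hb1 [s2 [T1 [ex1 rp1 tp1 v1 hT1]]]] := sp1' _ _ _ _ _ bd rp.
have [hb2 [s3 [T2 [ex2 rp2 tp2 v2 hT2]]]] := sp2' _ _ _ _ _ bd rp1.
have v1' : eval s3 (tget t) = xeval s env e1 by rewrite /= tp2 // v1.
have v2' : eval s3 (tget t.+1) = xeval s env e2 by [].
have ex3 := ExecSet s3 a (tget t) (tget t.+1); rewrite v1' v2' in ex3.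
have tp13 : tp_same t s1 s3.
  exact: tp_same_trans (leqnn t) tp1 (fun i it => tp2 i (ltnW it : (i < t.+1)%N)).
eexists; eexists; eexists; split.
- exact: ExecSeq ex1 (ExecSeq ex2 ex3).
- split; last by move=> i it; rewrite update_ne ?tp13 // eq_sym.
  split=> [b i bE bT|l]; last by rewrite update_ne ?rp2.2 // eq_sym.
  by rewrite /update rp2.1.
- split=> //.
    by move=> b i; rewrite /update; case: ifP.
  move=> j; rewrite /update; case: ifP => // /andP[/eqP e _].
  by apply: hPA.
- exact: q.
- rewrite /= tp2 // v1 v2.
  have hu := leq_unit K B W.
  have hK : (K <= K * B)%N by rewrite leq_pmulr.
  move: hb1 hb2 hT1 hT2 tK t1K hK hu.
  move: (bitlen (xeval _ _ e1)) (bitlen (xeval _ _ e2)) (bitlen t%:Z) (bitlen t.+1%:Z).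
  move: (unit _ _ _) (K * B)%N => *; lia.
Qed.

Lemma wpc_for B W K t l e c env s mb (r : nat) (I : nat -> state -> Prop) (Q : state -> Prop) :
  xeval s env e = r%:Z -> (bitlen r <= B)%N -> I 0%N s ->
  (forall i s', (i < r)%N -> I i s' ->
    wpc B W K t.+2 c (upd_env env l i%:Z) s' mb (I i.+1)) ->
  (forall s', I r s' -> Q s') ->
  wpc B W K t (CFor l e c) env s (r * (mb + 30) + 30) Q.
Proof.
move=> er br I0 IS IQ [K0 lK t1K [tK spe] spc] s1 bd rp; have [B0 bs be bp] := bd.
have [hbe [s2 [T1 [ex1 rp1 tp1 v1 hT1]]]] := spe _ _ _ _ _ bd rp.
rewrite er in v1.
have hu := leq_unit K B W.
have hK : (K <= K * B)%N by rewrite leq_pmulr.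
have hB : (B <= K * B)%N by rewrite leq_pmull.
pose u := unit K B W.
have bi i : (i <= r)%N -> (bitlen i <= B)%N.
  by move=> ir; apply: leq_trans br; apply: bitlen_leq_abs.
pose wh := PWhile (EBin OpSub (tget t) (vget l))
          (PSeq (ccomp t.+2 c) (vset l (EBin OpAdd (vget l) (ECst 1)))).
have loop d i sx sa : (i + d = r)%N -> I i sx -> bounded B W sx env ->
    rep sx (upd_env env l i%:Z) sa -> sa TP t = r%:Z ->
  exists s' sb T, [/\ exec wh sa T sb, rep s' (upd_env env l r%:Z) sb /\ I r s',
    tp_same t.+2 sa sb, bounded B W s' env &
    (T <= d * ((mb + 20) * u) + 8 * u)%N].
  elim: d i sx sa => [|d IH] i sx sa ir Ii bdx rpa va.
    rewrite addn0 in ir; subst i.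
    exists sx, sa; eexists; split; [apply: ExecWhileFalse| | | |] => //.
      by rewrite /= va rpa.2 upd_env_at subrr.
    rewrite /= mul0n va rpa.2 upd_env_at add0n.
    move: br hB hK hu tK lK; rewrite -/u.
    by move: (bitlen r) (bitlen t%:Z) (bitlen l%:Z) (K * B)%N (u) => *; lia.
  have i_r : (i < r)%N by lia.
  have bdi := bounded_env l bdx (bi i (ltnW i_r)).
  have [sy [s3 [T2 [ex2 [rp2 tp2] bd2 I2 hT2]]]] := IS i sx i_r Ii spc sa bdi rpa.
  pose s4 := update s3 EV l i.+1%:Z.
  have ve4 : eval s3 (EBin OpAdd (vget l) (ECst 1)) = i.+1%:Z.
    by rewrite /= rp2.2 upd_env_at; lia.
  have ex4 := exec_vset l (EBin OpAdd (vget l) (ECst 1)) s3.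
  rewrite ve4 -/s4 in ex4.
  have rp4 : rep sy (upd_env env l i.+1%:Z) s4.
    by apply: rep_env (rep_vset l _ rp2) => l'; rewrite upd_env2.
  have bd4 : bounded B W sy env by case: bd2.
  have v4 : s4 TP t = r by rewrite /s4 update_ne // tp2.
  have [|s' [sb [T [exb rpb tpb bdb hT]]]] := IH i.+1 sy s4 _ I2 bd4 rp4 v4; first lia.
  exists s', sb; eexists; split.
  - apply: ExecWhileTrue exb; last exact: ExecSeq ex2 ex4.
    by rewrite /= va rpa.2 upd_env_at; lia.
  - by [].
  - by move=> j jt; rewrite tpb // /s4 update_ne // tp2.
  - by [].
  - rewrite /= va rpa.2 rp2.2 !upd_env_at bitlen1.
    move: (bi _ i_r) (bi _ (ltnW i_r)) br hT2 hT hu hK hB tK lK.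
    rewrite -/u (mulSn d) [in X in _ -> X](mulnDl mb 20 u).
    move: (mb * u)%N (d * _)%N.
    by move: (bitlen i) (bitlen i.+1) (bitlen r) (bitlen t%:Z) (bitlen l%:Z) (K * B)%N (u) => *; lia.
pose s3 := update s2 TP t.+1 (env l).
have rp3 : rep s env s3 by apply: rep_tset.
pose s4 := update s3 EV l 0.
have rp4 : rep s (upd_env env l 0%:Z) s4 by apply: rep_vset.
have ex3 : exec (tset t.+1 (vget l)) s2 (2 * bitlen t.+1 + 2 * bitlen l + 2 * bitlen (env l))%N s3.
  have := exec_tset t.+1 (vget l) s2; rewrite /= rp1.2.
  by congr (exec _ _ _ _); lia.
have ex4 : exec (vset l (ECst 0)) s3 (2 * bitlen l + 2)%N s4.
  have -> : (2 * bitlen l + 2 = bitlen l + 1 + bitlen l + 1)%N by lia.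
  exact: (exec_vset l (ECst 0)).
have v4 : s4 TP t = r.
  by rewrite /s4 update_ne // /s3 update_same; case: eqP => [[]|_] //; lia.
have v41 : s4 TP t.+1 = env l by rewrite /s4 update_ne // /s3 update_at.
have [s' [sb [T [exb [rpb Ir] tpb bdb hT]]]] := loop r 0%N s s4 (add0n r) I0 bd rp4 v4.
pose s5 := update sb EV l (env l).
have ex5 : exec (vset l (tget t.+1)) sb (2 * bitlen l + 2 * bitlen t.+1 + 2 * bitlen (env l))%N s5.
  have := exec_vset l (tget t.+1) sb; rewrite /= tpb // v41.
  by congr (exec _ _ _ _); lia.
exists s', s5; eexists; split.
- exact: ExecSeq ex1 (ExecSeq ex3 (ExecSeq ex4 (ExecSeq exb ex5))).
- split.
    by apply: rep_env (rep_vset l (env l) rpb) => l'; rewrite upd_env2; apply: upd_env_id.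
  move=> i it; rewrite /s5 update_ne // tpb ?(leq_trans it) //; last lia.
  by rewrite /s4 update_ne // /s3 update_same; case: eqP => [[]|_]; [lia | rewrite tp1].
- by [].
- exact: IQ.
- have -> : ((r * (mb + 30) + 30) * unit K B W = r * ((mb + 20) * u) + r * (10 * u) + 30 * u)%N.
    by rewrite -/u; lia.
  move: (be l) br hT1 hT hu hK hB tK lK t1K; rewrite -/u.
  move: (r * _)%N (r * (10 * u))%N.
  by move: (bitlen (env l)) (bitlen t%:Z) (bitlen t.+1%:Z) (bitlen l%:Z) (K * B)%N (u) => *; lia.
Qed.

(** * The reduction as a program *)

Definition ev s env e (n : nat) := xeval s env e = n%:Z.

Definition Xadd := XB OpAdd.
Definition Xsub := XB OpSub.
Definition Xmul := XB OpMul.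
Definition Xdiv := XB OpDiv.
Definition Xn (n : nat) := XC n%:Z.
Definition Xmod e1 e2 := Xsub e1 (Xmul (Xdiv e1 e2) e2).
Definition Xlt e1 e2 := XIf (Xsub e2 e1) (Xn 1) (Xn 0).
Definition Xle e1 e2 := Xlt e1 (Xadd e2 (Xn 1)).
Definition Xeq e1 e2 := Xmul (Xle e1 e2) (Xle e2 e1).
Definition Xor e1 e2 := XIf (Xadd e1 e2) (Xn 1) (Xn 0).
Definition Xsumk (k : nat) (f : nat -> xexpr) :=
  iteri k (fun i acc => Xadd acc (f i)) (Xn 0).
Definition Xpow e (i : nat) := iter i (Xmul e) (Xn 1).
(** Expressions have powers with fixed exponents only, so [theta i], whose exponent varies, is
    looked up in a finite table. *)
Definition Xtab (m : nat) (g : nat -> nat) e :=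
  Xsumk m (fun j => Xmul (Xeq e (Xn j)) (Xn (g j))).

Section Ev.
Variables (s : state) (env : nat -> int).
Notation evl := (ev s env).

Lemma ev_n n : evl (Xn n) n. Proof. by []. Qed.

Lemma ev_add e1 e2 n1 n2 : evl e1 n1 -> evl e2 n2 -> evl (Xadd e1 e2) (n1 + n2)%N.
Proof. by rewrite /ev /= => -> ->. Qed.

Lemma ev_sub e1 e2 n1 n2 : evl e1 n1 -> evl e2 n2 -> (n2 <= n1)%N -> evl (Xsub e1 e2) (n1 - n2)%N.
Proof. by rewrite /ev /= => -> -> h; rewrite subzn. Qed.

Lemma ev_mul e1 e2 n1 n2 : evl e1 n1 -> evl e2 n2 -> evl (Xmul e1 e2) (n1 * n2)%N.
Proof. by rewrite /ev /= => -> ->. Qed.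

Lemma ev_div e1 e2 n1 n2 : evl e1 n1 -> evl e2 n2 -> evl (Xdiv e1 e2) (n1 %/ n2)%N.
Proof. by rewrite /ev /= => -> ->; rewrite divz_nat. Qed.

Lemma ev_mod e1 e2 n1 n2 : evl e1 n1 -> evl e2 n2 -> evl (Xmod e1 e2) (n1 %% n2)%N.
Proof.
move=> h1 h2; have h : (n1 %/ n2 * n2 <= n1)%N by rewrite leq_divM.
have -> : (n1 %% n2 = n1 - n1 %/ n2 * n2)%N by have := divn_eq n1 n2; lia.
exact: ev_sub h1 (ev_mul (ev_div h1 h2) h2) h.
Qed.

Lemma ev_if e e1 e2 n n1 n2 : evl e n -> ((0 < n)%N -> evl e1 n1) -> (n = 0%N -> evl e2 n2) ->
  evl (XIf e e1 e2) (if (0 < n)%N then n1 else n2).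
Proof.
rewrite /ev /= => -> h1 h2; rewrite ltz_nat; case: ltnP => [/h1 //|]; rewrite leqn0 => /eqP.
exact: h2.
Qed.

Lemma ev_lt e1 e2 n1 n2 : evl e1 n1 -> evl e2 n2 -> evl (Xlt e1 e2) (n1 < n2)%N.
Proof. by rewrite /ev /= => -> ->; rewrite subr_gt0 ltz_nat; case: ltnP. Qed.

Lemma ev_le e1 e2 n1 n2 : evl e1 n1 -> evl e2 n2 -> evl (Xle e1 e2) (n1 <= n2)%N.
Proof. by move=> h1 h2; have := ev_lt h1 (ev_add h2 (ev_n 1)); rewrite addn1 ltnS. Qed.

Lemma ev_and e1 e2 (b1 b2 : bool) : evl e1 b1 -> evl e2 b2 -> evl (Xmul e1 e2) (b1 && b2).
Proof. by move=> h1 h2; have := ev_mul h1 h2; rewrite mulnb. Qed.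

Lemma ev_eq e1 e2 n1 n2 : evl e1 n1 -> evl e2 n2 -> evl (Xeq e1 e2) (n1 == n2).
Proof. by move=> h1 h2; have := ev_and (ev_le h1 h2) (ev_le h2 h1); rewrite eqn_leq. Qed.

Lemma ev_or e1 e2 (b1 b2 : bool) : evl e1 b1 -> evl e2 b2 -> evl (Xor e1 e2) (b1 || b2).
Proof. by rewrite /ev /= => -> ->; case: b1 b2 => -[]. Qed.

Lemma ev_ifb e e1 e2 (b : bool) n1 n2 : evl e b -> (b -> evl e1 n1) -> (~~ b -> evl e2 n2) ->
  evl (XIf e e1 e2) (if b then n1 else n2).
Proof.
by rewrite /ev /=; case: b => -> h1 h2; [apply: h1|apply: h2].
Qed.

Lemma ev_sumk k f g : (forall i, (i < k)%N -> evl (f i) (g i)) ->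
  evl (Xsumk k f) (\sum_(i < k) g i)%N.
Proof.
elim: k => [|k IH] h; first by rewrite big_ord0.
rewrite big_ord_recr /=; apply: ev_add; last exact: h.
by apply: IH => i ik; apply: h; apply: ltnW.
Qed.

Lemma ev_pow e n i : evl e n -> evl (Xpow e i) (n ^ i)%N.
Proof. by move=> h; elim: i => [//|i IH]; rewrite expnS; apply: ev_mul. Qed.

Lemma ev_tab m g e n : evl e n -> (n < m)%N -> evl (Xtab m g e) (g n).
Proof.
move=> h nm.
have := @ev_sumk m (fun j => Xmul (Xeq e (Xn j)) (Xn (g j))) (fun j => (n == j) * g j)%N.
rewrite (bigD1 (Ordinal nm)) //= eqxx mul1n big1 ?addn0; first by apply=> i _; apply: ev_mul => //; apply: ev_eq.
by move=> i; rewrite -val_eqE /= eq_sym => /negPf ->.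
Qed.

Lemma ev_sum l j e m g : s PA j%:Z = m%:Z ->
  (forall i, (i < m)%N -> ev s (upd_env env l i%:Z) e (g i)) ->
  evl (XSum l j e) (\sum_(i < m) g i)%N.
Proof.
move=> hm h; rewrite /ev /= hm absz_nat.
have -> : (\sum_(i < m) g i)%N%:Z = \sum_(i < m) (g i)%:Z.
  by elim/big_rec2: _ => // i x y _ <-.
by apply: eq_bigr => i _; apply: h.
Qed.
End Ev.

Lemma xwf_sumk k f : (forall i, xwf (f i)) -> xwf (Xsumk k f).
Proof. by move=> h; elim: k => //= k IH; rewrite IH h. Qed.

Lemma xwf_pow e i : xwf e -> xwf (Xpow e i).
Proof. by move=> h; elim: i => //= i ->; rewrite h. Qed.

Definition isarr (s : state) (a U : nat) (f : nat -> bool) :=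
  forall c, (c < U)%N -> s a c%:Z = (f c : nat)%:Z.

Lemma ev_arr s env a U f e c : isarr s a U f -> ev s env e c -> (c < U)%N ->
  ev s env (XG a e) (f c).
Proof. by rewrite /ev /= => h -> cU; rewrite h. Qed.

(** In this order: input, powers of two, input formula, current formula, clauses being added,
    parsing position, selected flower, current point, output. [OUT] comes last so that a program
    shifted by [OUT] finds its input there and zeros in all later arrays. *)
Definition IN := 0%N.
Definition PW := 5%N.
Definition FI := 6%N.
Definition FF := 7%N.
Definition NN := 8%N.
Definition POS := 9%N.
Definition SQ := 10%N.
Definition SX := 11%N.
Definition OUT := 12%N.

Section Expr.
Variables (k alpha : nat).

Definition Xvn := XG IN (Xn 0).
Definition XM := Xadd (Xmul (Xn 2) Xvn) (Xn 1).
Definition XU := XG PA (Xn 0).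
Definition XQ := XG PA (Xn 1).
Definition Xdig c i := Xmod (Xdiv c (Xpow XM i)) XM.
Definition Xcsize c := Xsumk k (fun i => Xlt (Xn 0) (Xdig c i)).
Definition Xcsub h c := Xeq (Xsumk k (fun i =>
  Xor (Xeq (Xdig h i) (Xn 0)) (Xeq (Xdig h i) (Xdig c i)))) (Xn k).
Definition Xcdiff c h := Xsumk k (fun i =>
  Xmul (Xmul (Xeq (Xdig h i) (Xn 0)) (Xdig c i)) (Xpow XM i)).
Definition Xxc x := Xdiv (Xdiv x XU) (Xn k.+1).
Definition Xxi x := Xmod (Xdiv x XU) (Xn k.+1).
Definition Xxh x := Xmod x XU.
Definition Xcdeg h c l := XSum l 0
  (Xmul (XG FF (XV l)) (Xmul (Xeq (Xcsize (XV l)) c) (Xcsub h (XV l)))).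
Definition Xisflower x l :=
  Xmul (Xlt (Xn 0) (Xxi x)) (Xmul (Xlt (Xxi x) (Xxc x))
  (Xmul (Xeq (Xadd (Xcsize (Xxh x)) (Xxi x)) (Xxc x))
  (Xle (Xtab k.+1 (theta alpha) (Xxi x)) (Xcdeg (Xxh x) (Xxc x) l)))).
(** Variables 0 to 3 belong to the loops of the commands and 4 to 6 to the sums, so none is
    captured. *)
Definition Xsel := XSum 4 1 (Xeq (XSum 5 1
  (Xmul (Xle (XV 5) (XV 4)) (Xisflower (XV 5) 6))) (Xn 0)).
Definition Xcmin := Xmul (XG FI (XV 3)) (Xeq (XSum 4 0
  (Xmul (XG FI (XV 4)) (Xmul (Xcsub (XV 4) (XV 3))
    (Xsub (Xn 1) (Xeq (XV 4) (XV 3)))))) (Xn 0)).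
Definition Xq := XG SQ (Xn 0).
Definition Xnew v := XIf (Xlt Xq XQ)
  (XIf (Xlt (XV 2) v) (Xeq (XV 3) (Xxh Xq))
  (XIf (Xeq (XV 2) v)
     (Xlt (Xn 0) (XSum 4 0 (Xmul (XG FF (XV 4)) (Xmul (Xeq (Xcsize (XV 4)) (Xxc Xq))
       (Xmul (Xcsub (Xxh Xq) (XV 4)) (Xeq (Xcdiff (XV 4) (Xxh Xq)) (XV 3)))))))
     (Xn 0))) (Xn 0).
Definition Xcupd := Xor (XG NN (XV 3)) (Xmul (XG FF (XV 3))
  (Xeq (XSum 4 0 (Xmul (XG NN (XV 4)) (Xcsub (XV 4) (XV 3)))) (Xn 0))).
Definition Xrank c l := XSum l 0 (Xmul (XG FF (XV l)) (Xlt (XV l) c)).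

Section EvExpr.
Variables (n : nat) (s : state).
Notation M := (2 * n + 1)%N.
Notation U := (M ^ k)%N.
Notation Q := (search_bound M k).
Hypotheses (s_n : s IN 0 = n%:Z) (s_U : s PA 0 = U%:Z) (s_Q : s PA 1 = Q%:Z).

Lemma ev_M env : ev s env XM M.
Proof. by apply: ev_add => //; apply: ev_mul. Qed.

Lemma ev_dig env e c i : ev s env e c -> ev s env (Xdig e i) (dig M c i).
Proof.
move=> h; apply: ev_mod (ev_M env); apply: ev_div => //; apply: ev_pow; exact: ev_M.
Qed.

Lemma ev_csize env e c : ev s env e c -> ev s env (Xcsize e) (csize M k c).
Proof. by move=> h; apply: (@ev_sumk s env k _ (fun i => (0 < dig M c i)%N)) => i _; apply: ev_lt => //; apply: ev_dig. Qed.

Lemma ev_csub env e1 e2 h c : ev s env e1 h -> ev s env e2 c ->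
  ev s env (Xcsub e1 e2) (csub M k h c).
Proof.
move=> h1 h2; apply: ev_eq => //.
apply: (@ev_sumk s env k _ (fun i => (dig M h i == 0%N) || (dig M h i == dig M c i))) => i _.
by apply: ev_or; apply: ev_eq => //; apply: ev_dig.
Qed.

Lemma ev_cdiff env e1 e2 c h : ev s env e1 c -> ev s env e2 h ->
  ev s env (Xcdiff e1 e2) (cdiff M k c h).
Proof.
move=> h1 h2.
apply: (@ev_sumk s env k _ (fun i => ((dig M h i == 0%N) * dig M c i * M ^ i)%N)) => i _.
apply: ev_mul; last by apply: ev_pow; apply: ev_M.
by apply: ev_mul; [apply: ev_eq => //|]; apply: ev_dig.
Qed.

Lemma ev_U env : ev s env XU U. Proof. exact: s_U. Qed.
Lemma ev_Q env : ev s env XQ Q. Proof. exact: s_Q. Qed.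

Lemma ev_xc env e x : ev s env e x -> ev s env (Xxc e) (xc M k x).
Proof. by move=> h; apply: ev_div => //; apply: ev_div => //; apply: ev_U. Qed.
Lemma ev_xi env e x : ev s env e x -> ev s env (Xxi e) (xi M k x).
Proof. by move=> h; apply: ev_mod => //; apply: ev_div => //; apply: ev_U. Qed.
Lemma ev_xh env e x : ev s env e x -> ev s env (Xxh e) (xh M k x).
Proof. by move=> h; apply: ev_mod => //; apply: ev_U. Qed.

Lemma ev_var env l i : ev s (upd_env env l i%:Z) (XV l) i.
Proof. by rewrite /ev /= upd_env_at. Qed.

Lemma ev_isflower f env l e x : isarr s FF U f ->
  (forall i : nat, ev s (upd_env env l i%:Z) e x) -> ev s env e x ->
  ev s env (Xisflower e l) (isflower M k alpha f x).
Proof.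
move=> hf hi h; apply: ev_and; first by apply: ev_lt => //; apply: ev_xi.
apply: ev_and; first by apply: ev_lt; [apply: ev_xi|apply: ev_xc].
apply: ev_and.
  apply: ev_eq; last exact: ev_xc.
  by apply: ev_add; [apply: ev_csize; apply: ev_xh|apply: ev_xi].
apply: ev_le; first by apply: ev_tab; [apply: ev_xi|apply: ltn_pmod].
apply: (@ev_sum s env l 0 _ U (fun C => [&& f C, csize M k C == xc M k x & csub M k (xh M k x) C])) => //.
move=> i iU; have vi := ev_var env l i.
apply: ev_and; first exact: ev_arr hf vi iU.
apply: ev_and; first by apply: ev_eq; [apply: ev_csize|apply: ev_xc].
by apply: ev_csub => //; apply: ev_xh.
Qed.

Lemma ev_sel f env : isarr s FF U f -> ev s env Xsel (sel M k alpha f).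
Proof.
move=> hf; apply: (@ev_sum s env 4 1 _ Q (fun x => (\sum_(y < Q) ((y <= x) && isflower M k alpha f y))%N == 0%N)) => // x xQ.
apply: ev_eq => //.
apply: (ev_sum (g := fun y => (y <= x)%N && isflower M k alpha f y)) => // y yQ.
have vy := ev_var (upd_env env 4 x) 5 y.
apply: ev_and; first exact: ev_le.
by apply: ev_isflower.
Qed.

Lemma ev_cmin f env c : isarr s FI U f -> (c < U)%N ->
  ev s (upd_env env 3 c%:Z) Xcmin (cmin M k f c).
Proof.
move=> hf cU; have vc := ev_var env 3 c; apply: ev_and; first exact: ev_arr hf vc cU.
apply: ev_eq => //.
apply: (ev_sum (g := fun d => [&& f d, csub M k d c & d != c :> nat])) => // d dU.
have vd := ev_var (upd_env env 3 c) 4 d.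
apply: ev_and; first exact: ev_arr hf vd dU.
apply: ev_and; first exact: ev_csub.
have := ev_sub (ev_n s (upd_env (upd_env env 3 c) 4 d) 1) (ev_eq vd (vc : ev s (upd_env (upd_env env 3 c) 4 d) (XV 3) c)).
by move=> /(_ (leq_b1 _)); case: (d == c).
Qed.

Lemma ev_new f env v Xv j D : isarr s FF U f -> ev s env (XV 2) j ->
  s SQ 0 = (sel M k alpha f)%:Z -> (forall c, ev s (upd_env env 3 c) Xv v) -> (D < U)%N ->
  ev s (upd_env env 3 D%:Z) (Xnew Xv) (cnew M k alpha f v j D).
Proof.
move=> hf hj hq hv DU; have vD := ev_var env 3 D.
have vq env' : ev s env' Xq (sel M k alpha f) by [].
set env' := upd_env env 3 D%:Z.
rewrite /cnew.
have -> : ((if (sel M k alpha f < Q)%N then newcl M k f (sel M k alpha f) (action v j) D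
   else false) : bool) = (if (sel M k alpha f < Q)%N then newcl M k f (sel M k alpha f) (action v j) D : nat
   else 0%N) :> nat by case: ifP.
apply: ev_ifb => [|_|_]; first by apply: ev_lt => //; apply: ev_Q.
  have -> : (newcl M k f (sel M k alpha f) (action v j) D : nat) =
    (if (j < v)%N then (D == xh M k (sel M k alpha f)) : nat else
     if j == v then (0 < \sum_(C < U) [&& f C, csize M k C == xc M k (sel M k alpha f),
       csub M k (xh M k (sel M k alpha f)) C & cdiff M k C (xh M k (sel M k alpha f)) == D] : nat)%N else 0%N).
    by rewrite /newcl /action; case: (j < v)%N => //=; case: (j == v).
  have hj' : ev s env' (XV 2) j by [].
  apply: ev_ifb => [|_|_]; first by apply: ev_lt => //; apply: hv.
    by apply: ev_eq => //; apply: ev_xh.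
  apply: ev_ifb => [|_|_] //; first by apply: ev_eq => //; apply: hv.
  apply: ev_lt => //; apply: (ev_sum (g := fun C => [&& f C, csize M k C == xc M k (sel M k alpha f),
       csub M k (xh M k (sel M k alpha f)) C & cdiff M k C (xh M k (sel M k alpha f)) == D])) => // C CU.
  have vC := ev_var env' 4 C.
  apply: ev_and; first exact: ev_arr hf vC CU.
  apply: ev_and; first by apply: ev_eq; [apply: ev_csize|apply: ev_xc].
  apply: ev_and; first by apply: ev_csub => //; apply: ev_xh.
  by apply: ev_eq; [apply: ev_cdiff => //; apply: ev_xh|].
by [].
Qed.

Lemma ev_cupd (f nn : nat -> bool) env D : isarr s NN U nn -> (s FF D%:Z = (f D : nat)%:Z) -> (D < U)%N ->
  ev s (upd_env env 3 D%:Z) Xcupd (cupd M k f nn D).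
Proof.
move=> hn hf DU; have vD := ev_var env 3 D.
apply: ev_or; first exact: ev_arr hn vD DU.
apply: ev_and; first by rewrite /ev /= upd_env_at.
apply: ev_eq => //.
apply: (ev_sum (g := fun D' => nn D' && csub M k D' D)) => // D' DU'.
have vD' := ev_var (upd_env env 3 D) 4 D'.
apply: ev_and; first exact: ev_arr hn vD' DU'.
exact: ev_csub.
Qed.

Lemma ev_rank f env l e c : isarr s FF U f ->
  (forall i : nat, ev s (upd_env env l i%:Z) e c) ->
  ev s env (Xrank e l) (rank M k f c).
Proof.
move=> hf h; apply: (ev_sum (g := fun d => f d && (d < c)%N)) => // d dU.
have vd := ev_var env l d.
by apply: ev_and; [exact: ev_arr hf vd dU|exact: ev_lt].
Qed.

End EvExpr.
End Expr.

(** The value for cell [i] may read [a] itself, whose cells from [i] on still have their old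
    contents. This allows [FF] to be updated in place. *)
Lemma wpc_fill B W K t l er a val env s (r : nat) (new : nat -> int) (P : state -> Prop) :
  a != PA -> xeval s env er = r%:Z -> (bitlen r <= B)%N ->
  (forall (i : nat) s', (i < r)%N -> (forall b, b != a -> s' b = s b) ->
    (forall c : nat, (c < i)%N -> s' a c = new c) ->
    (forall c : nat, (i <= c)%N -> s' a c = s a c) ->
    xeval s' (upd_env env l i%:Z) val = new i) ->
  (forall i, (i < r)%N -> (bitlen (new i) <= B)%N) ->
  (forall s', (forall b, b != a -> s' b = s b) ->
    (forall c : nat, (c < r)%N -> s' a c = new c) -> P s') ->
  wpc B W K t (CFor l er (CSet a (XV l) val)) env s (r * 40 + 30) P.
Proof.
move=> aPA her br hval hnew hP.
pose I (i : nat) s' := [/\ forall b, b != a -> s' b = s b,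
  forall c : nat, (c < i)%N -> s' a c = new c &
  forall c : nat, (i <= c)%N -> s' a c = s a c].
rewrite -[40%N]/(10 + 30)%N; apply: (wpc_for (I := I) her br) => [|i s' ir [h1 h2 h3]|s' [h1 h2 _]]; [by split| |exact: hP].
have e := hval i s' ir h1 h2 h3.
apply: wpc_set; rewrite ?e; [exact: hnew|by move=> ea; rewrite ea eqxx in aPA|].
rewrite /= upd_env_at; split=> [b ba|c|c ic].
- by rewrite update_ne // h1.
- rewrite update_same ltnS => ci; case: eqP => [[->] //|nc].
  by apply: h2; rewrite ltn_neqAle ci andbT; apply/eqP => ec; rewrite ec in nc.
- by rewrite update_same; case: eqP => [[ec]|_]; [lia|rewrite h3 // ltnW].
Qed.

Section Prog.
Variables (k alpha w D : nat).
Local Notation W := (alpha ^ k.*2.-1)%N.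

Definition Xh := Xdiv (Xadd Xvn (Xn 1)) (Xn 2).
Definition XT := Xadd (Xdiv (Xmul (Xn 3) (Xmul (Xn k) XM)) (Xn alpha)) (Xn 1).
Definition XL := Xadd Xh (Xmul (Xn w) XT).
Definition Xd := Xmul (Xn D) XL.
Definition XN := XG PW XL.
Definition XZ := Xadd (Xn 4) (Xmul (Xmul (Xn 4) XN) Xd).
Definition Xx := XG SX (Xn 0).
Definition Xpos := XG POS (Xn 0).
(** The literal encoded as [-i] becomes the digit [n + i]. *)
Definition Xlit e := XIf e e (Xsub Xvn e).
Definition Xcode := Xsumk k (fun i =>
  Xmul (XIf (Xlt (Xn i) (XG IN Xpos)) (Xlit (XG IN (Xadd (Xadd Xpos (Xn 1)) (Xn i)))) (Xn 0))
    (Xpow XM i)).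
Definition Xidx e := XIf (Xle e Xvn) (Xsub e (Xn 1)) (Xsub (Xsub e (Xn 1)) Xvn).
Definition Xslit sd e := XIf e (XIf (XIf sd (Xlt (Xidx e) Xh) (Xle Xh (Xidx e)))
  (Xeq (Xmod (Xdiv Xx (XG PW (XIf sd (Xidx e) (Xsub (Xidx e) Xh)))) (Xn 2)) (Xle e Xvn))
  (Xn 0)) (Xn 0).
Definition Xcfalse sd c := Xeq (Xsumk k (fun p => Xslit sd (Xdig c p))) (Xn 0).
Definition Xobit sd j := Xlt (Xn 0) (XSum 4 0 (Xmul (XG FF (XV 4))
  (Xmul (Xeq (Xrank (XV 4) 5) j) (Xcfalse sd (XV 4))))).
Definition Xrow := Xdiv (Xsub (XV 0) (Xn 4)) (Xmul (Xn 2) Xd).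
Definition Xtok := Xmod (Xdiv Xx (XG PW (Xadd Xh (Xmul (Xn w) (XV 1))))) (Xn (2 ^ w)).
Definition Xcoord sd i :=
  XIf i (XIf sd (Xmul (Xmul (Xn 2) XN) (Xsub (Xn 1) (Xobit sd (Xsub i (Xn 1)))))
                (Xadd XN (Xmul (Xmul (Xn 2) XN) (Xobit sd (Xsub i (Xn 1))))))
        (XIf (Xmul sd (Xlt Xq XQ)) (Xsub Xx (Xmul (Xn 4) XN))
             (Xadd (Xmul (Xmul (Xn 4) XN) (Xdiv Xx (XG PW Xh))) Xx)).
Definition Xout := XIf (Xlt (XV 0) (Xn 4))
  (XIf (Xlt (XV 0) (Xn 1)) XN (XIf (Xlt (XV 0) (Xn 2)) Xd (XIf (Xlt (XV 0) (Xn 3)) XN (Xn 1))))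
  (XIf (Xmod (XV 0) (Xn 2)) (Xn 1)
    (Xcoord (Xlt Xrow XN) (Xmod (Xdiv (Xsub (XV 0) (Xn 4)) (Xn 2)) Xd))).

Definition c_setup := CSeq (CSet PA (Xn 0) (Xpow XM k))
  (CSeq (CSet PA (Xn 1) (Xmul (Xn (k.+1 * k.+1)) XU))
  (CSeq (CSet PW (Xn 0) (Xn 1))
        (CFor 0 XL (CSet PW (Xadd (XV 0) (Xn 1)) (Xmul (Xn 2) (XG PW (XV 0))))))).
Definition c_parse := CSeq (CSet POS (Xn 0) (Xn 2))
  (CFor 0 (XG IN (Xn 1)) (CSeq (CSet FI Xcode (Xn 1))
     (CSet POS (Xn 0) (Xadd (Xadd Xpos (XG IN Xpos)) (Xn 1))))).
Definition c_step := CSeq (CSet SQ (Xn 0) (Xsel k alpha))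
  (CSeq (CFor 3 XU (CSet NN (XV 3) (Xnew k Xtok))) (CFor 3 XU (CSet FF (XV 3) (Xcupd k)))).
(** The leaf formula is recomputed from the input for every single output cell. This polynomial
    overhead per cell is affordable, since the number of cells is only [N] times a polynomial. *)
Definition c_body :=
  CSeq (CSet SX (Xn 0) (XIf (Xlt (XV 0) (Xn 4)) (Xn 0) (Xmod Xrow XN)))
  (CSeq (CFor 3 XU (CSet FF (XV 3) (Xcmin k)))
  (CSeq (CFor 1 XT (CFor 2 (Xn W) c_step))
  (CSeq (CSet SQ (Xn 0) (Xsel k alpha))
        (CSet OUT (XV 0) Xout)))).
Definition c_main := CSeq c_setup (CSeq c_parse (CFor 0 XZ c_body)).

Lemma cwf_main : cwf c_main.
Proof.
rewrite /c_main /c_setup /c_parse /c_body /c_step /=.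
by rewrite ?xwf_pow ?xwf_sumk ?andbT //= => *; rewrite ?xwf_pow ?xwf_sumk //= => *; rewrite ?xwf_pow.
Qed.

End Prog.

Section Params.
Variables (k alpha w D n : nat) (fi : nat -> bool).
Local Notation M := (2 * n + 1)%N.
Local Notation U := (M ^ k)%N.
Local Notation Q := (search_bound M k).
Local Notation W := (alpha ^ k.*2.-1)%N.

Definition half_vars := ((n + 1) %/ 2)%N.
(** The least number of tokens that satisfies the hypothesis of [crun_complete]. *)
Definition ntokens := ((3 * (k * M)) %/ alpha + 1)%N.
Definition log_points := (half_vars + w * ntokens)%N.
Definition bcp_dim := (D * log_points)%N.
Definition npoints := (2 ^ log_points)%N.
Definition ncells := (4 + 4 * npoints * bcp_dim)%N.

(* The digits 1, ..., n are positive literals and n+1, ..., 2n negative ones. *)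
Definition lidx (delta : nat) := if (delta <= n)%N then (delta - 1)%N else (delta - 1 - n)%N.
(* Side A ([side = true]) holds the first [half_vars] variables, side B the others. *)
Definition slit (x : nat) (side : bool) (delta : nat) : bool :=
  [&& (0 < delta)%N, (if side then lidx delta < half_vars else half_vars <= lidx delta)%N &
      (x %/ 2 ^ (if side then lidx delta else lidx delta - half_vars) %% 2 == (delta <= n))%N].
Definition cfalse x side c := (\sum_(p < k) slit x side (dig M c p))%N == 0%N.
(** When no clause has rank [j] the bit is 0 on both sides, and the two coordinates [2N] and [N] are
    at the harmless distance [N]. So the dimension may exceed the number of clauses. *)
Definition slot_bit (F : nat -> bool) x side j :=
  (0 < \sum_(C < U) [&& F C, rank M k F C == j & cfalse x side C])%N.
Definition tokx x t := dig (2 ^ w) (x %/ 2 ^ half_vars) t.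
Definition leaf_formula x := crun M k alpha (cmin M k fi) (tokx x) W ntokens.
(** In coordinate 0, token parts that differ leave a distance above [4N - N]. Off a leaf, side A is
    below [-3N] while side B is nonnegative. The summand [x], less than [N], also makes all points
    of a side distinct, as [bcp_instance] requires. *)
Definition coord_value side x i : int :=
  if i == 0%N then
    if side && (sel M k alpha (leaf_formula x) < Q)%N then x%:Z - (4 * npoints)%N%:Z
    else (4 * npoints * (x %/ 2 ^ half_vars) + x)%N%:Z
  else if side then (2 * npoints * (1 - slot_bit (leaf_formula x) x side (i - 1)))%N%:Z
  else (npoints + 2 * npoints * slot_bit (leaf_formula x) x side (i - 1))%N%:Z.
Definition point_of_cell z := if (z < 4)%N then 0%N else ((z - 4) %/ (2 * bcp_dim) %% npoints)%N.
(* Cell [z] of the encoded instance: a header of four cells, then all coordinates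
   of sides A and B, each a numerator followed by the denominator 1. *)
Definition out_value (z : nat) : int :=
  if (z < 4)%N then
    if (z < 1)%N then npoints%:Z else if (z < 2)%N then bcp_dim%:Z else if (z < 3)%N then npoints%:Z else 1
  else if (0 < z %% 2)%N then 1
  else coord_value ((z - 4) %/ (2 * bcp_dim) < npoints)%N (point_of_cell z) ((z - 4) %/ 2 %% bcp_dim)%N.

(** Small quantities enter with their values, which exceed their bit lengths. Coordinates are at
    most [8 * npoints * npoints], that is, they need about [2 * log_points + 3] bits. *)
Definition bit_bound := (Q + 3 * log_points + bcp_dim + W + ntokens + 10)%N.

Lemma npoints_gt0 : (0 < npoints)%N. Proof. by rewrite expn_gt0. Qed.

Lemma leq_half_vars : (n <= 2 * half_vars)%N.
Proof. by rewrite /half_vars; have := divn_eq (n + 1) 2; have := ltn_pmod (n + 1) (isT : 0 < 2)%N; lia. Qed.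

Lemma bitlen_small x : (x <= bit_bound)%N -> (bitlen x%:Z <= bit_bound)%N.
Proof.
have b0 : (0 < bit_bound)%N by rewrite /bit_bound; lia.
by move=> xB; rewrite bitlen_leq //= (leq_ltn_trans xB) // ltn_expl.
Qed.

Lemma bitlen_big (z : int) : (`|z| <= 8 * npoints * npoints)%N -> (bitlen z <= bit_bound)%N.
Proof.
move=> h; rewrite bitlen_leq; last by rewrite /bit_bound; lia.
apply: leq_ltn_trans h _; rewrite /npoints -(expnD 2 3) -expnD ltn_exp2l // /bit_bound.
rewrite /log_points; lia.
Qed.

Lemma npoints_leq : (npoints <= 8 * npoints * npoints)%N.
Proof. by have := npoints_gt0; nia. Qed.

Lemma bitlen_ncell : (bitlen ncells%:Z <= bit_bound)%N.
Proof.
rewrite bitlen_leq /=; last by rewrite /bit_bound; lia.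
have h1 : (bcp_dim < 2 ^ bcp_dim)%N by rewrite ltn_expl.
have h2 := npoints_gt0.
apply: (@leq_ltn_trans (2 ^ 3 * npoints * 2 ^ bcp_dim)%N); first by rewrite /ncells; nia.
by rewrite /npoints -!expnD ltn_exp2l // /bit_bound; lia.
Qed.

Lemma coord_value_bound x side i : (x < npoints)%N ->
  (`|coord_value side x i| <= 8 * npoints * npoints)%N.
Proof.
have h0 := npoints_gt0; have h1 := npoints_leq => xN; rewrite /coord_value.
have xs : (x %/ 2 ^ half_vars <= x)%N by apply: leq_div.
have h2 : (4 * npoints * (x %/ 2 ^ half_vars) + x <= 8 * npoints * npoints)%N.
  by apply: (@leq_trans (4 * npoints * npoints + npoints)); nia.
case: ifP => _; first by case: ifP => _; [nia | exact: h2].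
by case: ifP => _; rewrite absz_nat; case: (slot_bit _ _ _ _); nia.
Qed.

Lemma bitlen_outv z : (bitlen (out_value z) <= bit_bound)%N.
Proof.
have h0 := npoints_gt0; have h1 := npoints_leq; have hd : (bcp_dim <= bit_bound)%N by rewrite /bit_bound; lia.
rewrite /out_value; case: ifP => _.
  case: ifP => _; first exact: bitlen_big.
  case: ifP => _; first exact: bitlen_small.
  case: ifP => _; first exact: bitlen_big.
  by apply: (@bitlen_small 1); rewrite /bit_bound; lia.
case: ifP => _; first by apply: (@bitlen_small 1); rewrite /bit_bound; lia.
apply: bitlen_big; apply: coord_value_bound.
by rewrite /point_of_cell; case: ifP => // _; rewrite ltn_pmod.
Qed.

Lemma U_leq_Q : (U <= Q)%N.
Proof. by rewrite /search_bound leq_pmull. Qed.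

Section Evals.
Variables (s : state).
Hypotheses (s_n : s IN 0 = n%:Z) (s_U : s PA 0 = U%:Z) (s_Q : s PA 1 = Q%:Z).

Lemma ev_vn env : ev s env Xvn n. Proof. exact: s_n. Qed.

Lemma ev_h env : ev s env Xh half_vars.
Proof. by apply: ev_div => //; apply: ev_add => //; apply: ev_vn. Qed.

Lemma ev_T env : ev s env (XT k alpha) ntokens.
Proof.
apply: ev_add => //; apply: ev_div => //; apply: ev_mul => //; apply: ev_mul => //.
exact: ev_M.
Qed.

Lemma ev_L env : ev s env (XL k alpha w) log_points.
Proof. by apply: ev_add; [apply: ev_h|apply: ev_mul => //; apply: ev_T]. Qed.

Lemma ev_d env : ev s env (Xd k alpha w D) bcp_dim.
Proof. by apply: ev_mul => //; apply: ev_L. Qed.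

Hypothesis s_P : forall i : nat, (i <= log_points)%N -> s PW i = (2 ^ i)%N%:Z.

Lemma ev_P env e i : ev s env e i -> (i <= log_points)%N -> ev s env (XG PW e) (2 ^ i)%N.
Proof. by rewrite /ev /= => -> h; rewrite s_P. Qed.

Lemma ev_N env : ev s env (XN k alpha w) npoints.
Proof. by apply: ev_P => //; apply: ev_L. Qed.

Lemma ev_Z env : ev s env (XZ k alpha w D) ncells.
Proof.
apply: ev_add => //; apply: ev_mul; last exact: ev_d.
by apply: ev_mul => //; apply: ev_N.
Qed.

Lemma ev_idx env e delta : ev s env e delta -> (0 < delta)%N -> (delta < M)%N ->
  ev s env (Xidx e) (lidx delta).
Proof.
move=> h d0 dM; apply: ev_ifb => [|_|nd]; first by apply: ev_le => //; apply: ev_vn.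
  by apply: ev_sub.
by apply: ev_sub; [apply: ev_sub|apply: ev_vn|lia].
Qed.

Lemma ev_slit env esd sd e delta x : ev s env esd (sd : bool) -> ev s env e delta ->
  s SX 0 = x%:Z -> (delta < M)%N -> ev s env (Xslit esd e) (slit x sd delta).
Proof.
move=> hsd he hx dM.
have -> : (slit x sd delta : nat) = (if (0 < delta)%N then
    (if (if sd then lidx delta < half_vars else half_vars <= lidx delta)%N then
      (x %/ 2 ^ (if sd then lidx delta else lidx delta - half_vars) %% 2 == (delta <= n))%N : nat
     else 0%N) else 0%N).
  rewrite /slit; case: (0 < delta)%N => //=.
  by case: (if sd then _ else _).
apply: ev_if => // d0.
have idn : (lidx delta < n)%N by rewrite /lidx; case: ifP; lia.
have hid := ev_idx he d0 dM.
apply: ev_ifb => // [|c].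
  have -> : ((if sd then lidx delta < half_vars else half_vars <= lidx delta)%N : nat) =
     (if sd then (lidx delta < half_vars)%N : nat else (half_vars <= lidx delta)%N : nat) by case: (sd).
  apply: ev_ifb => // _; first by apply: ev_lt => //; apply: ev_h.
  by apply: ev_le => //; apply: ev_h.
apply: ev_eq; last by apply: ev_le => //; apply: ev_vn.
apply: ev_mod => //; apply: ev_div => //; apply: ev_P.
  apply: ev_ifb => // sd0; apply: ev_sub => //; first exact: ev_h.
  by move: c; rewrite (negPf sd0).
by have := leq_half_vars; rewrite /log_points; case: ifP c => _ c; lia.
Qed.

Lemma ev_cfalse env esd sd e c x : ev s env esd (sd : bool) -> ev s env e c ->
  s SX 0 = x%:Z -> ev s env (Xcfalse k esd e) (cfalse x sd c).
Proof.
move=> hsd he hx; apply: ev_eq => //.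
apply: (@ev_sumk s env k _ (fun p => slit x sd (dig M c p))) => p _.
by apply: ev_slit => //; [apply: ev_dig|apply: dig_ltn; lia].
Qed.

Lemma ev_obit F env esd sd ej j x : isarr s FF U F ->
  (forall i : nat, ev s (upd_env env 4 i%:Z) esd (sd : bool)) ->
  (forall i : nat, ev s (upd_env env 4 i%:Z) ej j) ->
  s SX 0 = x%:Z -> ev s env (Xobit k esd ej) (slot_bit F x sd j).
Proof.
move=> hF hsd hj hx; apply: ev_lt => //.
apply: (@ev_sum s env 4 0 _ U (fun C => [&& F C, rank M k F C == j & cfalse x sd C])) => // C CU.
have vC := ev_var s env 4 C.
apply: ev_and; first exact: ev_arr hF vC CU.
apply: ev_and; last exact: ev_cfalse.
by apply: ev_eq => //; apply: ev_rank => // i; rewrite /ev /=.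
Qed.

Lemma ev_tok env t x : s SX 0 = x%:Z -> (t < ntokens)%N ->
  ev s env (XV 1) t -> ev s env (Xtok w) (tokx x t).
Proof.
move=> hx tT ht; rewrite /tokx /dig -expnM -divnMA -expnD.
apply: ev_mod => //; apply: ev_div => //; apply: ev_P.
  by apply: ev_add; [apply: ev_h|apply: ev_mul].
by rewrite /log_points leq_add2l leq_mul2l ltnW ?orbT.
Qed.

Lemma xeval_if env e e1 e2 (m : nat) : ev s env e m ->
  xeval s env (XIf e e1 e2) = if (0 < m)%N then xeval s env e1 else xeval s env e2.
Proof. by rewrite /ev /= => ->; rewrite ltz_nat. Qed.

Lemma xeval_ifb env e e1 e2 (b : bool) : ev s env e b ->
  xeval s env (XIf e e1 e2) = if b then xeval s env e1 else xeval s env e2.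
Proof. by move=> h; rewrite (xeval_if _ _ h); case: b h. Qed.

Lemma ev_coord env esd sd ei i x :
  isarr s FF U (leaf_formula x) -> s SQ 0 = (sel M k alpha (leaf_formula x))%:Z -> s SX 0 = x%:Z ->
  (forall j : nat, ev s (upd_env env 4 j%:Z) esd (sd : bool)) ->
  (forall j : nat, ev s (upd_env env 4 j%:Z) ei i) ->
  ev s env esd (sd : bool) -> ev s env ei i ->
  xeval s env (Xcoord k alpha w esd ei) = coord_value sd x i.
Proof.
move=> hF hq hx hsd4 hi4 hsd hi; rewrite /coord_value (xeval_if _ _ hi) lt0n.
have hN := ev_N env.
case: eqP => [i0|/eqP ni] /=.
  have -> : (sd && (sel M k alpha (leaf_formula x) < Q)%N) = (0 < sd * (sel M k alpha (leaf_formula x) < Q)%N)%N.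
    by case: sd {hsd4 hsd} => //=; case: (_ < _)%N.
  rewrite -[LHS]/(xeval s env (XIf (Xmul esd (Xlt Xq XQ)) (Xsub Xx (Xmul (Xn 4) (XN k alpha w)))
             (Xadd (Xmul (Xmul (Xn 4) (XN k alpha w)) (Xdiv Xx (XG PW Xh))) Xx))).
  rewrite (@xeval_if _ _ _ _ (sd * (sel M k alpha (leaf_formula x) < Q)%N)%N); last first.
    by apply: ev_mul => //; apply: ev_lt => //.
  case: ifP => _.
    have := ev_mul (ev_n s env 4) hN; rewrite /ev /= => ->; by rewrite hx.
  apply: ev_add => //; apply: ev_mul; first exact: ev_mul.
  apply: ev_div => //; apply: ev_P; first exact: ev_h.
  by rewrite /log_points leq_addr.
have hi1 : forall j : nat, ev s (upd_env env 4 j%:Z) (Xsub ei (Xn 1)) (i - 1)%N.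
  by move=> j; apply: ev_sub => //; rewrite lt0n.
have hb : ev s env (Xobit k esd (Xsub ei (Xn 1))) (slot_bit (leaf_formula x) x sd (i - 1)%N) by apply: ev_obit.
rewrite -[LHS]/(xeval s env (XIf esd (Xmul (Xmul (Xn 2) (XN k alpha w)) (Xsub (Xn 1) (Xobit k esd (Xsub ei (Xn 1)))))
                (Xadd (XN k alpha w) (Xmul (Xmul (Xn 2) (XN k alpha w)) (Xobit k esd (Xsub ei (Xn 1))))))).
rewrite (xeval_ifb _ _ hsd); case: ifP => hs.
  apply: ev_mul; first exact: ev_mul.
  by rewrite hs in hb *; apply: ev_sub => //; exact: leq_b1.
by rewrite hs in hb *; apply: ev_add => //; apply: ev_mul => //; apply: ev_mul.
Qed.

Lemma ev_row env z : ev s env (XV 0) z -> (4 <= z)%N ->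
  ev s env (Xrow k alpha w D) ((z - 4) %/ (2 * bcp_dim))%N.
Proof.
move=> h z4; apply: ev_div; first by apply: ev_sub.
by apply: ev_mul => //; apply: ev_d.
Qed.

Lemma ev_x env z : ev s env (XV 0) z ->
  ev s env (XIf (Xlt (XV 0) (Xn 4)) (Xn 0) (Xmod (Xrow k alpha w D) (XN k alpha w))) (point_of_cell z).
Proof.
move=> h; apply: ev_ifb => // [|nz]; first exact: ev_lt.
by apply: ev_mod; [apply: ev_row => //; lia|apply: ev_N].
Qed.

Lemma ev_out env z : ev s env (XV 0) z ->
  isarr s FF U (leaf_formula (point_of_cell z)) -> s SQ 0 = (sel M k alpha (leaf_formula (point_of_cell z)))%:Z ->
  s SX 0 = (point_of_cell z)%:Z ->
  xeval s env (Xout k alpha w D) = out_value z.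
Proof.
move=> hz hF hq hx; rewrite /out_value.
have hz4 (j : nat) : ev s (upd_env env 4 j%:Z) (XV 0) z by [].
rewrite /Xout (xeval_ifb _ _ (ev_lt hz (ev_n s env 4))); case: ifP => z4.
  rewrite (xeval_ifb _ _ (ev_lt hz (ev_n s env 1))); case: ifP => _; first exact: ev_N.
  rewrite (xeval_ifb _ _ (ev_lt hz (ev_n s env 2))); case: ifP => _; first exact: ev_d.
  rewrite (xeval_ifb _ _ (ev_lt hz (ev_n s env 3))); case: ifP => _ //; exact: ev_N.
rewrite (xeval_if _ _ (ev_mod hz (ev_n s env 2))); case: ifP => // _.
have z4' : (4 <= z)%N by lia.
have sdE env' : ev s env' (XV 0) z ->
    ev s env' (Xlt (Xrow k alpha w D) (XN k alpha w)) ((z - 4) %/ (2 * bcp_dim) < npoints)%N.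
  by move=> h; apply: ev_lt; [apply: ev_row|apply: ev_N].
have iE env' : ev s env' (XV 0) z ->
    ev s env' (Xmod (Xdiv (Xsub (XV 0) (Xn 4)) (Xn 2)) (Xd k alpha w D)) ((z - 4) %/ 2 %% bcp_dim)%N.
  by move=> h; apply: ev_mod; [apply: ev_div => //; apply: ev_sub|apply: ev_d].
by apply: ev_coord => //; [move=> j; apply: sdE|move=> j; apply: iE|apply: sdE|apply: iE].
Qed.

End Evals.
End Params.

Lemma xeval_get s env a e : xeval s env (XG a e) = s a (xeval s env e).
Proof. by []. Qed.

(** * Execution of the reduction, for an abstract layout of the input *)

Section Run.
Variables (k alpha w D n m : nat) (inp : seq int).
Variables (pos sz : nat -> nat) (delta : nat -> nat -> nat).
Local Notation M := (2 * n + 1)%N.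
Local Notation U := (M ^ k)%N.
Local Notation Q := (search_bound M k).
Local Notation W := (alpha ^ k.*2.-1)%N.
Local Notation lgN := (log_points k alpha w n).
Local Notation bdim := (bcp_dim k alpha w D n).
Local Notation npt := (npoints k alpha w n).
Local Notation ncell := (ncells k alpha w D n).
Local Notation ntok := (ntokens k alpha n).
Local Notation B := (bit_bound k alpha w D n).

Definition ccode j := code_of M k (fun i => if (i < sz j)%N then delta j i else 0%N).
Definition is_cnf_code (c : nat) := has (fun j => ccode j == c) (iota 0 m).
Local Notation outv := (out_value k alpha w D n is_cnf_code).
Local Notation xof := (point_of_cell k alpha w D n).
Local Notation Fx := (leaf_formula k alpha w n is_cnf_code).

Hypotheses (k_gt0 : (0 < k)%N) (alpha_ge : (4 * k <= alpha)%N).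
Hypotheses (inp0 : nth 0 inp 0 = n%:Z) (inp1 : nth 0 inp 1 = m%:Z) (m_U : (m <= U)%N).
Hypotheses (pos0 : pos 0%N = 2%N) (posS : forall j, pos j.+1 = (pos j + sz j + 1)%N).
Hypotheses (sz_k : forall j, (j < m)%N -> (sz j <= k)%N)
  (inp_sz : forall j, (j < m)%N -> nth 0 inp (pos j) = (sz j)%:Z)
  (delta_M : forall j i, (delta j i < M)%N)
  (inp_lit : forall j i, (j < m)%N -> (i < sz j)%N ->
    let z := nth 0 inp (pos j + 1 + i) in (if 0 < z then z else n%:Z - z) = (delta j i)%:Z).

(** The last condition keeps the arrays above [OUT] clean for the closest pair program, which
    expects zeros outside its input. *)
Definition base0 (s : state) := [/\ forall i, s IN i = init inp IN i, s PA 0 = U%:Z,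
  s PA 1 = Q%:Z, forall i : nat, (i <= lgN)%N -> s PW i = (2 ^ i)%N%:Z &
  forall b i, (OUT < b)%N -> s b i = 0].
Definition base (s : state) := base0 s /\ isarr s FI U is_cnf_code.

Let M_gt0 : (0 < M)%N. Proof. by rewrite addn1. Qed.

Lemma base0_n s : base0 s -> s IN 0 = n%:Z.
Proof. by case=> -> _ _ _ _; rewrite /init /=. Qed.

Lemma base_ext s s' : (forall b, b \notin [:: FF; NN; POS; SQ; SX; OUT] -> s' b = s b) ->
  base s -> base s'.
Proof.
move=> h [[h1 h2 h3 h4 h5] h6]; split; first split.
- by move=> i; rewrite h.
- by rewrite h.
- by rewrite h.
- by move=> i iL; rewrite h // h4.
- by move=> b i bO; rewrite h ?h5 // !inE !negb_or !neq_ltn bO !(ltn_trans _ bO) ?orbT.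
- by move=> c cU; rewrite h // h6.
Qed.

Lemma bitlen_B (x : nat) : (x <= B)%N -> (bitlen x%:Z <= B)%N.
Proof. exact: bitlen_small. Qed.

Lemma U_B : (U <= B)%N.
Proof. by have := U_leq_Q k n; rewrite /bit_bound; lia. Qed.

Lemma bitlen_bool (b : bool) : (bitlen (b : nat)%:Z <= B)%N.
Proof. by apply: bitlen_B; rewrite /bit_bound; case: b; lia. Qed.

Lemma wpc_setup K t env : wpc B Q K t (c_setup k alpha w) env (init inp) (10 + (10 + (10 + (lgN * 40 + 30))))%N
  (fun s => base0 s /\ forall b i, (PW < b)%N -> s b i = 0).
Proof.
set s0 := init inp.
have s0n : s0 IN 0 = n%:Z by rewrite /s0 /init /=.
have s0z b i : (0 < b)%N -> s0 b i = 0 by rewrite /s0 /init; case: b.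
have eU : xeval s0 env (Xpow XM k) = U%:Z by apply: ev_pow; apply: ev_M.
apply: wpc_seq; apply: wpc_set; rewrite ?eU.
- by apply: bitlen_B; apply: U_B.
- by move=> _; have := U_leq_Q k n; lia.
set s1 := update s0 _ _ _.
have eQ : xeval s1 env (Xmul (Xn (k.+1 * k.+1)) XU) = Q%:Z by [].
apply: wpc_seq; apply: wpc_set; rewrite ?eQ.
- by apply: bitlen_B; rewrite /bit_bound; lia.
- by move=> _; lia.
set s2 := update s1 _ _ _.
apply: wpc_seq; apply: wpc_set => //; first by apply: bitlen_bool true.
set s3 := update s2 _ _ _.
have s3n : s3 IN 0 = n%:Z by [].
pose I (i : nat) (s : state) := [/\ forall b, b != PW -> s b = s3 b &
  forall c : nat, (c <= i)%N -> s PW c = (2 ^ c)%N%:Z].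
rewrite -[40%N]/(10 + 30)%N; apply: (wpc_for (I := I)) => [| | |i s iL [h1 h2]|s [h1 h2]].
- exact: (ev_L k alpha w s3n env).
- by apply: bitlen_B; rewrite /bit_bound; lia.
- by split=> // c; rewrite leqn0 => /eqP ->.
- have e : xeval s (upd_env env 0 i%:Z) (Xmul (Xn 2) (XG PW (XV 0))) = (2 ^ i.+1)%N%:Z.
    by rewrite /= upd_env_at h2 // expnS.
  apply: wpc_set; rewrite ?e //.
    apply: bitlen_big; rewrite absz_nat (leq_trans _ (npoints_leq _ _ _ _)) //.
    by rewrite leq_pexp2l.
  rewrite /= upd_env_at; split=> [b bP|c ci]; first by rewrite update_ne // h1.
  rewrite update_same; case: eqP => [ec|nc]; first by congr (2 ^ _)%N%:Z; lia.
  by apply: h2; move: nc ci; rewrite /=; lia.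
have z2 b : (4 < b)%N -> s2 b = s0 b.
  by move=> hb; rewrite /s2 /s1 !update_ne //; rewrite /PA; lia.
split; first split.
- by move=> i; rewrite h1.
- by rewrite h1.
- by rewrite h1.
- exact: h2.
- move=> b i bO; rewrite /OUT in bO; rewrite h1 ?/s3 ?update_ne ?z2 ?s0z //; rewrite /PW; lia.
- move=> b i bO; rewrite /PW in bO; rewrite h1 ?/s3 ?update_ne ?z2 ?s0z //; rewrite /PW; lia.
Qed.

Lemma pos_leq j : (j <= m)%N -> (pos j <= 2 + j * k.+1)%N.
Proof.
elim: j => [|j IH] jm; first by rewrite pos0.
by rewrite posS mulSn; have := IH (ltnW jm); have := sz_k jm; lia.
Qed.

Lemma pos_B j : (j <= m)%N -> (pos j <= B)%N.
Proof.
move=> jm; apply: leq_trans (pos_leq jm) _; rewrite /bit_bound.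
suff : (j * k.+1 <= Q)%N by lia.
apply: (@leq_trans (U * k.+1)); first by rewrite leq_mul2r (leq_trans jm) ?orbT.
by rewrite /search_bound mulnC leq_mul2r leq_pmull ?orbT.
Qed.

Lemma ccode_U j : (ccode j < U)%N.
Proof.
apply: code_of_bound; first by rewrite addn1.
by move=> i _; case: ifP => _; [exact: delta_M|rewrite addn1].
Qed.

Lemma ev_code s env j : (j < m)%N -> base0 s -> s POS 0 = (pos j)%:Z -> ev s env (Xcode k) (ccode j).
Proof.
move=> jm bs hp; have [hI _ _ _ _] := bs; have hn := base0_n bs.
have hsz : s IN (pos j)%:Z = (sz j)%:Z by rewrite hI /init /= inp_sz.
have esz : ev s env (XG IN Xpos) (sz j) by rewrite /ev /= hp hsz.
apply: (@ev_sumk s env k _ (fun i => (if i < sz j then delta j i else 0) * M ^ i)%N) => i _.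
apply: ev_mul; last by apply: ev_pow; apply: ev_M.
apply: ev_ifb => // [|isz]; first exact: ev_lt.
have e : ev s env (Xadd (Xadd Xpos (Xn 1)) (Xn i)) (pos j + 1 + i)%N.
  by apply: ev_add => //; apply: ev_add.
have ez : xeval s env (XG IN (Xadd (Xadd Xpos (Xn 1)) (Xn i))) = nth 0 inp (pos j + 1 + i).
  by rewrite xeval_get e hI.
rewrite /ev -(inp_lit jm isz) /Xlit.
by rewrite -ez /= hn.
Qed.

Lemma wpc_parse K t env s : base0 s -> (forall b i, (PW < b)%N -> s b i = 0) ->
  wpc B Q K t (c_parse k) env s (10 + (m * (20 + 30) + 30))%N
  (fun s => base s /\ forall i, s OUT i = 0).
Proof.
move=> bs hz; apply: wpc_seq; apply: wpc_set => //; first by apply: bitlen_B; rewrite /bit_bound; lia.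
set s1 := update _ _ _ _.
pose I (j : nat) (s' : state) := [/\ forall b, b != POS -> b != FI -> s' b = s b,
  s' POS 0 = (pos j)%:Z & forall c : nat, s' FI c = (has (fun j => ccode j == c) (iota 0 j) : nat)%:Z].
have bI s' : (forall b, b != POS -> b != FI -> s' b = s b) -> base0 s'.
  move=> h; case: bs => h1 h2 h3 h4 h5; split.
  - by move=> i; rewrite h.
  - by rewrite h.
  - by rewrite h.
  - by move=> i iL; rewrite h // h4.
  - by move=> b i bO; rewrite h ?h5 //; rewrite /POS /FI /OUT in bO *; lia.
apply: (wpc_for (I := I)) => [| | |j s' jm [h1 h2 h3]|s' [h1 h2 h3]].
- by have [hI _ _ _ _] := bs; rewrite xeval_get /s1 update_ne // hI /init /= inp1.
- by apply: bitlen_B; apply: leq_trans U_B.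
- split=> [b bp bf| |c]; first by rewrite /s1 update_ne.
    by rewrite /s1 update_at pos0.
  by rewrite /s1 update_ne // hz.
- have bs' := bI _ h1; have ec := ev_code (upd_env env 0 j%:Z) jm bs' h2.
  rewrite -[20%N]/(10 + 10)%N; apply: wpc_seq; apply: wpc_set => //; first exact: bitlen_bool true.
  rewrite ec /=; set s2 := update _ _ _ _.
  have e2 : xeval s2 (upd_env env 0 j%:Z) (Xadd (Xadd Xpos (XG IN Xpos)) (Xn 1)) = (pos j.+1)%:Z.
    rewrite /= /s2 !update_ne // h2; have [-> _ _ _ _] := bs'.
    by rewrite /init /= inp_sz // posS.
  apply: wpc_set; rewrite ?e2 //; first by apply: bitlen_B; apply: pos_B.
  split=> [b bp bf| |c].
  - by rewrite update_ne // /s2 update_ne // h1.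
  - by rewrite update_at.
  - rewrite update_ne // /s2 update_same h3 -[in RHS]addn1 iotaD has_cat add0n /= orbF [ccode j == c]eq_sym.
    by case: eqP => [[->]|nc]; [rewrite eqxx orbT|case: eqP => [ec'|_]; [rewrite ec' in nc|rewrite orbF]].
split; last by move=> i; rewrite h1 // hz.
by split; [exact: bI|move=> c _; rewrite h3].
Qed.

(** The units follow the nesting of the commands: 10 for an assignment, 40 for a cell filled,
    [r * (m + 30) + 30] for a loop. *)
Definition ustep := (10 + ((U * 40 + 30) + (U * 40 + 30)))%N.
Definition ubody := (10 + ((U * 40 + 30) + ((ntok * ((W * (ustep + 30) + 30) + 30) + 30) + (10 + 10))))%N.

Definition keep (s s' : state) := forall b, b \notin [:: FF; NN; SQ] -> s' b = s b.

Lemma keep_base s s' : keep s s' -> base s -> base s'.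
Proof.
move=> h; apply: base_ext => b hb; apply: h; move: hb; rewrite !inE !negb_or.
by move=> /and5P[-> -> _ -> _].
Qed.

Lemma wpc_step K t env s x (tau j : nat) g : base s -> isarr s FF U g -> s SX 0 = x%:Z ->
  (tau < ntok)%N -> env 1%N = tau%:Z -> env 2%N = j%:Z ->
  wpc B Q K t (c_step k alpha w) env s ustep (fun s' => keep s s' /\
    isarr s' FF U (cstep M k alpha g (tokx w n x tau) j)).
Proof.
move=> bs hg hx ht e1 e2.
have [b0 _] := bs; have [_ hU hQ hP _] := b0; have hn := base0_n b0.
have es := @ev_sel k alpha n s hn hU hQ g env hg.
apply: wpc_seq; apply: wpc_set; rewrite ?es //.
  by apply: bitlen_B; have := sel_leq M_gt0 k_gt0 alpha_ge g; rewrite /bit_bound; lia.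
set s1 := update _ _ _ _.
have k1 b : b != SQ -> s1 b = s b by move=> h; rewrite /s1 update_ne.
have s1q : s1 SQ 0 = (sel M k alpha g)%:Z by rewrite /s1 update_at.
set nn := cnew M k alpha g (tokx w n x tau) j.
apply: wpc_seq; apply: (wpc_fill (r := U) (new := fun c => (nn c : nat)%:Z)) => //.
- by apply: bitlen_B; exact: U_B.
- move=> D' s' DU f1 f2 f3.
  have g1 b : b != SQ -> b != NN -> s' b = s b by move=> h h'; rewrite f1 // k1.
  apply: (ev_new (n := n)) => //.
  + by rewrite g1.
  + by rewrite g1.
  + by rewrite g1.
  + by move=> c cU; rewrite g1 // hg.
  + by rewrite f1.
  + move=> c; apply: (@ev_tok k alpha w n s' _ _ _ tau) => //; rewrite ?g1 //.
- by move=> i _; apply: bitlen_bool.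
move=> s2 f1 f2.
have k2 b : b != SQ -> b != NN -> s2 b = s b by move=> h h'; rewrite f1 // k1.
apply: (wpc_fill (r := U) (new := fun c => (cupd M k g nn c : nat)%:Z)) => //.
- by rewrite -[LHS]/(s2 PA 0) k2.
- by apply: bitlen_B; exact: U_B.
- move=> D' s' DU f1' f2' f3'.
  apply: (ev_cupd (n := n)) => //.
  + by rewrite f1' // k2.
  + by rewrite f1' // k2.
  + by move=> c cU; rewrite f1' // f2.
  + by rewrite f3' // k2 // hg.
- by move=> i _; apply: bitlen_bool.
move=> s3 f1' f2'; split=> [b|c cU].
  by rewrite !inE !negb_or => /and3P[h1 h2 h3]; rewrite f1' // k2.
by rewrite f2'.
Qed.

Lemma wpc_body K t env s (z : nat) : base s -> env 0%N = z%:Z ->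
  wpc B Q K t (c_body k alpha w D) env s ubody (fun s' => base s' /\
    forall i, s' OUT i = if i == z%:Z then outv z else s OUT i).
Proof.
move=> bs hz; have [b0 hfi] := bs; have [_ hU hQ hP _] := b0; have hn := base0_n b0.
have ez env' : env' 0%N = z%:Z -> ev s env' (XV 0) z by [].
have ex : ev s env (XIf (Xlt (XV 0) (Xn 4)) (Xn 0) (Xmod (Xrow k alpha w D) (XN k alpha w))) (xof z).
  by apply: ev_x => //; apply: ez.
set x := xof z in ex.
have xN : (x < npt)%N by rewrite /x /point_of_cell; case: ifP; rewrite ?npoints_gt0 ?ltn_pmod ?npoints_gt0.
apply: wpc_seq; apply: wpc_set; rewrite ?ex //.
  apply: bitlen_big; rewrite absz_nat; apply: leq_trans (ltnW xN) _; exact: npoints_leq.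
set s1 := update _ _ _ _.
have k1 b : b != SX -> s1 b = s b by move=> h; rewrite /s1 update_ne.
have s1x : s1 SX 0 = x%:Z by rewrite /s1 update_at.
have bs1 : base s1.
  by apply: base_ext bs => b; rewrite !inE !negb_or => /and5P[_ _ _ _ /andP[h _]]; rewrite k1.
apply: wpc_seq; apply: (wpc_fill (r := U) (new := fun c => (cmin M k is_cnf_code c : nat)%:Z)) => //.
- by apply: bitlen_B; exact: U_B.
- move=> D' s' DU f1 f2 f3; apply: (ev_cmin (n := n)) => //; rewrite ?f1 ?k1 //.
  by move=> c cU; rewrite f1 // k1 // hfi.
- by move=> i _; apply: bitlen_bool.
move=> s2 f1 f2.
have k2 b : b \notin [:: FF; NN; SQ; SX] -> s2 b = s b.
  by rewrite !inE !negb_or => /and4P[h1 h2 h3 h4]; rewrite f1 // k1.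
have s2x : s2 SX 0 = x%:Z by rewrite f1.
have bs2 : base s2.
  apply: base_ext bs1 => b; rewrite !inE !negb_or => /and5P[h1 _ _ _ _]; by rewrite f1.
pose tk := tokx w n x.
pose G (s' : state) g := [/\ keep s2 s' & isarr s' FF U g].
have [bb2 _] := bs2; have [_ hU2 hQ2 hP2 _] := bb2; have hn2 := base0_n bb2.
apply: wpc_seq; apply: (wpc_for (I := fun tau s' => G s' (crun M k alpha (cmin M k is_cnf_code) tk W tau))).
- exact: (ev_T k alpha hn2 env).
- by apply: bitlen_B; rewrite /bit_bound; lia.
- by split=> // c cU; rewrite f2.
- move=> tau s' ht [kp hg].
  apply: (wpc_for (r := W) (I := fun j s' => G s' (ctok M k alpha (crun M k alpha (cmin M k is_cnf_code) tk W tau) (tk tau) j))).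
  + by [].
  + by apply: bitlen_B; rewrite /bit_bound; lia.
  + by [].
  + move=> j s'' hj [kp' hg'].
    have bs'' := keep_base kp' bs2.
    have x'' : s'' SX 0 = x%:Z by rewrite kp'.
    apply: wpc_mono (@wpc_step K t.+4 (upd_env (upd_env env 1 tau) 2 j) s'' x tau j _
      bs'' hg' x'' ht erefl erefl) (leqnn _) _.
    by move=> s3 [kp3 hg3]; split=> // b hb; rewrite kp3 // kp'.
  + by [].
move=> s3 [kp3 hg3].
have bs3 := keep_base kp3 bs2.
have [b3 _] := bs3; have [_ hU3 hQ3 hP3 _] := b3; have hn3 := base0_n b3.
have es := @ev_sel k alpha n s3 hn3 hU3 hQ3 _ env hg3.
apply: wpc_seq; apply: wpc_set; rewrite ?es //.
  by apply: bitlen_B; have := sel_leq M_gt0 k_gt0 alpha_ge (crun M k alpha (cmin M k is_cnf_code) tk W ntok); rewrite /bit_bound; lia.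
set s4 := update _ _ _ _.
have k4 b : b != SQ -> s4 b = s3 b by move=> h; rewrite /s4 update_ne.
have eo : xeval s4 env (Xout k alpha w D) = outv z.
  by apply: ev_out => //; rewrite k4 // kp3 // s2x.
apply: wpc_set; rewrite ?eo //; first exact: bitlen_outv.
rewrite /= hz; split.
  apply: base_ext bs3 => b; rewrite !inE !negb_or => /and5P[h1 h2 h3 h4 /andP[h5 h6]].
  by rewrite update_ne // k4.
move=> i; rewrite update_same; case: eqP => // _.
by rewrite k4 // kp3 // k2.
Qed.

Definition umain := ((10 + (10 + (10 + (lgN * 40 + 30)))) +
  ((10 + (m * (20 + 30) + 30)) + (ncell * (ubody + 30) + 30)))%N.

Lemma wpc_main K t env : wpc B Q K t (c_main k alpha w D) env (init inp) umain
  (fun s => base s /\ forall i : int, s OUT i =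
     if i is Posz z then (if (z < ncell)%N then outv z else 0) else 0).
Proof.
apply: wpc_seq; apply: wpc_mono (@wpc_setup K t env) (leqnn _) _ => s1 [bs1 z1].
apply: wpc_seq; apply: wpc_mono (@wpc_parse K t env s1 bs1 z1) (leqnn _) _ => s2 [bs2 z2].
have [b2 _] := bs2; have [_ hU2 hQ2 hP2 _] := b2; have hn2 := base0_n b2.
apply: (wpc_for (I := fun z s => base s /\ forall i : int, s OUT i =
     if i is Posz y then (if (y < z)%N then outv y else 0) else 0)).
- exact: (ev_Z D hn2 hP2 env).
- exact: bitlen_ncell.
- by split=> // -[y|y]; rewrite z2.
- move=> z s3 zN [bs3 z3]; apply: wpc_mono (@wpc_body K t.+2 (upd_env env 0 z) s3 z bs3 erefl) (leqnn _) _.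
  move=> s4 [bs4 z4]; split=> // i; rewrite z4 z3; case: i => // y.
  case: eqP => [[->]|ny]; first by rewrite ltnSn.
  by have -> : (y < z.+1)%N = (y < z)%N by lia.
- by [].
Qed.

End Run.

(** * Correctness of the reduction *)

Lemma dig_shift M s u h i : (0 < M)%N -> (i < h)%N -> dig M (s * M ^ h + u) i = dig M u i.
Proof.
move=> M0 ih; rewrite /dig.
have -> : (s * M ^ h = s * M ^ (h - i).-1 * M * M ^ i)%N.
  by rewrite -!mulnA -expnS -expnD; congr (_ * _ ^ _)%N; lia.
by rewrite divnMDl ?expn_gt0 ?M0 // modnMDl.
Qed.

Section Corr.
Variables (k alpha w D n : nat) (f : nat -> bool).
Local Notation M := (2 * n + 1)%N.
Local Notation U := (M ^ k)%N.
Local Notation Q := (search_bound M k).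
Local Notation W := (alpha ^ k.*2.-1)%N.
Local Notation lgN := (log_points k alpha w n).
Local Notation bdim := (bcp_dim k alpha w D n).
Local Notation npt := (npoints k alpha w n).
Local Notation ntok := (ntokens k alpha n).
Local Notation hlf := (half_vars n).
Local Notation Fx := (leaf_formula k alpha w n f).
Local Notation coordv := (coord_value k alpha w n f).
Hypotheses (k_gt0 : (0 < k)%N) (alpha_ge : (4 * k <= alpha)%N) (W_w : (W < 2 ^ w)%N).
Hypothesis D_ge : (2 + 5 * (k * (1 + k * theta alpha k)) <= D)%N.

Let M_gt0 : (0 < M)%N. Proof. by rewrite addn1. Qed.

Definition dtrue (v : nat -> bool) (d : nat) := (0 < d)%N && (v (lidx n d) == (d <= n)%N).
Definition vtrue (v : nat -> bool) : pred ('I_k * 'I_M) := fun e => dtrue v e.2.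

Lemma lgN_gt0 : (0 < lgN)%N.
Proof.
have w0 : (0 < w)%N.
  case: w W_w => // h; have : (0 < W)%N by rewrite expn_gt0; lia.
  lia.
by rewrite /log_points addn_gt0 muln_gt0 w0 /ntokens addn1 orbT.
Qed.

(** The left side is the bound on the clauses of a leaf plus one for coordinate 0. The constant 5 in
    [D_ge] comes from [M <= 4 * lgN + 1 <= 5 * lgN]. *)
Lemma slots_dim : (2 + k * M * (1 + k * theta alpha k) <= bdim)%N.
Proof.
have L0 := lgN_gt0; have h := leq_half_vars n.
have nL : (n <= 2 * lgN)%N by rewrite /log_points; lia.
rewrite /bcp_dim; apply: leq_trans (leq_mul D_ge (leqnn _)).
have -> : (k * M * (1 + k * theta alpha k) = M * (k * (1 + k * theta alpha k)))%N by lia.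
move: (k * (1 + _))%N => a; nia.
Qed.

Lemma csat_code (v : nat -> bool) F c : sat (vtrue v) (fam M k F) -> (c < U)%N -> F c ->
  exists2 p : nat, (p < k)%N & dtrue v (dig M c p).
Proof.
move=> /forallP/(_ (cset M k c)) + cU Fc; rewrite (mem_fam M_gt0 k_gt0 alpha_ge) //.
rewrite Fc /= => /existsP[[p d]]; rewrite inE /= => /andP[/andP[d0 /eqP e]].
by rewrite /vtrue /= -e => dt; exists p.
Qed.

Lemma lidx_ltn d : (0 < d)%N -> (d < M)%N -> (lidx n d < n)%N.
Proof. by rewrite /lidx; case: ifP; lia. Qed.

Lemma cfalseP x sd c : reflect (forall p : nat, (p < k)%N -> ~~ slit n x sd (dig M c p)) (cfalse k n x sd c).
Proof.
rewrite /cfalse sum_nat_eq0; apply: (iffP forallP) => [h p pk|h p].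
  by have := h (Ordinal pk); rewrite /= eqb0.
by rewrite /= eqb0; apply: h.
Qed.

Lemma slot_bitP (F : nat -> bool) x sd j : reflect (exists c, [/\ (c < U)%N, F c, rank M k F c = j & cfalse k n x sd c])
  (slot_bit k n F x sd j).
Proof.
rewrite /slot_bit (exists_sum U (fun C => [&& F C, rank M k F C == j & cfalse k n x sd C])).
apply: (iffP existsP) => [[c /and3P[Fc /eqP rc cf]]|[c [cU Fc rc cf]]].
  by exists c.
by exists (Ordinal cU); rewrite /= Fc rc eqxx cf.
Qed.

Lemma tokx_eq x y : (x %/ 2 ^ hlf = y %/ 2 ^ hlf)%N -> Fx x = Fx y.
Proof. by move=> e; rewrite /leaf_formula; apply: crun_eq => t _; rewrite /tokx e. Qed.

(** The tokens given by [crun_complete] form the common high part [s] of [x] and [y], and the halves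
    of [v] their low parts. Equal tokens give equal leaf formulas, so a slot means the same clause
    on both sides. *)
Lemma close_of_sat v : sat (vtrue v) (fam M k f) ->
  exists x y, [/\ (x < npt)%N, (y < npt)%N &
    forall i, `|coordv true x i - coordv false y i| <= npt%:Z].
Proof.
move=> sv; have cs : sat (vtrue v) (fam M k (cmin M k f)) by rewrite (cmin_sat M_gt0 k_gt0 alpha_ge).
have hn : (3 * (k * M) < ntok * alpha)%N.
  have a0 : (0 < alpha)%N by lia.
  by rewrite /ntokens [X in (_ < X * _)%N]addn1 ltn_ceil.
have [tok [tokW St lf]] := crun_complete M_gt0 k_gt0 alpha_ge (cmin_inv M_gt0 k_gt0 alpha_ge f) cs hn.
have p2 m : (0 < 2 ^ m)%N by rewrite expn_gt0.
pose s := code_of (2 ^ w) ntok tok.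
have tok2 i : (i < ntok)%N -> (tok i < 2 ^ w)%N by move=> _; apply: leq_ltn_trans W_w.
have sN : (s < 2 ^ (w * ntok))%N by rewrite expnM; apply: code_of_bound.
pose uA := code_of 2 hlf (fun i => v i).
pose uB := code_of 2 hlf (fun i => v (hlf + i)%N).
have b2 (g : nat -> bool) i : (i < hlf)%N -> (g i < 2)%N by case: (g i).
have uAN : (uA < 2 ^ hlf)%N by apply: code_of_bound => // i; apply: (b2 v).
have uBN : (uB < 2 ^ hlf)%N by apply: code_of_bound => // i; apply: (b2 (fun i => v (hlf + i)%N)).
have xdiv u : (u < 2 ^ hlf)%N -> ((s * 2 ^ hlf + u) %/ 2 ^ hlf = s)%N.
  by move=> uN; rewrite divnMDl // divn_small // addn0.
have xN u : (u < 2 ^ hlf)%N -> (s * 2 ^ hlf + u < npt)%N.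
  by move=> uN; rewrite /npoints /log_points expnD [in X in (_ < X)%N]mulnC -ltn_divLR // xdiv.
have Fs u : (u < 2 ^ hlf)%N -> Fx (s * 2 ^ hlf + u) = crun M k alpha (cmin M k f) tok W ntok.
  move=> uN; rewrite /leaf_formula; apply: crun_eq => t tn.
  by rewrite /tokx xdiv // dig_code_of.
set x := (s * 2 ^ hlf + uA)%N; set y := (s * 2 ^ hlf + uB)%N.
have xn := xN _ uAN; have yn := xN _ uBN.
exists x, y; split=> // i; rewrite /coord_value !Fs // lf ltnn /=.
case: eqP => _; first by rewrite !xdiv //; lia.
set F := crun _ _ _ _ _ _ _ in St lf *.
(* Two set bits in one slot would mean a clause of the leaf that both halves of [v] falsify. *)
have nb : ~~ (slot_bit k n F x true (i - 1)%N && slot_bit k n F y false (i - 1)%N).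
  apply/negP => /andP[/slot_bitP[c [cU Fc rc cf]] /slot_bitP[c' [cU' Fc' rc' cf']]].
  have ec : c' = c by apply: (rank_inj M_gt0 k_gt0 alpha_ge cU' cU Fc' Fc); rewrite rc rc'.
  rewrite {}ec in cf'.
  have [p pk /andP[d0 /eqP dv]] := csat_code St cU Fc.
  have dM : (dig M c p < M)%N by apply: dig_ltn.
  have idn := lidx_ltn d0 dM.
  have [ih|hi] := ltnP (lidx n (dig M c p)) hlf.
    have := cfalseP _ _ _ cf p pk; rewrite /slit d0 ih /= -dv.
    have -> : (x %/ 2 ^ lidx n (dig M c p) %% 2 = v (lidx n (dig M c p)))%N.
      by rewrite -[LHS]/(dig 2 x _) dig_shift // dig_code_of // => j; apply: (b2 v).
    by rewrite eqxx.
  have := cfalseP _ _ _ cf' p pk; rewrite /slit d0 hi /= -dv.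
  have hn' := leq_half_vars n.
  have -> : (y %/ 2 ^ (lidx n (dig M c p) - hlf) %% 2 = v (lidx n (dig M c p)))%N.
    rewrite -[LHS]/(dig 2 y _) dig_shift //; last by lia.
    rewrite dig_code_of //; [by rewrite subnKC| |lia].
    by move=> j; apply: (b2 (fun i => v (hlf + i)%N)).
  by rewrite eqxx.
by case: (slot_bit _ _ _ x _ _) nb => /=; case: (slot_bit _ _ _ y _ _) => //= _; lia.
Qed.

(** Half assignments may falsify the same clauses, so the other coordinates cannot separate points.
    Coordinate 0 determines [x] modulo [4 * npt], and its two cases differ in sign. *)
Lemma coord0_inj sd x y : (x < npt)%N -> (y < npt)%N ->
  coordv sd x 0 = coordv sd y 0 -> x = y.
Proof.
move=> xN yN; rewrite /coord_value /=.
have modN a z : (z < npt)%N -> ((4 * npt * a + z) %% (4 * npt) = z)%N.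
  by move=> zN; rewrite [(4 * npt * a)%N]mulnC modnMDl modn_small //; lia.
have e4 a b : (4 * npt * a + x = 4 * npt * b + y)%N -> x = y.
  by move=> e; rewrite -(modN a x xN) -(modN b y yN) e.
have mixed (a b c d : nat) : (c < b)%N -> c%:Z - (4 * b)%N%:Z = (a + d)%N%:Z -> False by lia.
case: ifP => _; case: ifP => _ e.
- by lia.
- by case: (mixed _ _ _ _ xN e).
- by case: (mixed _ _ _ _ yN (esym e)).
- by apply: (e4 (x %/ 2 ^ hlf) (y %/ 2 ^ hlf))%N; have := congr1 absz e.
Qed.

Lemma sat_of_close x y : (x < npt)%N -> (y < npt)%N ->
  (forall i, (i < bdim)%N -> `|coordv true x i - coordv false y i| < 3 * npt%:Z) ->
  exists v, sat (vtrue v) (fam M k f).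
Proof.
move=> xN yN close; have sd := slots_dim.
have := close 0%N _; rewrite /coord_value /= => /(_ ltac:(lia)).
case: ifP => [_|nl].
  have far (a b c d : nat) : (c < b)%N -> `|c%:Z - (4 * b)%N%:Z - (a + d)%N%:Z| < 3 * b%:Z -> False by lia.
  by move=> h; case: (far _ _ _ _ xN h).
have lf : sel M k alpha (Fx x) = Q.
  by have := sel_leq M_gt0 k_gt0 alpha_ge (Fx x); move: nl; lia.
set s := (x %/ _)%N; set s' := (y %/ _)%N => c0.
have es : s = s'.
  have [lt|gt|//] := ltngtP s s'.
    by have : (4 * npt * s + 4 * npt <= 4 * npt * s')%N; [rewrite -mulnSr leq_mul|lia].
  by have : (4 * npt * s' + 4 * npt <= 4 * npt * s)%N; [rewrite -mulnSr leq_mul|lia].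
have eF : Fx y = Fx x by apply: tokx_eq.
pose v i := if (i < hlf)%N then (x %/ 2 ^ i %% 2 == 1)%N else (y %/ 2 ^ (i - hlf) %% 2 == 1)%N.
have bit1 z (b : bool) : (z %% 2 == b)%N = ((z %% 2 == 1)%N == b).
  by have := ltn_pmod z (isT : 0 < 2)%N; case: (z %% 2)%N => [|[|]] //; case: b.
exists v; rewrite -(cmin_sat M_gt0 k_gt0 alpha_ge).
apply: (crun_sat M_gt0 k_gt0 alpha_ge (tok := tokx w n x) (W := W) (n := ntok)).
rewrite -/(Fx x); apply/forallP => C; apply/implyP => /famP[c [cU Fc ->]].
have [/existsP[p pt]|np] := boolP [exists p : 'I_k, dtrue v (dig M c p)].
  apply/existsP; exists (p, Ordinal (dig_ltn c p M_gt0)).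
  by rewrite inE /= eqxx andbT /vtrue /= pt andbT; case/andP: pt.
exfalso.
have nt p : (p < k)%N -> dtrue v (dig M c p) = false.
  by move=> pk; apply: negbTE; move: np; rewrite negb_exists => /forallP/(_ (Ordinal pk)).
have cf1 : cfalse k n x true c.
  apply/cfalseP => p /nt; rewrite /dtrue /slit /v; case: (0 < _)%N => //=.
  by case: ifP => //= ih h; rewrite bit1 h.
have cf2 : cfalse k n y false c.
  apply/cfalseP => p /nt; rewrite /dtrue /slit /v; case: (0 < _)%N => //=.
  by rewrite [(hlf <= _)%N]leqNgt; case: ifP => //= ih h; rewrite bit1 h.
have rj := rank_ltn cU Fc.
have hc := crun_leaf_card M_gt0 k_gt0 alpha_ge (tok := tokx w n x) lf.
rewrite -/(Fx x) in hc.
(* The leaf has so few clauses that the slot of [c] is among the coordinates; there side A is at 0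
   and side B at [3N]. *)
have := close (rank M k (Fx x) c).+1 _; rewrite /coord_value /= subn1 /= eF => /(_ ltac:(lia)).
have -> : slot_bit k n (Fx x) x true (rank M k (Fx x) c) by apply/slot_bitP; exists c.
have -> : slot_bit k n (Fx x) y false (rank M k (Fx x) c) by apply/slot_bitP; exists c.
by lia.
Qed.

End Corr.

(** * Programs on shifted arrays *)

Fixpoint shift_expr (d : nat) (e : expr) : expr :=
  match e with
  | ECst z => ECst z
  | EGet a e => EGet (d + a) (shift_expr d e)
  | EBin o e1 e2 => EBin o (shift_expr d e1) (shift_expr d e2)
  end.

Fixpoint shift_prog (d : nat) (p : prog) : prog :=
  match p with
  | PSkip => PSkip
  | PSet a i e => PSet (d + a) (shift_expr d i) (shift_expr d e)
  | PSeq p q => PSeq (shift_prog d p) (shift_prog d q)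
  | PIf e p q => PIf (shift_expr d e) (shift_prog d p) (shift_prog d q)
  | PWhile e p => PWhile (shift_expr d e) (shift_prog d p)
  end.

Definition shifted d (s s1 : state) := forall a i, s1 (d + a)%N i = s a i.

Lemma eval_shift d s s1 e : shifted d s s1 -> eval s1 (shift_expr d e) = eval s e.
Proof. by move=> h; elim: e => [z|a e IH|o e1 IH1 e2 IH2] //=; rewrite ?IH ?IH1 ?IH2. Qed.

Lemma ecost_shift d s s1 e : shifted d s s1 -> ecost s1 (shift_expr d e) = ecost s e.
Proof.
move=> h; elim: e => [z|a e IH|o e1 IH1 e2 IH2] //=.
  by rewrite IH (eval_shift _ h) h.
by rewrite IH1 IH2 !(eval_shift _ h).
Qed.

Lemma exec_shift d p s t s' : exec p s t s' -> forall s1, shifted d s s1 ->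
  exists2 s1', exec (shift_prog d p) s1 t s1' & shifted d s' s1'.
Proof.
elim=> {p s t s'} [s|s a i e|p q s t s' t' s'' _ IH1 _ IH2|e p q s t s' pos _ IH|
  e p q s t s' neg _ IH|e p s t s' t' s'' pos _ IH1 _ IH2|e p s neg] s1 h /=.
- by exists s1 => //; apply: ExecSkip.
- rewrite -!(ecost_shift _ h) -!(eval_shift _ h); eexists; first exact: ExecSet.
  by move=> b j; rewrite /update eqn_add2l h.
- have [s2 e1 h1] := IH1 _ h; have [s3 e2 h2] := IH2 _ h1.
  by exists s3 => //; apply: ExecSeq e1 e2.
- have [s2 e1 h1] := IH _ h; exists s2 => //; rewrite -(ecost_shift _ h).
  by apply: ExecIfTrue => //; rewrite (eval_shift _ h).
- have [s2 e1 h1] := IH _ h; exists s2 => //; rewrite -(ecost_shift _ h).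
  by apply: ExecIfFalse => //; rewrite (eval_shift _ h).
- have [s2 e1 h1] := IH1 _ h; have [s3 e2 h2] := IH2 _ h1.
  exists s3 => //; rewrite -(ecost_shift _ h).
  by apply: ExecWhileTrue e1 e2; rewrite (eval_shift _ h).
- by exists s1 => //; rewrite -(ecost_shift _ h); apply: ExecWhileFalse; rewrite (eval_shift _ h).
Qed.

(** * Layout of the encoded instance *)

Lemma size_flatten_const (T S : Type) (f : S -> seq T) c (s : seq S) :
  (forall x, size (f x) = c) -> size (flatten (map f s)) = (size s * c)%N.
Proof. by move=> h; elim: s => //= x s IH; rewrite size_cat h IH mulSn. Qed.

Lemma nth_flatten_const (T : Type) (x0 : T) (f : nat -> seq T) c N z :
  (forall x, size (f x) = c) -> (z < N * c)%N ->
  nth x0 (flatten (map f (iota 0 N))) z = nth x0 (f (z %/ c)%N) (z %% c)%N.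
Proof.
move=> hf zN; have c0 : (0 < c)%N by case: c zN {hf} => //; rewrite muln0.
suff gen m : nth x0 (flatten (map f (iota m N))) z = nth x0 (f (m + z %/ c)%N) (z %% c)%N by rewrite gen add0n.
elim: N m z zN => [|N IH] m z zN; first by rewrite mul0n in zN.
rewrite /= nth_cat hf; case: ltnP => h.
  by rewrite divn_small // modn_small // addn0.
rewrite IH; last by rewrite mulSn in zN; lia.
have mz : (z %% c = (z - c) %% c)%N by rewrite -[in LHS](subnKC h) modnDl.
have dz : (z %/ c = 1 + (z - c) %/ c)%N.
  by rewrite -[in LHS](subnKC h) divnDl ?dvdnn // divnn c0.
by rewrite mz dz addnA addn1.
Qed.

Section Instance.
Variables (N d : nat) (g : bool -> nat -> nat -> int).

Definition int_point (side : bool) (x : nat) : 'rV[rat]_d := \row_(i < d) (g side x i)%:~R.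
Definition int_points side := [seq int_point side x | x <- iota 0 N].

Lemma encode_int (z : int) : encode_rat z%:~R = [:: z; 1].
Proof. by rewrite /encode_rat numq_int denq_int. Qed.

Lemma encode_int_point side x :
  encode_point (int_point side x) = flatten [seq [:: g side x i; 1] | i <- iota 0 d].
Proof.
rewrite /encode_point -val_enum_ord -map_comp; congr flatten; apply: eq_map => i /=.
by rewrite mxE encode_int.
Qed.

Definition int_cell (z : nat) : int :=
  if (z < 4)%N then
    if (z < 1)%N then N%:Z else if (z < 2)%N then d%:Z else if (z < 3)%N then N%:Z else 1
  else if (0 < z %% 2)%N then 1
  else let row := ((z - 4) %/ (2 * d))%N in
    g (row < N)%N (row %% N) ((z - 4) %/ 2 %% d).

Lemma size_encode_int_point side x : size (encode_point (int_point side x)) = (2 * d)%N.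
Proof. by rewrite encode_int_point (@size_flatten_const _ _ _ 2) // size_iota mulnC. Qed.

Lemma flatten_int_points side : flatten [seq encode_point a | a <- int_points side] =
  flatten [seq encode_point (int_point side x) | x <- iota 0 N].
Proof. by rewrite /int_points -map_comp. Qed.

Lemma size_flatten_int_points side :
  size (flatten [seq encode_point a | a <- int_points side]) = (N * (2 * d))%N.
Proof.
rewrite flatten_int_points (@size_flatten_const _ _ _ (2 * d)) ?size_iota //.
by move=> x; apply: size_encode_int_point.
Qed.

Lemma nth_flatten_int_points side z : (z < N * (2 * d))%N ->
  nth 0 (flatten [seq encode_point a | a <- int_points side]) z =
  if (0 < z %% 2)%N then 1 else g side (z %/ (2 * d)) (z %/ 2 %% d).
Proof.
move=> zN; have d0 : (0 < 2 * d)%N by case: d zN; rewrite ?muln0.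
rewrite flatten_int_points (@nth_flatten_const _ _ _ (2 * d)) //; last by move=> x; apply: size_encode_int_point.
rewrite encode_int_point (@nth_flatten_const _ _ _ 2) //; last by rewrite [(d * 2)%N]mulnC ltn_pmod.
rewrite modn_dvdm ?dvdn_mulr //.
have -> : (z %% (2 * d) %/ 2 = z %/ 2 %% d)%N by rewrite modn_divl [(d * 2)%N]mulnC.
have := ltn_pmod z (isT : 0 < 2)%N; by case: (z %% 2)%N => [|[|]].
Qed.

Lemma init_encode z : init (encode_bcp N (int_points true) (int_points false) N%:R) 0 z =
  if z is Posz c then (if (c < 4 + 4 * N * d)%N then int_cell c else 0) else 0.
Proof.
case: z => // c; rewrite /init /= /encode_bcp /encode_rat.
have -> : (N%:R : rat) = (N%:Z)%:~R by [].
rewrite numq_int denq_int /int_cell.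
case: c => [|[|[|[|c]]]] //=; rewrite (_ : (c.+4 - 4 = c)%N); last by lia.
have -> : (c.+4 %% 2 = c %% 2)%N by rewrite -addn4 -modnDmr addn0.
rewrite nth_cat size_flatten_int_points.
case: ltnP => h1.
  have d0 : (0 < 2 * d)%N by move: h1; case: (2 * d)%N => //; rewrite muln0.
  have rN : (c %/ (2 * d) < N)%N by rewrite ltn_divLR.
  rewrite nth_flatten_int_points // (_ : (c.+4 < _)%N); last by lia.
  by rewrite rN (modn_small rN).
case: ltnP => h2; last by rewrite nth_default // size_flatten_int_points; lia.
rewrite nth_flatten_int_points; last by lia.
have d0 : (0 < 2 * d)%N by lia.
have e : (c = N * (2 * d) + (c - N * (2 * d)))%N by lia.
have -> : (c %% 2 = (c - N * (2 * d)) %% 2)%N.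
  by rewrite {1}e mulnCA mulnC modnMDl.
have -> : (c %/ 2 %% d = (c - N * (2 * d)) %/ 2 %% d)%N.
  by rewrite {1}e mulnCA [(2 * _)%N]mulnC divnMDl // modnMDl.
have e2 : (c %/ (2 * d) = N + (c - N * (2 * d)) %/ (2 * d))%N by rewrite {1}e divnMDl.
have small : ((c - N * (2 * d)) %/ (2 * d) < N)%N by rewrite ltn_divLR //; lia.
by rewrite e2 [(_ < N)%N]ltnNge leq_addr /= modnDl (modn_small small).
Qed.

End Instance.

(** * CNF formulas as families of codes *)

Section Cnf.
Variables (k n : nat) (phi : cnf n).
Hypotheses (phi_k : is_kcnf k phi) (k_gt0 : (0 < k)%N).
Local Notation M := (2 * n + 1)%N.
Local Notation U := (M ^ k)%N.

Definition cl j : clause n := nth [::] phi j.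
Definition cl_size j := size (cl j).
Definition lit_digit (l : literal n) : nat := if l.2 then l.1.+1 else (n + l.1.+1)%N.
Definition cl_digit j i := nth 0%N [seq lit_digit l | l <- cl j] i.
Definition cl_pos j := (2 + \sum_(i < j) (cl_size i).+1)%N.

Lemma lit_digit_ltn l : (lit_digit l < M)%N.
Proof. by rewrite /lit_digit; case: l => i b /=; have := ltn_ord i; case: b; lia. Qed.

Lemma cl_digit_ltn j i : (cl_digit j i < M)%N.
Proof.
rewrite /cl_digit; have [h|h] := ltnP i (size [seq lit_digit l | l <- cl j]); last by rewrite nth_default // addn1.
by have /mapP[l _ ->] := mem_nth 0%N h; apply: lit_digit_ltn.
Qed.

Lemma cl_size_leq j : (cl_size j <= k)%N.
Proof.
rewrite /cl_size /cl; have [h|h] := ltnP j (size phi); last by rewrite nth_default.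
by case/andP: phi_k => _ /allP/(_ _ (mem_nth [::] h))/andP[].
Qed.

Lemma cl_posS j : cl_pos j.+1 = (cl_pos j + cl_size j + 1)%N.
Proof. by rewrite /cl_pos big_ord_recr /= -[(cl_size j).+1]addn1 !addnA. Qed.

Lemma nth_encode_cnf j i : (j < size phi)%N -> (i <= cl_size j)%N ->
  nth 0 (encode_cnf phi) (cl_pos j + i) = nth 0 (encode_clause (cl j)) i.
Proof.
rewrite /encode_cnf /cl_pos -addnA /= /cl_size /cl => + hi.
elim: phi j hi => // c s IH [|j] hi jm /=.
  by rewrite big_ord0 !add0n -cat_cons nth_cat /= size_map ltnS hi.
rewrite big_ord_recl add0n -cat_cons nth_cat /= size_map -addnA ltnNge leq_addr /=.
by rewrite addKn; apply: IH.
Qed.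

Lemma nth_cl_size j : (j < size phi)%N -> nth 0 (encode_cnf phi) (cl_pos j) = (cl_size j)%:Z.
Proof. by move=> jm; have := nth_encode_cnf jm (leq0n _); rewrite addn0. Qed.

Lemma nth_cl_lit (l0 : literal n) j i : (j < size phi)%N -> (i < cl_size j)%N ->
  let z := nth 0 (encode_cnf phi) (cl_pos j + 1 + i) in
  (if 0 < z then z else n%:Z - z) = (cl_digit j i)%:Z.
Proof.
move=> jm ij z; have {z}-> : z = encode_literal (nth l0 (cl j) i).
  by rewrite /z -addnA nth_encode_cnf // add1n /= (nth_map l0).
rewrite /cl_digit (nth_map l0) //.
by case: (nth l0 (cl j) i) => o b; rewrite /encode_literal /lit_digit /=; case: b => //=; lia.
Qed.

Local Notation code j := (ccode k n cl_size cl_digit j).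

Lemma dig_code j p : (p < k)%N ->
  dig M (code j) p = if (p < cl_size j)%N then cl_digit j p else 0%N.
Proof.
move=> pk; rewrite dig_code_of ?addn1 // => i _; case: ifP => // _.
by rewrite -[X in (_ < X)%N]addn1 cl_digit_ltn.
Qed.

Lemma lit_digit_gt0 l : (0 < lit_digit l)%N.
Proof. by rewrite /lit_digit; case: ifP => // _; rewrite addnS. Qed.

Lemma lidx_lit_digit l : lidx n (lit_digit l) = l.1.
Proof.
case: l => o b; rewrite /lidx /lit_digit /=; have := ltn_ord o.
by case: b => on; case: ifP; lia.
Qed.

Lemma sgn_lit_digit l : (lit_digit l <= n)%N = l.2.
Proof. by case: l => o b; rewrite /lit_digit /=; have := ltn_ord o; case: b; lia. Qed.

Lemma lit_digit_inj : injective lit_digit.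
Proof.
move=> l l' e; have e1 := lidx_lit_digit l; have e2 := sgn_lit_digit l.
rewrite e lidx_lit_digit in e1; rewrite e sgn_lit_digit in e2.
by case: l l' e1 e2 {e} => o b [o' b'] /= e1 ->; congr pair; apply: val_inj.
Qed.

Lemma cl_digit_gt0 j i : (i < cl_size j)%N -> (0 < cl_digit j i)%N.
Proof.
move=> ij; have /mapP[l _ ->] : cl_digit j i \in [seq lit_digit l | l <- cl j].
  by rewrite mem_nth // size_map.
exact: lit_digit_gt0.
Qed.

(** Digits of literals are positive, so the first digit 0 marks the end of the clause. *)
Lemma code_inj j j' : code j = code j' -> cl j = cl j'.
Proof.
move=> e; have dg p : (p < k)%N -> (if (p < cl_size j)%N then cl_digit j p else 0%N) =
    (if (p < cl_size j')%N then cl_digit j' p else 0%N).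
  by move=> pk; rewrite -!dig_code // e.
have es : cl_size j = cl_size j'.
  have [lt|gt|//] := ltngtP (cl_size j) (cl_size j').
    have := dg (cl_size j) (leq_trans lt (cl_size_leq j')); rewrite ltnn lt => e0.
    by have := cl_digit_gt0 lt; rewrite -e0.
  have := dg (cl_size j') (leq_trans gt (cl_size_leq j)); rewrite ltnn gt => e0.
  by have := cl_digit_gt0 gt; rewrite e0.
apply: (inj_map lit_digit_inj); apply: (@eq_from_nth _ 0%N); rewrite !size_map //.
move=> i ij; have := dg i (leq_trans ij (cl_size_leq j)).
by rewrite -es ij.
Qed.

(** Here the absence of repeated clauses in [is_kcnf] is used: the codes of the clauses are
    distinct. *)
Lemma size_phi_leq : (size phi <= U)%N.
Proof.
have cU j : (code j < U)%N by apply: ccode_U => *; apply: cl_digit_ltn.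
rewrite -[X in (X <= _)%N]card_ord -[X in (_ <= X)%N]card_ord.
apply: (@leq_card _ _ (fun j : 'I_(size phi) => Ordinal (cU j))) => j j' [/code_inj e].
apply: val_inj; apply/eqP; have /andP[u _] := phi_k.
by rewrite -(nth_uniq [::] (ltn_ord j) (ltn_ord j') u) -/(cl j) e.
Qed.

Variable alpha : nat.
Hypothesis alpha_ge : (4 * k <= alpha)%N.
Local Notation fphi := (is_cnf_code k n (size phi) cl_size cl_digit).

Let M_gt0 : (0 < M)%N. Proof. by rewrite addn1. Qed.

Lemma fphiP c : reflect (exists2 j, (j < size phi)%N & code j = c) (fphi c).
Proof.
apply: (iffP hasP) => [[j]|[j jm <-]]; first by rewrite mem_iota => /= jm /eqP; exists j.
by exists j; rewrite ?mem_iota.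
Qed.

Lemma satisfiableP : satisfiable phi <-> exists v, sat (@vtrue k n v) (fam M k fphi).
Proof.
split.
  move=> /existsP[v sv]; pose v' i := [exists o : 'I_n, (o == i :> nat) && v o].
  have v'E (o : 'I_n) : v' o = v o.
    apply/existsP/idP => [[o' /andP[/eqP e vo]]|vo]; last by exists o; rewrite eqxx.
    by rewrite -(val_inj e).
  exists v'; apply/forallP => C; apply/implyP => /famP[c [cU /fphiP[j jm <-] ->]].
  have /hasP[l lc vl] := allP sv _ (mem_nth [::] jm).
  have ij : (index l (cl j) < cl_size j)%N by rewrite /cl_size index_mem.
  have ik := leq_trans ij (cl_size_leq j).
  have dl : cl_digit j (index l (cl j)) = lit_digit l by rewrite /cl_digit (nth_map l) ?nth_index.
  apply/existsP; exists (Ordinal ik, Ordinal (lit_digit_ltn l)).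
  rewrite inE /= dig_code // ij dl eqxx lit_digit_gt0 /vtrue /dtrue /=.
  by rewrite lit_digit_gt0 lidx_lit_digit sgn_lit_digit v'E vl.
move=> [v sv]; apply/existsP; exists [ffun o : 'I_n => v o]; apply/(all_nthP [::]) => j jm.
have cU : (code j < U)%N by apply: ccode_U => *; apply: cl_digit_ltn.
have fc : fphi (code j) by apply/fphiP; exists j.
have [p pk] := csat_code k_gt0 alpha_ge sv cU fc; rewrite dig_code //.
case: ifP => // ps.
have /mapP[l lc ->] : cl_digit j p \in [seq lit_digit l | l <- cl j].
  by rewrite mem_nth // size_map.
rewrite /dtrue lidx_lit_digit sgn_lit_digit => /andP[_ vl].
by apply/hasP; exists l; rewrite // ffunE.
Qed.

End Cnf.

(** * Running time *)

Definition poly_bounded (f : nat -> nat) := exists C, forall n, (f n <= C * n.+1 ^ C)%N.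

Lemma poly_bounded_le f g : (forall n, f n <= g n)%N -> poly_bounded g -> poly_bounded f.
Proof. by move=> fg [C hC]; exists C => n; apply: leq_trans (fg n) (hC n). Qed.

Lemma poly_bounded_const c : poly_bounded (fun=> c).
Proof. by exists c => n; rewrite leq_pmulr // expn_gt0. Qed.

Lemma poly_bounded_id : poly_bounded id.
Proof. by exists 1%N => n; rewrite mul1n expn1. Qed.

Lemma poly_bounded_add f g : poly_bounded f -> poly_bounded g ->
  poly_bounded (fun n => f n + g n)%N.
Proof.
move=> [C hC] [C' hC']; exists (C + C')%N => n; rewrite mulnDl leq_add //.
  by apply: leq_trans (hC n) _; rewrite leq_mul2l leq_pexp2l ?orbT // leq_addr.
by apply: leq_trans (hC' n) _; rewrite leq_mul2l leq_pexp2l ?orbT // leq_addl.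
Qed.

Lemma poly_bounded_mul f g : poly_bounded f -> poly_bounded g ->
  poly_bounded (fun n => f n * g n)%N.
Proof.
move=> [C hC] [C' hC']; exists (C * C' + C + C')%N => n.
apply: leq_trans (leq_mul (hC n) (hC' n)) _; rewrite mulnACA -expnD.
by rewrite leq_mul ?leq_pexp2l //; lia.
Qed.

Lemma poly_bounded_exp f e : poly_bounded f -> poly_bounded (fun n => f n ^ e)%N.
Proof.
move=> h; elim: e => [|e IH]; first exact: (poly_bounded_const 1).
by apply: poly_bounded_le (poly_bounded_mul h IH) => n; rewrite expnS.
Qed.

Section Reduction.
Variables (k alpha w D : nat).
Hypotheses (k_gt0 : (0 < k)%N) (alpha_ge : (4 * k <= alpha)%N).
Local Notation M n := (2 * n + 1)%N.

Lemma poly_bounded_M : poly_bounded (fun n => M n).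
Proof.
by apply: poly_bounded_add (poly_bounded_const 1); apply: poly_bounded_mul poly_bounded_id; apply: poly_bounded_const.
Qed.

Lemma poly_bounded_half : poly_bounded half_vars.
Proof.
apply: (poly_bounded_le (g := fun n => n + 1)%N); first by move=> n; apply: leq_div.
exact: poly_bounded_add poly_bounded_id (poly_bounded_const 1).
Qed.

Lemma poly_bounded_ntokens : poly_bounded (ntokens k alpha).
Proof.
apply: (poly_bounded_le (g := fun n => 3 * (k * M n) + 1)%N).
  by move=> n; rewrite leq_add2r leq_div.
apply: poly_bounded_add (poly_bounded_const 1); apply: poly_bounded_mul (poly_bounded_const 3) _.
exact: poly_bounded_mul (poly_bounded_const k) poly_bounded_M.
Qed.

Lemma poly_bounded_log_points : poly_bounded (log_points k alpha w).
Proof.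
apply: poly_bounded_add poly_bounded_half _.
exact: poly_bounded_mul (poly_bounded_const w) poly_bounded_ntokens.
Qed.

Lemma poly_bounded_bcp_dim : poly_bounded (bcp_dim k alpha w D).
Proof. exact: poly_bounded_mul (poly_bounded_const D) poly_bounded_log_points. Qed.

Lemma poly_bounded_search : poly_bounded (fun n => search_bound (M n) k).
Proof.
apply: poly_bounded_mul (poly_bounded_const _) _.
exact: poly_bounded_exp poly_bounded_M.
Qed.

Lemma poly_bounded_bits : poly_bounded (bit_bound k alpha w D).
Proof.
apply: poly_bounded_add (poly_bounded_const 10).
apply: poly_bounded_add poly_bounded_ntokens.
apply: poly_bounded_add (poly_bounded_const _).
apply: poly_bounded_add poly_bounded_bcp_dim.
apply: poly_bounded_add poly_bounded_search _.
exact: poly_bounded_mul (poly_bounded_const 3) poly_bounded_log_points.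
Qed.

Lemma poly_bounded_fill : poly_bounded (fun n => (M n ^ k) * 40 + 30)%N.
Proof.
apply: poly_bounded_add (poly_bounded_const 30); apply: poly_bounded_mul (poly_bounded_const 40).
exact: poly_bounded_exp poly_bounded_M.
Qed.

Lemma poly_bounded_ubody : poly_bounded (ubody k alpha).
Proof.
apply: poly_bounded_add (poly_bounded_const 10) _.
apply: poly_bounded_add poly_bounded_fill _.
apply: poly_bounded_add (poly_bounded_const (10 + 10)).
apply: poly_bounded_add (poly_bounded_const 30).
apply: poly_bounded_mul poly_bounded_ntokens _.
apply: poly_bounded_add (poly_bounded_const 30).
apply: poly_bounded_add (poly_bounded_const 30).
apply: poly_bounded_mul (poly_bounded_const _) _.
apply: poly_bounded_add (poly_bounded_const 30).
apply: poly_bounded_add (poly_bounded_const 10) _.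
exact: poly_bounded_add poly_bounded_fill poly_bounded_fill.
Qed.

(** Only the number of output cells is exponential in n, and it is linear in [npoints]. *)
Lemma umain_bound : exists C, forall n m, (m <= M n ^ k)%N ->
  (umain k alpha w D n m <= npoints k alpha w n * (C * n.+1 ^ C))%N.
Proof.
pose f n := ((10 + (10 + (10 + (log_points k alpha w n * 40 + 30)))) +
  (10 + (M n ^ k * 50 + 30) + ((4 + 4 * bcp_dim k alpha w D n) * (ubody k alpha n + 30) + 30)))%N.
have [C hC] : poly_bounded f.
  apply: poly_bounded_add.
    do 3 apply: poly_bounded_add (poly_bounded_const 10) _.
    apply: poly_bounded_add (poly_bounded_const 30).
    exact: poly_bounded_mul poly_bounded_log_points (poly_bounded_const 40).
  apply: poly_bounded_add.
    apply: poly_bounded_add (poly_bounded_const 10) _.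
    apply: poly_bounded_add (poly_bounded_const 30).
    apply: poly_bounded_mul (poly_bounded_const 50).
    exact: poly_bounded_exp poly_bounded_M.
  apply: poly_bounded_add (poly_bounded_const 30).
  apply: poly_bounded_mul.
    apply: poly_bounded_add (poly_bounded_const 4) _.
    exact: poly_bounded_mul (poly_bounded_const 4) poly_bounded_bcp_dim.
  exact: poly_bounded_add poly_bounded_ubody (poly_bounded_const 30).
exists C => n m mU; apply: leq_trans (leq_mul (leqnn _) (hC n)).
have N0 : (0 < npoints k alpha w n)%N by apply: npoints_gt0.
rewrite /umain /f /ncells.
move: (npoints _ _ _ _) (bcp_dim _ _ _ _ _) (ubody _ _ _) (log_points _ _ _ _) (M n ^ k)%N N0 mU.
move=> N d u l U N0 mU.
rewrite (mulnDr N); apply: leq_add; first by rewrite leq_pmull.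
rewrite (mulnDr N); apply: leq_add.
  by apply: leq_trans (leq_pmull _ N0); lia.
rewrite (mulnDr N); apply: leq_add; last by rewrite leq_pmull.
rewrite mulnA leq_mul2r; apply/orP; right.
by rewrite (mulnDr N) [(N * (4 * d))%N]mulnCA -mulnA leq_add2r leq_pmull.
Qed.

Lemma encode_cnf_bounded n (phi : cnf n) z : is_kcnf k phi ->
  (`|nth 0%R (encode_cnf phi) z| <= bit_bound k alpha w D n)%N.
Proof.
move=> pk; have mU := size_phi_leq pk k_gt0; have hU := U_leq_Q k n.
have kQ : (k <= search_bound (M n) k)%N.
  apply: (@leq_trans (k.+1 * k.+1)); first by rewrite mulSn; lia.
  by rewrite leq_pmulr // expn_gt0 addn1.
have hn := leq_half_vars n.
have nB : (n <= bit_bound k alpha w D n)%N by rewrite /bit_bound /log_points; lia.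
have kB : (k <= bit_bound k alpha w D n)%N by rewrite /bit_bound; lia.
have mB : (size phi <= bit_bound k alpha w D n)%N by rewrite /bit_bound; lia.
have [h|h] := ltnP z (size (encode_cnf phi)); last by rewrite nth_default.
have := mem_nth 0 h; move: (nth _ _ _) => y; rewrite !inE => /or3P[/eqP ->|/eqP ->|] //.
move=> /flatten_mapP[c cphi]; rewrite inE => /orP[/eqP ->|/mapP[l _ ->]].
  by case/andP: pk => _ /allP/(_ _ cphi)/andP[_ ck]; apply: leq_trans kB.
by rewrite /encode_literal; case: ifP => _; rewrite ?abszN absz_nat; apply: leq_trans nB.
Qed.

(** The shift makes [OUT] the input array of [p] and leaves its answer in [OUT + 1], from where it
    is copied. *)
Definition reduction_prog p := PSeq (ccomp 0 (c_main k alpha w D))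
  (PSeq (shift_prog OUT p) (PSet 1 (ECst 0) (EGet (OUT + 1) (ECst 0)))).

Section Formula.
Variables (n : nat) (phi : cnf n).
Definition cnf_code_set := is_cnf_code k n (size phi) (cl_size phi) (cl_digit phi).
Definition cnf_points := int_points (npoints k alpha w n) (bcp_dim k alpha w D n)
  (coord_value k alpha w n cnf_code_set).
Definition cnf_bcp := encode_bcp (npoints k alpha w n) (cnf_points true) (cnf_points false)
  (npoints k alpha w n)%:R.
End Formula.

Lemma reduction_prep : exists C, forall n (phi : cnf n), is_kcnf k phi ->
  exists s T, [/\ exec (ccomp 0 (c_main k alpha w D)) (init (encode_cnf phi)) T s,
    shifted OUT (init (cnf_bcp phi)) s & (T <= npoints k alpha w n * (C * n.+1 ^ C))%N].
Proof.
have [K spec] := ccomp_specP 0 (cwf_main k alpha w D).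
have [C1 hC1] := umain_bound.
have [C2 hC2] : poly_bounded (fun n => unit K (bit_bound k alpha w D n) (search_bound (M n) k)).
  apply: poly_bounded_mul (poly_bounded_const K) _; apply: poly_bounded_mul poly_bounded_bits _.
  apply: poly_bounded_exp; apply: (poly_bounded_le (g := fun n => search_bound (M n) k + 1)%N).
    by move=> n; rewrite [X in (_ <= X)%N]addn1.
  exact: poly_bounded_add poly_bounded_search (poly_bounded_const 1).
have [C hC] := poly_bounded_mul (ex_intro _ C1 (fun n => leqnn (C1 * n.+1 ^ C1)%N))
  (ex_intro _ C2 (fun n => leqnn (C2 * n.+1 ^ C2)%N)).
exists C => n phi pk; have mU := size_phi_leq pk k_gt0.
have B10 : (10 <= bit_bound k alpha w D n)%N by rewrite /bit_bound; lia.
have b0 : (bitlen 0 <= bit_bound k alpha w D n)%N by apply: leq_trans B10.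
have bd : bounded (bit_bound k alpha w D n) (search_bound (M n) k) (init (encode_cnf phi)) (fun=> 0).
  split; first lia.
  - move=> a i; rewrite /init; case: ifP => _; last exact: b0.
    case: i => i; last exact: b0.
    rewrite bitlen_leq; last by lia.
    by apply: leq_ltn_trans (encode_cnf_bounded _ pk) _; apply: ltn_expl.
  - by move=> l; apply: b0.
  - by [].
have rp : rep (init (encode_cnf phi)) (fun=> 0) (init (encode_cnf phi)) by [].
have main := @wpc_main k alpha w D n (size phi) (encode_cnf phi) (cl_pos phi) (cl_size phi)
  (cl_digit phi) k_gt0 alpha_ge erefl erefl mU.
have pos0 : cl_pos phi 0 = 2%N by rewrite /cl_pos big_ord0.
have lit j i (jm : (j < size phi)%N) (ij : (i < cl_size phi j)%N) :
  let z := nth 0 (encode_cnf phi) (cl_pos phi j + 1 + i) in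
  (if 0 < z then z else n%:Z - z) = (cl_digit phi j i)%:Z.
  case e : (cl phi j) => [|l0 c]; first by rewrite /cl_size e in ij.
  exact: (nth_cl_lit l0).
have posS j : cl_pos phi j.+1 = (cl_pos phi j + cl_size phi j + 1)%N by apply: cl_posS.
have szk j : (j < size phi)%N -> (cl_size phi j <= k)%N by move=> _; apply: cl_size_leq.
have szE j : (j < size phi)%N -> nth 0 (encode_cnf phi) (cl_pos phi j) = (cl_size phi j)%:Z.
  exact: nth_cl_size.
have [s [s1 [T [ex [rps _] _ [[[_ _ _ _ z0] _] out] hT]]]] :=
  main pos0 posS szk szE lit
    K 0%N (fun=> 0) spec _ bd rp.
exists s1, T; split=> //.
  move=> a i; have -> : s1 (OUT + a)%N i = s (OUT + a)%N i by apply: rps.1; rewrite /OUT /EV /TP.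
  case: a => [|a]; last by rewrite z0 // /init /OUT; lia.
  rewrite addn0 out init_encode; case: i => // z; case: ifP => // _.
  by rewrite /out_value /int_cell /point_of_cell; case: (z < 4)%N.
apply: leq_trans hT _; apply: leq_trans (leq_mul (hC1 n _ mU) (hC2 n)) _.
by rewrite -mulnA leq_mul2l hC orbT.
Qed.

Lemma reduction_answers : exists C, forall n (phi : cnf n), is_kcnf k phi ->
  forall p b tp, answers p (cnf_bcp phi) b tp ->
  exists2 t, answers (reduction_prog p) (encode_cnf phi) b t &
    (t <= npoints k alpha w n * (C * n.+1 ^ C) + tp + 10)%N.
Proof.
have [C hC] := reduction_prep; exists C => n phi pk p b tp [s [exs ans]].
have [s1 [T [ex1 sh hT]]] := hC n phi pk.
have [s2 ex2 sh2] := exec_shift exs sh.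
have e3 : s2 (OUT + 1)%N 0 = b%:Z by rewrite sh2 ans.
eexists; first (eexists; split).
- exact: ExecSeq ex1 (ExecSeq ex2 (ExecSet s2 1 (ECst 0) (EGet (OUT + 1) (ECst 0)))).
- by rewrite update_at /= e3.
- rewrite -[X in (_ <= X)%N]addnA; apply: leq_add hT _; rewrite leq_add2l /= -/(OUT + 1)%N e3.
  by case: (b).
Qed.

End Reduction.

From mathcomp Require Import all_classical all_reals all_analysis ring lra.

Import numFieldNormedType.Exports.

(** * Distances and growth over the reals *)

Section Distance.
Variables (R : realType) (d : nat) (g : bool -> nat -> nat -> int).
Implicit Types x y : nat.

Lemma dist_int_pointE sx sy x y : dist_infty R (int_point d g sx x) (int_point d g sy y) =
  \big[Num.max/0]_(ij : 'I_1 * 'I_d) (`|g sx x ij.2 - g sy y ij.2|%:~R : R).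
Proof.
rewrite /dist_infty -[LHS]/(mx_norm _) mx_normrE; apply: eq_bigr => ij _.
by rewrite !mxE !ratr_int -intrB -intr_norm.
Qed.

Lemma dist_int_point_le sx sy x y (c : int) : 0 <= c ->
  (forall i, (i < d)%N -> `|g sx x i - g sy y i| <= c) ->
  dist_infty R (int_point d g sx x) (int_point d g sy y) <= c%:~R.
Proof.
move=> c0 h; rewrite dist_int_pointE; apply: bigmax_le => [|ij _].
  by rewrite ler0z.
by rewrite ler_int; apply: h.
Qed.

Lemma dist_int_point_lt sx sy x y (c : R) : 
  dist_infty R (int_point d g sx x) (int_point d g sy y) < c ->
  forall i, (i < d)%N -> `|g sx x i - g sy y i|%:~R < c.
Proof.
move=> h i id; apply: le_lt_trans h; rewrite dist_int_pointE.
exact: (le_bigmax _ (fun ij : 'I_1 * 'I_d => (`|g sx x ij.2 - g sy y ij.2|%:~R : R)) (ord0, Ordinal id)).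
Qed.

End Distance.

Section Growth.
Variable R : realType.
Implicit Types (a b : R).

Lemma powR2_le a b : a <= b -> (2 : R) `^ a <= 2 `^ b.
Proof. by move=> h; apply: ler_powR => //; rewrite ler1n. Qed.

Lemma powR2_ge1 a : 0 <= a -> 1 <= (2 : R) `^ a.
Proof. by move=> h; rewrite -[leLHS](powRr0 (2 : R)); apply: powR2_le. Qed.

Lemma powR2D a b : (2 : R) `^ (a + b) = 2 `^ a * 2 `^ b.
Proof. by rewrite powRD // pnatr_eq0 implybT. Qed.

Lemma poly_growth (C : nat) : exists2 C' : R, 0 <= C' &
  forall n, (C * n.+1 ^ C)%N%:R <= C' * 2 `^ (n%:R / 8).
Proof.
(* From [n + 1 <= q * 2 ^ (n / q)], raised to the power [C]; this [q] makes [C * (n / q)] at most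
   [n / 8]. *)
pose q := (8 * C.+1)%N; exists (C * q ^ C)%N%:R => // n.
have h1 : (n.+1 <= q * 2 ^ (n %/ q))%N.
  apply: (@leq_trans ((n %/ q).+1 * q)); first exact: ltn_ceil.
  by rewrite mulnC leq_mul2l ltn_expl ?orbT.
have h2 : (C * n.+1 ^ C <= C * q ^ C * 2 ^ (n %/ q * C))%N.
  rewrite -mulnA leq_mul2l expnM -expnMn; case: (C) => // c.
  by rewrite leq_exp2r // h1 orbT.
apply: (@le_trans _ _ (C * q ^ C * 2 ^ (n %/ q * C))%N%:R); first by rewrite ler_nat.
rewrite natrM ler_wpM2l // natrX -powR_mulrn //; apply: powR2_le.
have h3 : (n %/ q * C * 8 <= n)%N.
  by apply: leq_trans (leq_divM n q); rewrite -mulnA leq_mul2l /q; apply/orP; right; lia.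
by rewrite ler_pdivlMr // -[8]/(8%:R) -natrM ler_nat.
Qed.

End Growth.

Lemma is_kcnfS k n (phi : cnf n) : is_kcnf k phi -> is_kcnf k.+1 phi.
Proof.
case/andP=> u /allP h; apply/andP; split=> //; apply/allP => c /h /andP[-> ck].
exact: leqW.
Qed.

(** The [k] supplied by [SETH] might be 0, whereas the reduction needs a positive one; it is applied
    to [k.+1]. *)
Lemma solves_kSATS (R : realType) k (eps : R) p : solves_kSAT k.+1 eps p -> solves_kSAT k eps p.
Proof. by move=> [C h]; exists C => n phi /is_kcnfS; apply: h. Qed.

(** * From closest pairs back to k-SAT *)

Section Instance.
Variables (R : realType) (k alpha w D : nat).
Local Notation W := (alpha ^ k.*2.-1)%N.
Hypotheses (k_gt0 : (0 < k)%N) (alpha_ge : (4 * k <= alpha)%N) (W_w : (W < 2 ^ w)%N).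
Hypothesis D_ge : (2 + 5 * (k * (1 + k * theta alpha k)) <= D)%N.

(** [npoints] is a power of 2, so for [c = D / ln 2] the product [c ln N] is the integer
    [D * log_points] and nothing is truncated. *)
Lemma bcp_dim_truncn n : bcp_dim k alpha w D n =
  Num.truncn ((D%:R / ln 2) * ln ((npoints k alpha w n)%:R : R)).
Proof.
have l2 : (0 : R) < ln 2 by apply: ln_gt0; rewrite ltr1n.
rewrite /npoints natrX lnXn // -[ln 2 *+ _]mulr_natr mulrA divfK ?gt_eqF //.
by rewrite -natrM natrK.
Qed.

Section Formula.
Variables (n : nat) (phi : cnf n).
Local Notation N := (npoints k alpha w n).
Local Notation A := (cnf_points k alpha w D phi true).
Local Notation B := (cnf_points k alpha w D phi false).
Local Notation coordv := (coord_value k alpha w n (cnf_code_set k phi)).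

Lemma mem_cnf_points sd a : a \in cnf_points k alpha w D phi sd ->
  exists2 x, (x < N)%N & a = int_point (bcp_dim k alpha w D n) coordv sd x.
Proof. by move=> /mapP[x]; rewrite mem_iota => /= xN ->; exists x. Qed.

Lemma uniq_cnf_points sd : uniq (cnf_points k alpha w D phi sd).
Proof.
rewrite map_inj_in_uniq ?iota_uniq // => x y; rewrite !mem_iota => /= xN yN.
have d0 : (0 < bcp_dim k alpha w D n)%N.
  by apply: leq_trans (slots_dim n k_gt0 alpha_ge W_w D_ge).
move=> /rowP/(_ (Ordinal d0)); rewrite !mxE => /eqP; rewrite eqr_int => /eqP.
exact: coord0_inj.
Qed.

Lemma cnf_bcp_instance : bcp_instance N A B N%:R.
Proof.
rewrite /bcp_instance !uniq_cnf_points !size_map !size_iota eqxx /=.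
by rewrite ltr0n npoints_gt0.
Qed.

(** The exponent 4 is that of [8 * N * N <= N.+1 ^ 4]. *)
Lemma short_int (z : int) : (`|z| <= 8 * N * N)%N -> short_rat 4 N z%:~R.
Proof.
move=> h; rewrite /short_rat numq_int denq_int /=.
have N0 := npoints_gt0 k alpha w n; rewrite expn_gt0 andbT /=.
apply: leq_trans h _; move: N N0 => m m0.
have -> : (m.+1 ^ 4 = (m.+1 * m.+1) * (m.+1 * m.+1))%N by rewrite !expnS expn0 muln1 !mulnA.
have [->//|m2] : (m = 1 \/ 2 <= m)%N by lia.
apply: (@leq_trans ((4 * m) * (m.+1 * m.+1))); nia.
Qed.

Lemma cnf_short_instance : short_instance 4 N A B N%:R.
Proof.
rewrite /short_instance (short_int (z := N)) /=; last by apply: npoints_leq.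
rewrite all_cat; apply/andP; split; apply/allP => a /mem_cnf_points[x xN ->];
  apply/forallP => i; rewrite mxE; apply: short_int; exact: coord_value_bound.
Qed.

Hypothesis phi_k : is_kcnf k phi.

Lemma cnf_bcp_yes : satisfiable phi -> bcp_yes R A B N%:R.
Proof.
move=> /(satisfiableP phi_k k_gt0 alpha_ge)[v sv].
have [x [y [xN yN close]]] := close_of_sat k_gt0 alpha_ge W_w D_ge sv.
exists (int_point (bcp_dim k alpha w D n) coordv true x),
  (int_point (bcp_dim k alpha w D n) coordv false y); split.
- by apply: map_f; rewrite mem_iota.
- by apply: map_f; rewrite mem_iota.
- rewrite ratr_nat -[N%:R]/(N%:Z%:~R); apply: dist_int_point_le => // i _; exact: close.
Qed.

Lemma cnf_bcp_no (gamma : R) : gamma < 3 -> ~~ satisfiable phi -> bcp_no gamma A B N%:R.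
Proof.
move=> g3 us a b /mem_cnf_points[x xN ->] /mem_cnf_points[y yN ->].
rewrite ratr_nat leNgt; apply/negP => lt; case/negP: us.
apply/(satisfiableP phi_k k_gt0 alpha_ge); apply: (sat_of_close k_gt0 alpha_ge W_w D_ge xN yN) => i id.
have := dist_int_point_lt lt id => h.
rewrite -(ltr_int R); apply: (lt_le_trans h).
by rewrite intrM ler_wpM2r // ltW.
Qed.

End Formula.

Lemma reduction_correct (gamma delta : R) p : gamma < 3 ->
  solves_bcp gamma delta (D%:R / ln 2) p ->
  exists (Cp : R) (C : nat), forall n (phi : cnf n), is_kcnf k phi ->
  exists t, answers (reduction_prog k alpha w D p) (encode_cnf phi) (satisfiable phi) t /\
    t%:R <= (npoints k alpha w n)%:R * (C * n.+1 ^ C)%N%:R +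
      Cp * (npoints k alpha w n)%:R `^ (2 - delta) + 10.
Proof.
move=> g3 /(_ 4%N)[Cp hp]; have [C hC] := reduction_answers w D k_gt0 alpha_ge.
exists Cp, C => n phi pk.
have [yes no] := hp _ _ _ _ _ (npoints_gt0 k alpha w n) (bcp_dim_truncn n)
  (cnf_bcp_instance phi) (cnf_short_instance phi).
have [tp [an tpC]] : exists t : nat, answers p (cnf_bcp k alpha w D phi) (satisfiable phi) t /\
    t%:R <= Cp * (npoints k alpha w n)%:R `^ (2 - delta).
  case e : (satisfiable phi); first exact/yes/cnf_bcp_yes.
  by apply/no/cnf_bcp_no => //; rewrite e.
have [t ant tC] := hC n phi pk p _ _ an.
exists t; split=> //; apply: (@le_trans _ _ ((npoints k alpha w n)%:R * (C * n.+1 ^ C)%N%:R + tp%:R + 10)).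
  by rewrite -natrM -!natrD ler_nat.
by rewrite lerD2r lerD2l.
Qed.

End Instance.

(** The slope is 1/2 for the half assignment plus eta for the tokens; the roundings go into the
    constant term. *)
Lemma log_points_le (R : realType) k alpha w n : (0 < alpha)%N ->
  (log_points k alpha w n)%:R <=
  (1 / 2 + w%:R * (3 * k%:R / alpha%:R + 1)) + (1 / 2 + 6 * k%:R * w%:R / alpha%:R) * n%:R :> R.
Proof.
move=> a0; have h1 : (2 * half_vars n <= n + 1)%N by rewrite /half_vars mulnC leq_divM.
have h2 : (3 * (k * (2 * n + 1)) %/ alpha * alpha <= 3 * (k * (2 * n + 1)))%N by apply: leq_divM.
rewrite /log_points /ntokens; move: (half_vars n) (_ %/ alpha)%N h1 h2 => h q.
rewrite -(ler_nat R) natrM natrD => h1; rewrite -(ler_nat R) !natrM natrD natrM => h2.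
rewrite natrD natrM natrD.
have a0' : (0 : R) < alpha%:R by rewrite ltr0n.
have hq : q%:R <= (3 * (k%:R * (2 * n%:R + 1))) / alpha%:R :> R by rewrite ler_pdivlMr.
have hw : w%:R * q%:R <= w%:R * ((3 * (k%:R * (2 * n%:R + 1))) / alpha%:R) :> R by rewrite ler_wpM2l.
have e : w%:R * ((3 * (k%:R * (2 * n%:R + 1))) / alpha%:R) =
  w%:R * (3 * k%:R / alpha%:R) + 6 * k%:R * w%:R / alpha%:R * n%:R :> R by ring.
rewrite e in hw; rewrite !mulrDr; lra.
Qed.

(** * Choice of the constants and conclusion *)

Section Constants.
Variables (R : realType) (delta : R) (k : nat).
Hypothesis delta_gt0 : 0 < delta.

(** For [alpha = 2 ^ a], the number [2 ^ w] is [alpha ^ k.+1.*2], one power of [alpha] above the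
    bound on tokens. The quotient is 12 (k+1)^2 a / 2^a. For a = 2e it is 24 (k+1)^2 e / 4^e, at
    most delta / 8 once 192 (k+1)^2 <= delta e, because e < 2^e. *)
Lemma choose_alpha : exists a : nat, let alpha := (2 ^ a)%N in
  let w := (a * k.+1.*2)%N in
  [/\ (4 * k.+1 <= alpha)%N, (alpha ^ k.+1.*2.-1 < 2 ^ w)%N &
    6 * k.+1%:R * w%:R / alpha%:R <= delta / 8].
Proof.
pose K := (192 * (k.+1 * k.+1))%N.
pose e := (Num.truncn (K%:R / delta) + 4 * k.+1)%N.+1.
have e2 : (e < 2 ^ e)%N by apply: ltn_expl.
have sq : (2 ^ (2 * e) = 2 ^ e * 2 ^ e)%N by rewrite mul2n -addnn expnD.
exists (2 * e)%N; split.
- rewrite sq; have : (4 * k.+1 < e)%N by rewrite ltnS leq_addl.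
  by move=> h; apply: (@leq_trans (2 ^ e)); [lia|rewrite leq_pmulr // expn_gt0].
- by rewrite -expnM ltn_exp2l // ltn_mul2l muln_gt0 /= doubleS /=.
- have h : K%:R / delta <= e%:R.
    apply: (@le_trans _ _ (Num.truncn (K%:R / delta)).+1%:R); first exact/ltW/truncnS_gt.
    by rewrite ler_nat ltnS leq_addr.
  have p0 : (0 : R) < (2 ^ e)%N%:R by rewrite ltr0n expn_gt0.
  have e2' : e%:R <= (2 ^ e)%N%:R :> R by rewrite ler_nat ltnW.
  have KE : K%:R = 192 * (k.+1%:R * k.+1%:R) :> R by rewrite /K !natrM.
  rewrite ler_pdivrMr // in h.
  rewrite sq ler_pdivrMr ?natrM ?mulr_gt0 //.
  have -> : (k.+1.*2)%:R = 2 * k.+1%:R :> R by rewrite -mul2n natrM.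
  move: h p0 e2' KE; move: (2 ^ e)%N%:R e%:R (k.+1%:R : R) K%:R (ler0n R e) => P x c KK x0 h p0 xP KE.
  rewrite KE in h.
  have h1 : 192 * (c * c) * x <= x * delta * x by rewrite ler_wpM2r.
  have h2 : delta * (x * x) <= delta * (P * P) by rewrite ler_wpM2l ?ler_pM // ltW.
  lra.
Qed.

End Constants.

Unset Implicit Arguments.

Theorem theorem1p3 (R : realType) (hSETH : SETH R)
    (delta gamma : R) (hdelta : 0 < delta)
    (hgamma1 : 1 < gamma) (hgamma3 : gamma < 3) :
  exists c : R, 0 < c /\ ~ exists p : prog, solves_bcp gamma delta c p.
Proof.
(* Capping at 1 keeps [2 - de] positive and [1 - de / 4] at least 3/4, room enough for the cost of
   writing the instance. *)
pose de := Num.min delta 1.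
have de0 : 0 < de by rewrite lt_min hdelta ltr01.
have de1 : de <= 1 by rewrite ge_min lexx orbT.
have ded : de <= delta by rewrite ge_min lexx.
have de4 : 0 < de / 4 by rewrite divr_gt0.
have [k hk] := hSETH _ de4.
have [a [alpha_ge W_w eta_le]] := choose_alpha k de0.
set alpha := (2 ^ a)%N in alpha_ge W_w eta_le; set w := (a * _)%N in W_w eta_le.
pose D := (2 + 5 * (k.+1 * (1 + k.+1 * theta alpha k.+1)))%N.
have l2 : (0 : R) < ln 2 by apply: ln_gt0; rewrite ltr1n.
exists (D%:R / ln 2); split; first by rewrite divr_gt0 // ltr0n.
move=> [p sp]; apply: hk.
exists (reduction_prog k.+1 alpha w D p); apply: solves_kSATS.
have [Cp [C hC]] := reduction_correct (ltn0Sn k) alpha_ge W_w (leqnn D) hgamma3 sp.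
have [C' C'0 hC'] := poly_growth R C.
pose eta : R := 6 * k.+1%:R * w%:R / alpha%:R.
pose c0 : R := 1 / 2 + w%:R * (3 * k.+1%:R / alpha%:R + 1).
have c00 : 0 <= c0 by rewrite addr_ge0 ?mulr_ge0 ?addr_ge0 ?divr_ge0.
have eta0 : 0 <= eta by rewrite divr_ge0 ?mulr_ge0.
exists (2 `^ c0 * C' + `|Cp| * 2 `^ (2 * c0) + 10) => n phi pk.
have [t [ant ht]] := hC n phi pk; exists t; split=> //; apply: le_trans ht _.
set N := npoints _ _ _ _.
have a0 : (0 < alpha)%N by rewrite expn_gt0.
have NE : N%:R = 2 `^ (log_points k.+1 alpha w n)%:R :> R by rewrite powR_mulrn // /N /npoints natrX.
have hL := log_points_le R k.+1 w n a0; rewrite -/eta -/c0 in hL.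
set L := (log_points _ _ _ _)%:R in NE hL.
have L0 : 0 <= L by [].
have n0 : (0 : R) <= n%:R by [].
have etan : eta * n%:R <= de / 8 * n%:R by rewrite ler_wpM2r.
have den : 0 <= de * n%:R by rewrite mulr_ge0 // ltW.
have den1 : de * n%:R <= n%:R by rewrite ler_piMl.
set X := 2 `^ ((1 - de / 4) * n%:R).
have X0 : 0 <= X by apply: powR_ge0.
rewrite [leRHS]mulrDl [X in _ <= X + _]mulrDl; apply: lerD; first apply: lerD.
(* Writing the instance: [1 / 2 + eta + 1 / 8 <= 3 / 4 <= 1 - de / 4], as
   [eta <= de / 8 <= 1 / 8]. *)
- apply: (@le_trans _ _ (2 `^ (c0 + (1 / 2 + eta) * n%:R) * (C' * 2 `^ (n%:R / 8)))).
    by rewrite NE ler_pM ?powR_ge0 //; apply: powR2_le.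
  rewrite powR2D mulrACA ler_wpM2l ?mulr_ge0 ?powR_ge0 //.
  rewrite -powR2D; apply: powR2_le; lra.
- apply: (@le_trans _ _ (`|Cp| * N%:R `^ (2 - delta))).
    by rewrite ler_wpM2r ?powR_ge0 // ler_norm.
  rewrite -mulrA ler_wpM2l // NE -powRrM -powR2D; apply: powR2_le.
  (* Running [p]: [(1 / 2 + eta) * (2 - de) <= 1 - de / 2 + 2 * eta <= 1 - de / 4], which is why
     [SETH] was used with [de / 4]. *)
  apply: (@le_trans _ _ (L * (2 - de))); first by rewrite ler_wpM2l // lerB.
  apply: (@le_trans _ _ ((c0 + (1 / 2 + eta) * n%:R) * (2 - de))).
    by rewrite ler_wpM2r // subr_ge0; lra.
  have h1 : 0 <= de * c0 by rewrite mulr_ge0 // ltW.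
  have h2 : 0 <= de * (eta * n%:R) by rewrite mulr_ge0 ?mulr_ge0 // ltW.
  have -> : (c0 + (1 / 2 + eta) * n%:R) * (2 - de) =
    2 * c0 - de * c0 + n%:R - de * n%:R / 2 + 2 * (eta * n%:R) - de * (eta * n%:R) by field.
  lra.
- by rewrite ler_peMr // powR2_ge1 // mulr_ge0 // subr_ge0; lra.
Qed.
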